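(* Let $\ell\ge1$ and let $\dot{\mathfrak g}=\{X\in M_{2\ell+3}(\mathbb C)\mid X^T=-X\}$, the simple Lie algebra of type $B_{\ell+1}$. Put $$\sigma_0=\mathrm{Ad}\Big(-E_{2\ell+3,2\ell+3}+\sum_{i=1}^{2\ell+2}E_{ii}\Big),\quad\sigma_1=\mathrm{Ad}\Big(-E_{2\ell+2,2\ell+2}+E_{2\ell+3,2\ell+3}+\sum_{i=1}^{2\ell+1}E_{ii}\Big).$$ Then $\dot{\mathfrak g}_{(\overline0,\overline0)}$ is the simple Lie algebra of type $B_\ell$ (with $B_1=A_1$); $\dot{\mathfrak g}_{(\overline0,\overline1)}$ and $\dot{\mathfrak g}_{(\overline1,\overline0)}$ are each a $(2\ell+1)$-dimensional irreducible representation of it, and $\dot{\mathfrak g}_{(\overline1,\overline1)}$ is one-dimensional. The set $R$ of non-isotropic roots of the twisted 2-toroidal Lie algebra $\mathfrak g(\sigma_0,\sigma_1)$ is, for $\ell\ge2$, the extended affine root system $B_\ell^{(2,2)*}$: $$R=\{\alpha+m\delta_0+n\delta_1\mid\alpha\in R(B_\ell)\text{ short},\ m,n\in\mathbb Z,\ mn\in2\mathbb Z\}\cup\{\alpha+2m\delta_0+2n\delta_1\mid\alpha\in R(B_\ell)\text{ long},\ m,n\in\mathbb Z\},$$ and for $\ell=1$ it is the extended affine root system $A_1^{(1,1)*}$: $$R=\{\alpha+m\delta_0+n\delta_1\mid\alpha\in R(A_1),\ m,n\in\mathbb Z,\ mn\in2\mathbb Z\}.$$ Here $R(B_\ell)$,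 resp. $R(A_1)$, is the root system of $\dot{\mathfrak g}_{(\overline0,\overline0)}$ with respect to its Cartan subalgebra $\dot{\mathfrak h}_{\overline0}$.
   Context: $E_{ij}$ are matrix units and $\mathrm{Ad}(A)(X)=AXA^{-1}$. Work over $\mathbb C$. Let $\dot{\mathfrak g}$ be a simple finite-dimensional Lie algebra with Killing form $(\cdot,\cdot)$, and $\sigma_0,\sigma_1$ commuting automorphisms of finite orders $n_0,n_1$ (order 1 allowed). Put $\epsilon_j=\exp(2\pi i/n_j)$ and, for $p,q\in\mathbb Z$, $\dot{\mathfrak g}_{(\overline p,\overline q)}=\{g\in\dot{\mathfrak g}\mid\sigma_0(g)=\epsilon_0^p g,\ \sigma_1(g)=\epsilon_1^q g\}$, where $\overline p=p \bmod n_0$, $\overline q=q\bmod n_1$. Let $\mathcal R=\mathbb C[t_0^{\pm1},t_1^{\pm1}]$, $\mathcal K=\Omega^1_{\mathcal R}/d\mathcal R$, $k_i=t_i^{-1}dt_i$, and let $\mathcal K(\Sigma)\subset\mathcal K$ be spanned by the elements $t_0^{n_0a}t_1^{n_1b}k_i$ ($a,b\in\mathbb Z$, $i=0,1$). The twisted 2-toroidal Lie algebra is $$\mathfrak g(\sigma_0,\sigma_1)=\bigoplus_{m,n\in\mathbb Z}\dot{\mathfrak g}_{(\overline m,\overline n)}\otimes t_0^mt_1^n\ \oplus\ \mathcal K(\Sigma)\ \oplus\ \mathbb Cd_0\oplus\mathbb Cd_1,$$ with bracket $[g_1\otimes f_1,g_2\otimes f_2]=[g_1,g_2]\otimes f_1f_2+(g_1,g_2)f_2\,df_1$;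 $\mathcal K(\Sigma)$ commutes with itself and with all $g\otimes f$; $d_j=t_j\partial/\partial t_j$ acts by $[d_j,g\otimes t_0^{r_0}t_1^{r_1}]=r_j\,g\otimes t_0^{r_0}t_1^{r_1}$, $[d_j,t_0^{r_0}t_1^{r_1}k_i]=r_j\,t_0^{r_0}t_1^{r_1}k_i$; and $[d_0,d_1]=0$. Let $\dot{\mathfrak h}_{\overline 0}$ be a Cartan subalgebra of the reductive algebra $\dot{\mathfrak g}_{(\overline 0,\overline 0)}$ and $\mathfrak h=\dot{\mathfrak h}_{\overline 0}\oplus\mathbb Cd_0\oplus\mathbb Cd_1\oplus\mathbb Ck_0\oplus\mathbb Ck_1$. Elements of $\dot{\mathfrak h}_{\overline 0}^*$ are extended to $\mathfrak h$ by $0$ on all $d_i,k_i$; $\delta_i\in\mathfrak h^*$ is defined by $\delta_i(d_j)=\delta_{ij}$ and zero on $\dot{\mathfrak h}_{\overline 0}$ and all $k_j$. Let $V=\dot{\mathfrak h}_{\overline 0}^*\oplus\mathbb C\delta_0\oplus\mathbb C\delta_1$ with the bilinear form $(\cdot,\cdot)_V$ which on $\dot{\mathfrak h}_{\overline 0}^*$ is dual to the restriction of the Killing form to $\dot{\mathfrak h}_{\overline 0}$ and has $\delta_0,\delta_1$ in its radical. Then $R$ is the set of $\beta\in V$ with $(\beta,\beta)_V\ne0$ whose weight space in $\mathfrak g(\sigma_0,\sigma_1)$ under the adjoint action of $\mathfrak h$ is nonzero. *)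

(* Defs.v *)
From HB Require Import structures.
From mathcomp Require Import all_boot all_order all_algebra.
From mathcomp Require Import ring_quotient generic_quotient complex.
From mathcomp Require Import boolp classical_sets functions cardinality fsbigop.
From mathcomp Require Import reals trigo.

Set Implicit Arguments.
Unset Strict Implicit.
Unset Printing Implicit Defensive.

Import Order.TTheory GRing.Theory Num.Theory.

Local Open Scope classical_set_scope.
Local Open Scope ring_scope.
Local Open Scope quotient_scope.

(* Finite-dimensional Lie algebras are Lie subalgebras of gl_N(F), that is,
   subspaces of 'M[F]_N closed under the commutator. *)
Section LieSubalgebras.
Variables (F : fieldType) (N : nat).
Implicit Types (U W I h : {vspace 'M[F]_N}) (X Y : 'M[F]_N).

Definition lie X Y : 'M[F]_N := X *m Y - Y *m X.

Definition lie_stable U W := forall X Y, X \in U -> Y \in W -> lie X Y \in W.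

Definition lie_subalgebra U := lie_stable U U.

Definition lie_ideal U I := (I <= U)%VS /\ lie_stable U I.

Definition lie_simple U :=
  [/\ lie_subalgebra U,
      exists X Y, [/\ X \in U, Y \in U & lie X Y != 0] &
      forall I, lie_ideal U I -> I = 0%VS \/ I = U].

Definition lie_irreducible U W :=
  [/\ lie_stable U W, W != 0%VS &
      forall W', (W' <= W)%VS -> lie_stable U W' -> W' = 0%VS \/ W' = W].

Definition lie_prod U W : {vspace 'M[F]_N} :=
  <<[seq lie X Y | X <- vbasis U, Y <- vbasis W]>>%VS.

Definition lie_nilpotent U := exists k, iter k (lie_prod U) U = 0%VS.

Definition cartan_subalgebra U h :=
  [/\ (h <= U)%VS, lie_subalgebra h, lie_nilpotent h &
      forall X, X \in U -> (forall Y, Y \in h -> lie X Y \in h) -> X \in h].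

(* Trace of (ad X) (ad Y) on U. *)
Definition killing U X Y : F :=
  \sum_(i < \dim U) coord (vbasis U) i (lie X (lie Y (vbasis U)`_i)).

Definition lie_automorphism U (s : 'End('M[F]_N)) :=
  [/\ (s @: U = U)%VS,
      {in U &, injective s} &
      {in U &, forall X Y, s (lie X Y) = lie (s X) (s Y)}].

Definition order_on U (s : 'End('M[F]_N)) n :=
  [/\ (0 < n)%N, {in U, forall X, iter n s X = X} &
      forall k, (0 < k < n)%N -> ~ {in U, forall X, iter k s X = X}].

Definition dual h : vectType F := 'Hom(subvs_of h, F^o).

Definition lie_roots U h : set (dual h) :=
  [set a : dual h | a != 0 /\
     exists X, [/\ X \in U, X != 0 &
       forall y : subvs_of h, lie (vsval y) X = a y *: X]].

(* t_a in h is the element with killing U t_a y = a y for all y in h. *)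
Definition killing_dual U h : 'Hom(dual h, subvs_of h) :=
  (linfun (fun x : subvs_of h =>
     linfun (fun y : subvs_of h =>
       (killing U (vsval x) (vsval y) : F^o)) : dual h))^-1%VF.

Definition dual_form U h (a b : dual h) : F :=
  killing U (vsval (killing_dual U h a)) (vsval (killing_dual U h b)).

End LieSubalgebras.

Arguments lie_roots {F N} U h _.
Arguments dual_form {F N} U h a b.

(* The set P is, up to a linear isomorphism, the standard root system
   {+-e_i} U {+-e_i +- e_j | i != j} of type B_l; this is A_1 for l = 1. *)
Definition root_system_B (F : fieldType) (V : vectType F) (l : nat)
    (P : set V) :=
  exists2 e : l.-tuple V, basis_of fullv e &
    P = [set a | exists (i : 'I_l) (s : bool), a = (-1) ^+ s *: e`_i] `|`
        [set a | exists (i j : 'I_l) (s t : bool),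
           i != j /\ a = (-1) ^+ s *: e`_i + (-1) ^+ t *: e`_j].

Definition simple_of_type_B (F : fieldType) (N l : nat)
    (U : {vspace 'M[F]_N}) :=
  [/\ lie_simple U, exists h, cartan_subalgebra U h &
      forall h, cartan_subalgebra U h -> root_system_B l (lie_roots U h)].

(* laurent V is V (x) F[t_0^{+-1}, t_1^{+-1}]: f stands for the sum of the
   f (r_0, r_1) (x) t_0^r_0 t_1^r_1. *)
Section Laurent.
Variables (F : fieldType) (V : lmodType F).

Definition finitely_supported : {pred (int * int -> V)} :=
  fun f => `[< finite_set [set r | f r != 0] >].

Lemma finitely_supported_submod : submod_closed finitely_supported.
Proof.
split=> [|a f g].
  apply/asboolP; apply: (@sub_finite_set _ _ set0) => //.
  by move=> r /=; rewrite eqxx.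
move=> /asboolP fin_f /asboolP fin_g; apply/asboolP.
apply: (@sub_finite_set _ _ ([set r | f r != 0] `|` [set r | g r != 0])).
  move=> r /= nz; case: (eqVneq (f r) 0) => [f0|]; last by left.
  right; apply: contraNneq nz => g0.
  by rewrite !fctE f0 g0 scaler0 addr0.
by rewrite finite_setU.
Qed.

HB.instance Definition _ :=
  GRing.isSubmodClosed.Build F (int * int -> V) finitely_supported
    finitely_supported_submod.

Record laurent := Laurent {
  lcoef :> int * int -> V;
  lcoefP : lcoef \in finitely_supported }.

HB.instance Definition _ := [isSub for lcoef].
HB.instance Definition _ := [Choice of laurent by <:].
HB.instance Definition _ := [SubChoice_isSubLmodule of laurent by <:].

Lemma finsupp_tmono (r : int * int) (v : V) :
  (fun s => if s == r then v else 0) \in finitely_supported.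
Proof.
apply/asboolP; apply: (@sub_finite_set _ _ [set r]) => //.
by move=> s /=; case: (s =P r) => // _; rewrite eqxx.
Qed.

(* v (x) t^r *)
Definition tmono r v := Laurent (finsupp_tmono r v).

Lemma finsupp_deriv (a : F * F) (f : laurent) :
  (fun r : int * int => (a.1 * r.1%:~R + a.2 * r.2%:~R) *: f r)
    \in finitely_supported.
Proof.
have /asboolP fin_f := lcoefP f; apply/asboolP.
apply: (sub_finite_set _ fin_f) => r /=; apply: contraNneq => ->.
by rewrite scaler0.
Qed.

(* The action of a_0 d_0 + a_1 d_1, where d_j = t_j d/dt_j. *)
Definition deriv a f := Laurent (finsupp_deriv a f).

End Laurent.

(* Omega^1 of the Laurent polynomial ring is free on k_j = t_j^-1 dt_j, so its
   elements are sums of t^r (c_0 k_0 + c_1 k_1); the quotient by the exact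
   forms is the space K. *)
Section Differentials.
Variable F : fieldType.

Definition omega1 := laurent (F^o * F^o)%type.
HB.instance Definition _ := GRing.Lmodule.on omega1.

Lemma finsupp_kahler_d (f : laurent F^o) :
  (fun r : int * int => ((r.1%:~R : F) *: f r, (r.2%:~R : F) *: f r))
    \in finitely_supported (V := (F^o * F^o)%type).
Proof.
have /asboolP fin_f := lcoefP f; apply/asboolP.
apply: (sub_finite_set _ fin_f) => r /=; apply: contraNneq => ->.
by rewrite !scaler0.
Qed.

(* d t^r = t^r (r_0 k_0 + r_1 k_1) *)
Definition kahler_d f : omega1 := Laurent (finsupp_kahler_d f).

Definition exact_form : {pred omega1} :=
  fun w => `[< exists f, w = kahler_d f >].

Lemma kahler_d_is_linear : linear kahler_d.
Proof.
move=> a f g; apply/val_inj/funext => r /=.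
by rewrite !fctE /= !scalerDr !scalerA ![_%:~R * a]mulrC -!scalerA.
Qed.

Lemma exact_form_submod : submod_closed exact_form.
Proof.
split=> [|a _ _ /asboolP[f ->] /asboolP[g ->]]; apply/asboolP.
  exists 0; rewrite -(subrr (0 : laurent F^o)) -scaleN1r addrC.
  by rewrite kahler_d_is_linear scaleN1r addNr.
by exists (a *: f + g); rewrite kahler_d_is_linear.
Qed.

HB.instance Definition _ :=
  GRing.isSubmodClosed.Build F omega1 exact_form exact_form_submod.

Definition kahler := Quotient.quot exact_form.
HB.instance Definition _ := GRing.Zmodule.on kahler.
HB.instance Definition _ := Quotient.on kahler.

Definition kclass (w : omega1) : kahler := \pi w.

Definition kahler_scale (a : F) (z : kahler) := kclass (a *: repr z).

Lemma kclassD : {morph kclass : w w' / w + w'}.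
Proof. by move=> w w'; rewrite /kclass Quotient.pi_add. Qed.

Lemma kclass_eq w w' : (kclass w == kclass w') = (w - w' \in exact_form).
Proof. by rewrite Quotient.idealrBE. Qed.

Lemma kclassK z : kclass (repr z) = z.
Proof. exact: reprK. Qed.

Lemma kclassZ a w : kclass (a *: w) = kahler_scale a (kclass w).
Proof.
apply/eqP; rewrite kclass_eq -scalerBr rpredZ // -kclass_eq.
by rewrite kclassK.
Qed.

Fact kahler_scaleA a b z :
  kahler_scale a (kahler_scale b z) = kahler_scale (a * b) z.
Proof. by rewrite -[z]kclassK -!kclassZ scalerA. Qed.

Fact kahler_scale1 : left_id 1 kahler_scale.
Proof. by move=> z; rewrite -[z]kclassK -kclassZ scale1r. Qed.

Fact kahler_scaleDr : right_distributive kahler_scale +%R.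
Proof.
by move=> a z z'; rewrite -[z]kclassK -[z']kclassK -!(kclassD, kclassZ) scalerDr.
Qed.

Fact kahler_scaleDl z : {morph kahler_scale^~ z : a b / a + b}.
Proof. by move=> a b; rewrite -[z]kclassK -!kclassZ scalerDl kclassD. Qed.

HB.instance Definition _ := GRing.Zmodule_isLmodule.Build F kahler
  kahler_scaleA kahler_scale1 kahler_scaleDr kahler_scaleDl.

(* a_0 d_0 + a_1 d_1 preserves exact forms, hence acts on K. *)
Definition kderiv (a : F * F) (z : kahler) : kahler := kclass (deriv a (repr z)).

End Differentials.

(* The twisted 2-toroidal Lie algebra is a subspace of the vector space
   gl_N (x) C[t_0^{+-1}, t_1^{+-1}] + K + C d_0 + C d_1, where a triple
   (x, z, a) stands for x + z + a_0 d_0 + a_1 d_1; its bracket is given by a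
   formula on the whole space, meaningful only on that subspace. *)
Section Toroidal.
Variables (R : realType) (N : nat).
Local Notation C := R[i].
Variables (g : {vspace 'M[C]_N}) (s0 s1 : 'End('M[C]_N)) (n0 n1 : nat).

(* exp (2 pi i / n) *)
Definition epsilonC (n : nat) : C :=
  Complex (cos (2 * pi / n%:R)) (sin (2 * pi / n%:R)).

Definition graded (p q : int) : {vspace 'M[C]_N} :=
  (g :&: passmx.leigenspace s0 (epsilonC n0 ^ p)
     :&: passmx.leigenspace s1 (epsilonC n1 ^ q))%VS.

Definition loop := laurent 'M[C]_N.
Definition ambient := (loop * kahler C * (C^o * C^o))%type.

(* [X (x) t^r, Y (x) t^s] = [X, Y] (x) t^(r + s) + (X, Y) t^s d(t^r), extended
   bilinearly. *)
Definition loop_bracket (x y : loop) : loop :=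
  \sum_(r \in [set: int * int]) \sum_(s \in [set: int * int])
    tmono (r + s) (lie (x r) (y s)).

Definition loop_cocycle (x y : loop) : kahler C :=
  \sum_(r \in [set: int * int]) \sum_(s \in [set: int * int])
    killing g (x r) (y s) *: kclass (tmono (r + s) (r.1%:~R, r.2%:~R)).

Definition toroidal_bracket (u v : ambient) : ambient :=
  let: (x, z, a) := u in let: (y, w, b) := v in
  (loop_bracket x y + deriv a y - deriv b x,
   loop_cocycle x y + kderiv a w - kderiv b z, 0).

(* Spanned by the classes of t_0^(n0 a) t_1^(n1 b) k_i. *)
Definition kahler_sigma : set (kahler C) :=
  [set z | exists e : seq (int * int * (C^o * C^o)),
     z = \sum_(c <- e) kclass (tmono (n0%:Z * c.1.1, n1%:Z * c.1.2) c.2)].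

Definition toroidal : set ambient :=
  [set u : ambient | (forall m n, u.1.1 (m, n) \in graded m n) /\
     kahler_sigma u.1.2].

Variable h : {vspace 'M[C]_N}.

(* y + a_0 d_0 + a_1 d_1 + c_0 k_0 + c_1 k_1 *)
Definition cartan_elt (y : subvs_of h) (a c : C^o * C^o) : ambient :=
  (tmono 0 (vsval y), kclass (tmono 0 c), a).

(* (a, (b_0, b_1)) stands for a + b_0 delta_0 + b_1 delta_1. *)
Definition weights := (dual h * (C^o * C^o))%type.

Definition weight_eval (beta : weights) (y : subvs_of h) (a : C^o * C^o) : C :=
  beta.1 y + beta.2.1 * a.1 + beta.2.2 * a.2.

Definition weight_form (beta gamma : weights) : C :=
  dual_form g h beta.1 gamma.1.

Definition weight_space (beta : weights) : set ambient :=
  [set u | toroidal u /\ forall y a c,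
     toroidal_bracket (cartan_elt y a c) u = weight_eval beta y a *: u].

Definition nonisotropic_roots : set weights :=
  [set beta | weight_form beta beta != 0 /\
     exists2 u, weight_space beta u & u != 0].

End Toroidal.

Arguments nonisotropic_roots {R N} g s0 s1 n0 n1 h _.

Section ExtendedAffineRootSystems.
Variables (C : numFieldType) (V : lmodType C) (form : V -> V -> C) (P : set V).

Definition short_roots : set V :=
  [set a | P a /\ forall b, P b -> form a a <= form b b].

Definition long_roots : set V :=
  [set a | P a /\ forall b, P b -> form b b <= form a a].

Definition delta_shift (a : V) (m n : int) : V * (C^o * C^o) :=
  (a, (m%:~R, n%:~R)).

(* B_l^(2,2)* for P of type B_l, l >= 2. *)
Definition ears_B22star : set (V * (C^o * C^o)) :=
  [set b | exists a m n,
     [/\ short_roots a, (2 %| m * n)%Z & b = delta_shift a m n]] `|`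
  [set b | exists a m n, long_roots a /\ b = delta_shift a (2 * m) (2 * n)].

(* A_1^(1,1)* for P of type A_1. *)
Definition ears_A11star : set (V * (C^o * C^o)) :=
  [set b | exists a m n, [/\ P a, (2 %| m * n)%Z & b = delta_shift a m n]].

End ExtendedAffineRootSystems.

Definition Ad (F : fieldType) (N : nat) (A : 'M[F]_N) : 'End('M[F]_N) :=
  linfun (fun X => A *m X *m invmx A).

Definition so (F : fieldType) (N : nat) : {vspace 'M[F]_N} :=
  lker (linfun (fun X : 'M[F]_N => X^T + X)).

Lemma memv_so (F : fieldType) (N : nat) (X : 'M[F]_N) :
  (X \in so F N) = (X^T == - X).
Proof.
pose f (Y : 'M[F]_N) := Y^T + Y.
have lf : linear f.
  by move=> a Y Z; rewrite /f linearP /= scalerDr addrACA.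
pose fL := GRing.isLinear.Build F _ _ _ f lf.
pose f' : {linear _ -> _} := HB.pack f fL.
by rewrite memv_ker (lfunE f') /= addr_eq0.
Qed.

Section Involutions.
Variables (F : fieldType) (l : nat).

(* Matrix units, with rows and columns numbered from 1. *)
Definition munit (i j : nat) : 'M[F]_(2 * l + 3) :=
  \matrix_(a, b) ((a.+1 == i) && (b.+1 == j))%:R.

Definition sigma0 : 'End('M[F]_(2 * l + 3)) :=
  Ad (- munit (2 * l + 3) (2 * l + 3) + \sum_(1 <= i < 2 * l + 3) munit i i).

Definition sigma1 : 'End('M[F]_(2 * l + 3)) :=
  Ad (- munit (2 * l + 2) (2 * l + 2) + munit (2 * l + 3) (2 * l + 3)
      + \sum_(1 <= i < 2 * l + 2) munit i i).

End Involutions.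

(* Main.v *)
Require Import Defs.
Set Warnings "-all".
From HB Require Import structures.
From mathcomp Require Import all_boot all_order all_algebra.
From mathcomp Require Import complex ring zify.
From mathcomp Require Import boolp classical_sets functions cardinality fsbigop reals trigo.

(** A Cartan subalgebra h of so_k, k = 2m + 1, is first shown to be toral. The
    semisimple part of X in h is an odd polynomial in X, hence antisymmetric; it
    commutes with h because ad X is nilpotent on h, and it lies in h because h is
    self-normalizing. For t in h semisimple with the smallest possible centralizer,
    h acts nilpotently on the centralizer of t, so Engel's theorem makes the two
    equal. Since t is antisymmetric and diagonalizable, C^k has a basis of
    eigenvectors b_0, b_(+-1), ..., b_(+-m) in which b_i is orthogonal to b_j unless
    j = -i; nilpotency of h forces the eigenvalues to be distinct, so h is spanned
    by the b_i ^ b_(-i). In this basis the weights of h on so_k, and on the k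
    dimensional spaces of the v ^ e with e a fixed coordinate vector outside C^k,
    can be read off. Up to the factor 2 (N - 2) the Killing form of so_N makes the
    coroots orthonormal, which separates short from long roots.

    The commuting sign changes split so_(2l+3) as so_(2l+1), two spaces v ^ e, and
    a line on which so_(2l+1) acts trivially. A weight vector of the toroidal algebra
    whose weight does not vanish on h lies in the loop part, so the non-isotropic
    roots come from the weights of h on these four pieces. *)

Set Implicit Arguments.
Unset Strict Implicit.
Unset Printing Implicit Defensive.

Import Order.TTheory GRing.Theory Num.Theory.

Local Open Scope ring_scope.

(** * Commutators and nilpotent operators *)

(** The statement quantifies over all nilpotent self-normalizing [h], so no standard torus can be
    fixed: the basis of eigenvectors is built from the given [h], and roots and weights are then
    read off through that basis. The scalar product is the bilinear x y^T, so eigenvectors of an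
    antisymmetric matrix for nonzero eigenvalues are isotropic and pair only with those for the
    opposite eigenvalue. This forces the hyperbolic shape, and the oddness of k leaves one
    anisotropic vector b_0, which produces the short roots. Both so_N and its fixed algebra are
    treated as antisymmetric matrices of size N supported on the first k coordinates, with k = N and
    k = N - 2, so that simplicity, Cartan subalgebras and roots are handled once. The Killing form
    is nevertheless that of so_N, which is why its constant involves N and not k. *)

Section Nilpotent.
Variables (V : zmodType).

Lemma iter_morph0 (f : V -> V) k : f 0 = 0 -> iter k f 0 = 0.
Proof. by move=> f0; elim: k => //= k ->. Qed.

Lemma iter_comm (f g : V -> V) j k x :
  (forall x, f (g x) = g (f x)) -> iter j f (iter k g x) = iter k g (iter j f x).
Proof.
move=> fg; have fgk m y : f (iter m g y) = iter m g (f y).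
  by elim: m => //= m IH; rewrite fg IH.
by elim: j => //= j ->; rewrite fgk.
Qed.

(** A binomial argument without coefficients: expanding [j + k] factors [f - g] leaves words with at
    least [j] letters [f] or at least [k] letters [g]. *)
Lemma iter_sub_eq0 (f g h : V -> V) x j k :
    {morph f : x y / x - y} -> {morph g : x y / x - y} ->
    (forall x, h x = f x - g x) -> (forall x, f (g x) = g (f x)) ->
  iter j f x = 0 -> iter k g x = 0 -> iter (j + k) h x = 0.
Proof.
move=> fB gB hE fg fx gx.
have f0 : f 0 = 0 by have := fB 0 0; rewrite !subrr.
have g0 : g 0 = 0 by have := gB 0 0; rewrite !subrr.
have hB : {morph h : x y / x - y}.
  by move=> y z; rewrite !hE fB gB !opprD !opprK addrACA.
have hB' m : {morph iter m h : x y / x - y} by elim: m => // m IH y z /=; rewrite IH hB.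
(* [m] factors remain to be expanded; [a] and [b] count the letters already produced. *)
suff H m a b : (j + k <= m + a + b)%N -> iter m h (iter a f (iter b g x)) = 0.
  by apply: (H (j + k)%N 0%N 0%N); rewrite !addn0.
elim: m a b => [|m IH] a b /=; last first.
  rewrite -iterS iterSr hE hB' => le.
  rewrite -[f _]/(iter a.+1 f _) IH ?addnS//.
  have -> : g (iter a f (iter b g x)) = iter a f (iter b.+1 g x).
    by rewrite (@iter_comm f g a b.+1) // iterS -(@iter_comm f g a b).
  by rewrite IH ?subrr // !addnS.
rewrite add0n => le; case: (leqP j a) => ja.
  by rewrite iter_comm // -(subnK ja) iterD fx !iter_morph0.
have kb : (k <= b)%N by lia.
by rewrite -(subnK kb) iterD gx !iter_morph0.
Qed.

End Nilpotent.

Section LieCalculus.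
Variables (F : fieldType) (n : nat).
Implicit Types X Y Z A B : 'M[F]_n.

Lemma lieDr X Y Z : lie X (Y + Z) = lie X Y + lie X Z.
Proof. by rewrite /lie mulmxDr mulmxDl opprD addrACA. Qed.
Lemma lieNr X Y : lie X (- Y) = - lie X Y.
Proof. by rewrite /lie mulmxN mulNmx opprB opprK addrC. Qed.
Lemma lieBr X Y Z : lie X (Y - Z) = lie X Y - lie X Z.
Proof. by rewrite lieDr lieNr. Qed.
Lemma lieZr X c Y : lie X (c *: Y) = c *: lie X Y.
Proof. by rewrite /lie -scalemxAr -scalemxAl scalerBr. Qed.
Lemma lie0r X : lie X 0 = 0. Proof. by rewrite /lie mulmx0 mul0mx subrr. Qed.
Lemma lieC X Y : lie X Y = - lie Y X. Proof. by rewrite /lie opprB. Qed.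
Lemma lie0l X : lie 0 X = 0. Proof. by rewrite lieC lie0r oppr0. Qed.
Lemma lieDl X Y Z : lie (X + Y) Z = lie X Z + lie Y Z.
Proof. by rewrite lieC lieDr opprD -!lieC. Qed.
Lemma lieNl X Y : lie (- X) Y = - lie X Y.
Proof. by rewrite lieC lieNr -lieC. Qed.
Lemma lieBl X Y Z : lie (X - Y) Z = lie X Z - lie Y Z.
Proof. by rewrite lieDl lieNl. Qed.
Lemma lieZl X c Y : lie (c *: X) Y = c *: lie X Y.
Proof. by rewrite lieC lieZr -scalerN -lieC. Qed.
Lemma lie_suml (I : Type) (r : seq I) P (E : I -> 'M[F]_n) Z :
  lie (\sum_(i <- r | P i) E i) Z = \sum_(i <- r | P i) lie (E i) Z.
Proof.
by apply: (big_rec2 (fun A B => lie A Z = B)) => [|i A B _ <-]; rewrite ?lieDl ?lie0l.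
Qed.
Lemma lie_sumr (I : Type) (r : seq I) P (E : I -> 'M[F]_n) Z :
  lie Z (\sum_(i <- r | P i) E i) = \sum_(i <- r | P i) lie Z (E i).
Proof.
by apply: (big_rec2 (fun A B => lie Z A = B)) => [|i A B _ <-]; rewrite ?lieDr ?lie0r.
Qed.

Lemma jacobi X Y Z : lie X (lie Y Z) = lie (lie X Y) Z + lie Y (lie X Z).
Proof.
rewrite /lie !mulmxBr !mulmxBl !mulmxA.
by apply/matrixP => i j; rewrite !mxE; ring.
Qed.

Lemma trmx_lie X Y : (lie X Y)^T = - lie X^T Y^T.
Proof. by rewrite /lie linearB /= !trmx_mul opprB. Qed.

(** [lie X] is the difference of left and right multiplication by [X], two commuting operators whose
    [k]-th powers vanish. *)
Lemma ad_nilpotent X Y k : X ^+ k = 0 -> iter (k + k) (lie X) Y = 0.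
Proof.
move=> Xk.
apply: (@iter_sub_eq0 _ (mulmx X) (mulmx^~ X)) => //.
- by move=> A B; rewrite mulmxBr.
- by move=> A B; rewrite mulmxBl.
- by move=> A; rewrite mulmxA.
- have -> m : iter m (mulmx X) Y = X ^+ m *m Y; last by rewrite Xk mul0mx.
  by elim: m => [|m IH] /=; rewrite ?mul1mx// IH exprS mulmxA.
- have -> m : iter m (mulmx^~ X) Y = Y *m X ^+ m; last by rewrite Xk mulmx0.
  by elim: m => [|m IH] /=; rewrite ?mulmx1// IH exprSr mulmxA.
Qed.

(** By the Jacobi identity commuting matrices have commuting [lie] operators, so nilpotency at [Y]
    survives the subtraction of a nilpotent [A]. *)
Lemma iter_lieB X A Y j k : X *m A = A *m X ->
  iter j (lie X) Y = 0 -> A ^+ k = 0 -> iter (j + (k + k)) (lie (X - A)) Y = 0.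
Proof.
move=> XA XY Ak; apply: (@iter_sub_eq0 _ (lie X) (lie A)) => //.
- exact: lieBr.
- exact: lieBr.
- by move=> Z; rewrite lieBl.
- by move=> Z; rewrite jacobi [lie X A]/lie XA subrr lie0l add0r.
- exact: ad_nilpotent.
Qed.

(** In an eigenbasis of [X] the operator [lie X] multiplies each entry by a difference of
    eigenvalues, so its generalized kernel is its kernel. *)
Lemma lie_diag_eq0 X Y k : diagonalizable X ->
  iter k (lie X) Y = 0 -> lie X Y = 0.
Proof.
case=> P Pu /similar_diagPex[D /(similarP Pu) PX].
have XE : X = invmx P *m diag_mx D *m P by rewrite -mulmxA -PX mulKmx.
pose c Z := P *m Z *m invmx P.
have cX Z : c (lie X Z) = lie (diag_mx D) (c Z).
  by rewrite /lie /c mulmxBr mulmxBl XE !mulmxA mulmxV // mul1mx !mulmxK // mulmxKV.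
have cI Z : c Z = 0 -> Z = 0.
  move=> /(congr1 (fun Z => invmx P *m Z *m P)).
  by rewrite /c !mulmxA mulVmx // mul1mx mulmxKV // mulmx0 mul0mx.
have ciX m : c (iter m (lie X) Y) = iter m (lie (diag_mx D)) (c Y).
  by elim: m => //= m IH; rewrite cX IH.
have lieD Z i j : lie (diag_mx D) Z i j = (D 0 i - D 0 j) * Z i j.
  rewrite /lie mul_diag_mx mul_mx_diag !mxE; ring.
have itD m Z i j : iter m (lie (diag_mx D)) Z i j = (D 0 i - D 0 j) ^+ m * Z i j.
  by elim: m => [|m IH] /=; rewrite ?mul1r// lieD IH exprS mulrA.
move=> /(congr1 c); rewrite ciX {2}/c mulmx0 mul0mx => /matrixP H.
apply: cI; rewrite cX; apply/matrixP => i j; rewrite lieD.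
have /eqP : (D 0 i - D 0 j) ^+ k * c Y i j = 0 by rewrite -itD H mxE.
rewrite [RHS]mxE.
by rewrite mulf_eq0 expf_eq0 => /orP[/andP[_ /eqP->]|/eqP->]; rewrite ?mul0r ?mulr0.
Qed.

End LieCalculus.

(** * Jordan decomposition *)

Section Jordan.
Variables (F : fieldType).

(** Chinese remainder theorem for the moduli (X - a)^k; with [rs] the eigenvalues and [k] large, [p]
    evaluated at a matrix is its semisimple part. *)
Lemma crt_roots (rs : seq F) k : uniq rs ->
  exists p : {poly F}, forall a, a \in rs -> ('X - a%:P) ^+ k %| p - a%:P.
Proof.
elim: rs => [|b rs IH] /=; first by exists 0.
case/andP=> brs /IH[p pP].
pose A := \prod_(a <- rs) ('X - a%:P) ^+ k; pose B := ('X - b%:P) ^+ k.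
have : coprimep A B.
  rewrite /A; elim: rs brs {IH pP A} => [|a rs IH]; first by rewrite big_nil coprime1p.
  rewrite inE negb_or big_cons coprimepMl => /andP[ba /IH ->].
  by rewrite andbT coprimep_expl // coprimep_expr // coprimep_XsubC root_XsubC.
case/Bezout_eq1_coprimepP=> -[c d] /= cd.
(* [d * B] is 1 modulo [A] and 0 modulo [B], and [c * A] the reverse, so this is [p] modulo [A] and
   [b] modulo [B]. *)
exists (p * (d * B) + b%:P * (c * A)) => a; rewrite inE => /predU1P[->|ars].
  have -> : p * (d * B) + b%:P * (c * A) - b%:P = d * (p - b%:P) * B.
    by have -> : c * A = 1 - d * B by [rewrite -cd addrK]; ring.
  exact: dvdp_mull.
have -> : p * (d * B) + b%:P * (c * A) - a%:P = (p - a%:P) + c * (b%:P - p) * A.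
  by have -> : d * B = 1 - c * A by [rewrite -cd addrAC subrr add0r]; ring.
rewrite dvdp_add ?pP // dvdp_mull // /A (perm_big _ (perm_to_rem ars)) big_cons.
exact: dvdp_mulr.
Qed.

Lemma dvdp_prod_exp (I : eqType) (r : seq I) (f g : I -> {poly F}) k :
  (forall i, i \in r -> f i ^+ k %| g i) ->
  (\prod_(i <- r) f i) ^+ k %| \prod_(i <- r) g i.
Proof.
elim: r => [|i r IH] H; first by rewrite !big_nil expr1n dvdpp.
rewrite !big_cons exprMn dvdp_mul ?H ?mem_head // IH // => j jr.
by rewrite H // inE jr orbT.
Qed.

End Jordan.

Section JordanOdd.
Variables (C : numClosedFieldType) (n : nat).
Implicit Type A : 'M[C]_n.+1.

Lemma horner_mx_comp A (p q : {poly C}) :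
  horner_mx (horner_mx A q) p = horner_mx A (p \Po q).
Proof.
elim/poly_ind: p => [|p c IH]; first by rewrite comp_poly0 !rmorph0.
by rewrite comp_polyD comp_polyM comp_polyX comp_polyC !(rmorphD, rmorphM) /=
           !horner_mx_C horner_mx_X IH.
Qed.

Lemma diagonalizable_annihilated A (rs : seq C) : uniq rs ->
  horner_mx A (\prod_(a <- rs) ('X - a%:P)) = 0 -> diagonalizable A.
Proof. by move=> urs A0; apply/diagonalizableP; exists rs; rewrite // mxminpoly_min. Qed.

(* Oddness of q makes the semisimple part antisymmetric when A is, and makes it
   kill the row vectors killed by A. *)
Lemma jordan_odd A : exists q k,
  [/\ q \Po (- 'X) = - q, diagonalizable (horner_mx A q) &
      (A - horner_mx A q) ^+ k = 0].
Proof.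
have [r chE] := closed_field_poly_normal (char_poly A).
rewrite (monicP (char_poly_monic A)) scale1r in chE.
(* Adjoining the negatives makes the set of roots stable under sign, so that -p(-X) satisfies the
   same congruences as [p] and their mean [q] is odd. *)
pose rs := undup (r ++ map -%R r); pose B := \prod_(a <- rs) ('X - a%:P).
have rsN a : a \in rs -> - a \in rs.
  rewrite !mem_undup !mem_cat => /orP[ar|/mapP[b br ->]]; last by rewrite opprK br.
  by rewrite map_f ?orbT.
pose k := (size r).+1.
have Bk : horner_mx A (B ^+ k) = 0.
  suff /dvdpP[p ->] : char_poly A %| B ^+ k.
    by rewrite rmorphM /= Cayley_Hamilton mulr0.
  rewrite chE /k exprS dvdp_mull //.
  have : {subset r <= rs} by move=> a ar; rewrite mem_undup mem_cat ar.
  elim: (r) => [|a s IH] sub; first by rewrite big_nil expr0 dvdpp.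
  rewrite big_cons exprS dvdp_mul ?IH //.
    rewrite /B (perm_big _ (perm_to_rem (sub _ (mem_head _ _)))) big_cons.
    by rewrite dvdp_mulr.
  by move=> b bs; rewrite sub // inE bs orbT.
have dvd0 p : B ^+ k %| p -> horner_mx A p = 0.
  by case/dvdpP=> c ->; rewrite rmorphM /= Bk mulr0.
have [p pP] := @crt_roots C rs k (undup_uniq _).
pose q := 2^-1 *: (p - (p \Po (- 'X))).
have XN : - 'X \Po (- 'X) = 'X :> {poly C} by rewrite raddfN /= comp_polyX opprK.
have n2 : (2 : C) != 0 by rewrite pnatr_eq0.
have qP a : a \in rs -> ('X - a%:P) ^+ k %| q - a%:P.
  move=> ars; have -> : q - a%:P = 2^-1 *: ((p - a%:P) - ((p \Po (- 'X)) + a%:P)).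
    rewrite /q; set p' := p \Po (- 'X).
    have -> : p - a%:P - (p' + a%:P) = p - p' - a%:P *+ 2 by ring.
    have -> : a%:P *+ 2 = (2 : C) *: a%:P by rewrite scaler_nat.
    by rewrite [RHS]scalerBr scalerA mulVf // scale1r.
  rewrite dvdpZr ?invr_eq0 // dvdp_sub ?pP //.
  have /dvdpP[c cE] := pP _ (rsN _ ars).
  have -> : (p \Po (- 'X)) + a%:P = (p - (- a)%:P) \Po (- 'X).
    by rewrite rmorphB /= comp_polyC polyCN opprK.
  rewrite cE comp_polyM dvdp_mull // rmorphXn /= rmorphB /= comp_polyX comp_polyC.
  have -> : - 'X - (- a)%:P = - ('X - a%:P) by rewrite polyCN opprK opprB addrC.
  by rewrite exprNn dvdp_mull.
(* Each X - a divides X - q, so [B] divides (X - q)^(size rs), and [B ^+ k] annihilates [A]. *)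
exists q, (k * size rs)%N; split.
- rewrite comp_polyZ rmorphB /= -comp_polyA XN comp_polyXr -scalerN opprB.
  by [].
- apply: (@diagonalizable_annihilated _ rs); first exact: undup_uniq.
  rewrite horner_mx_comp dvd0 // rmorph_prod /=.
  by apply: dvdp_prod_exp => a ars; rewrite rmorphB /= comp_polyX comp_polyC qP.
have -> : A - horner_mx A q = horner_mx A ('X - q).
  by rewrite rmorphB /= horner_mx_X.
rewrite -rmorphXn /=; apply: dvd0.
rewrite mulnC exprM dvdp_exp2r //.
have H a : a \in rs -> ('X - a%:P) ^+ 1 %| 'X - q.
  move=> ars; have -> : 'X - q = ('X - a%:P) - (q - a%:P) by ring.
  by rewrite dvdp_sub // (dvdp_trans _ (qP _ ars)) // dvdp_exp2l.
have := @dvdp_prod_exp _ _ rs (fun a => 'X - a%:P) (fun=> 'X - q) 1 H.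
by rewrite expr1 big_const_seq count_predT iter_mulr_1.
Qed.

End JordanOdd.

(** * Cartan subalgebras are centralizers of semisimple elements *)

Section LieSubspaces.
Variables (F : fieldType) (n : nat).
Implicit Types (U W h : {vspace 'M[F]_n}) (X Y : 'M[F]_n).

Lemma lie_is_linear X : linear (lie X).
Proof. by move=> a Y Z; rewrite lieDr lieZr. Qed.
HB.instance Definition _ X := GRing.isLinear.Build F _ _ _ (lie X) (lie_is_linear X).

Lemma mem_lie_prod U W X Y : X \in U -> Y \in W -> lie X Y \in lie_prod U W.
Proof.
move=> XU YW; rewrite (coord_vbasis XU) (coord_vbasis YW) lie_suml.
apply: memv_suml => i _; rewrite lie_sumr; apply: memv_suml => j _.
rewrite lieZl lieZr !rpredZ //; apply: memv_span; apply/allpairsP.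
exists ((vbasis U)`_i, (vbasis W)`_j); by split; rewrite //= mem_nth // size_tuple.
Qed.

Lemma lie_prod_subl U W : lie_stable U W -> (lie_prod U W <= W)%VS.
Proof.
move=> UW; apply/span_subvP => _ /allpairsP[[X Y] [/vbasis_mem XU /vbasis_mem YW ->]].
exact: UW.
Qed.

Lemma lcs_ideal U j : lie_subalgebra U ->
  (iter j (lie_prod U) U <= U)%VS /\ lie_stable U (iter j (lie_prod U) U).
Proof.
move=> UU; elim: j => [|j [sub st]] /=; first by split; [exact: subvv | exact: UU].
have s := lie_prod_subl st; split; first exact: subv_trans s sub.
by move=> X Y XU /(subvP s) YD; exact: mem_lie_prod.
Qed.

Lemma nilpotent_ad U : lie_subalgebra U -> lie_nilpotent U ->
  exists k, forall X Y, X \in U -> Y \in U -> iter k (lie X) Y = 0.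
Proof.
move=> UU [k Uk]; exists k => X Y XU YU; apply/eqP; rewrite -memv0 -Uk.
by elim: (k) => //= j IH; exact: mem_lie_prod.
Qed.

(* Engel's theorem for the action of a nilpotent algebra h on W / h. *)
Lemma nilpotent_normalizer h (W : 'M[F]_n -> Prop) :
    lie_subalgebra h -> lie_nilpotent h ->
    (forall X w, X \in h -> W w -> W (lie X w)) ->
    (forall X w, X \in h -> W w -> exists m, iter m (lie X) w = 0) ->
    (exists2 w, W w & w \notin h) ->
  exists w, [/\ W w, w \notin h & forall X, X \in h -> lie X w \in h].
Proof.
move=> hh [K hK] Wst Wnil [w0 Ww0 hw0].
pose D j := iter j (lie_prod h) h.
(* Candidates are predicates, not subspaces: besides inclusion in [W], only stability under [h] and
   an element outside [h] are carried along. *)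
pose good (S : 'M[F]_n -> Prop) :=
  [/\ exists2 w, S w & w \notin h, forall w, S w -> W w &
      forall X w, X \in h -> S w -> S (lie X w)].
suff [S [[[w Sw hw] SW _] SD]] : exists S, good S /\
    (forall X w, X \in D 0%N -> S w -> lie X w \in h).
  by exists w; split=> // [|X Xh]; [exact: SW | exact: SD].
have -> : 0%N = (K - K)%N by rewrite subnn.
(* Climb the lower central series from its zero term back to [h]: at stage [j] the term of index
   [K - j] maps [S] into [h]. *)
elim: {1 4}K (leqnn K) => [|j IH] jK.
  exists W; split; first by split=> //; exists w0.
  by move=> X w; rewrite subn0 /D hK memv0 => /eqP-> _; rewrite lie0l mem0v.
have [S [Sg SD]] := IH (ltnW jK).
have jE : (K - j = (K - j.+1).+1)%N by lia.
rewrite jE in SD; move: (K - j.+1)%N SD => i SD.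
have [Dh Dst] := lcs_ideal i hh.
have [S' [S'g S'S S'D]] : exists S', [/\ good S', forall w, S' w -> S w &
    forall X w, X \in (vbasis (D i) : seq _) -> S' w -> lie X w \in h].
  have : {subset (vbasis (D i) : seq _) <= D i} by move=> X; exact: vbasis_mem.
  elim: (vbasis (D i) : seq _) => [_|a l IHl lD]; first by exists S.
  have aD : a \in D i by rewrite lD ?mem_head.
  have ah := subvP Dh _ aD.
  have [|S' [[[w S'w hw] S'W S'st] S'S S'l]] := IHl.
    by move=> X Xl; rewrite lD // inE Xl orbT.
  (* Stability of this smaller set holds because [a, X] lies in the next term of the series, which
     already maps [S] into [h]. *)
  exists (fun w => S' w /\ lie a w \in h); split; last 2 first.
  - by move=> z [/S'S].
  - by move=> X z; rewrite inE => /predU1P[->|Xl] [S'z az] //; exact: S'l.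
  split.
  (* The last iterate of [lie a] still outside [h] is the required element. *)
  - have [m am] := Wnil _ _ ah (S'W _ S'w).
    have ex : exists p, iter p (lie a) w \in h by exists m; rewrite am mem0v.
    case: (ex_minnP ex) => -[|p]; first by rewrite (negPf hw).
    move=> ph pmin; exists (iter p (lie a) w); last first.
      by apply/negP => /pmin; rewrite ltnn.
    split=> //; elim: (p) => //= q; exact: S'st.
  - by move=> z [/S'W].
  - move=> X z Xh [S'z az]; split; first exact: S'st.
    rewrite jacobi rpredD //; [apply: SD (S'S _ S'z)|exact: hh].
    by rewrite lieC rpredN; exact: mem_lie_prod.
exists S'; split=> // X w XD S'w.
rewrite (coord_vbasis XD) lie_suml; apply: memv_suml => b _.
by rewrite lieZl rpredZ // S'D // mem_nth // size_tuple.
Qed.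

End LieSubspaces.

Section AntisymmetricBlock.
Variables (F : fieldType) (N : nat).

(* so_k acting on the first k coordinates: for an antisymmetric matrix it is
   enough that the rows from k on vanish. *)
Definition so_block (k : nat) : {pred 'M[F]_N} := fun X =>
  (X^T == - X) && [forall i : 'I_N, forall j, (k <= i)%N ==> (X i j == 0)].

Lemma so_blockP k X :
  reflect (X^T = - X /\ forall i j : 'I_N, (k <= i)%N -> X i j = 0) (X \in so_block k).
Proof.
apply: (iffP andP) => -[/eqP XT X0].
  by split=> // i j ki; apply/eqP; move: X0 => /forallP/(_ i)/forallP/(_ j)/implyP/(_ ki).
by split=> //; apply/forallP=> i; apply/forallP=> j; apply/implyP=> /X0->.
Qed.

Lemma so_block_lie k X Y :
  X \in so_block k -> Y \in so_block k -> lie X Y \in so_block k.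
Proof.
move=> /so_blockP[XT X0] /so_blockP[YT Y0]; apply/so_blockP; split.
  by rewrite trmx_lie XT YT lieNl lieNr opprK.
move=> i j ki; rewrite /lie !mxE !big1 ?subrr // => a _.
- by rewrite Y0 ?mul0r.
- by rewrite X0 ?mul0r.
Qed.

End AntisymmetricBlock.

Section Toral.
Variables (C : numClosedFieldType) (n : nat).
Implicit Types (A X Y : 'M[C]_n.+1).

Lemma horner_mx_comm A p : A *m horner_mx A p = horner_mx A p *m A.
Proof. by rewrite -{1 4}[A]horner_mx_X -![_ *m _]rmorphM mulrC. Qed.

Lemma trmx_horner A p : (horner_mx A p)^T = horner_mx A^T p.
Proof.
elim/poly_ind: p => [|p c IH]; first by rewrite !rmorph0 trmx0.
rewrite !(rmorphD, rmorphM) /= !horner_mx_C !horner_mx_X linearD /= tr_scalar_mx.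
rewrite trmx_mul IH; by rewrite horner_mx_comm.
Qed.

Lemma horner_mx_eigen A (v : 'rV_n.+1) a p :
  v *m A = a *: v -> v *m horner_mx A p = p.[a] *: v.
Proof.
move=> vA; elim/poly_ind: p => [|p c IH].
  by rewrite !rmorph0 mulmx0 horner0 scale0r.
rewrite !(rmorphD, rmorphM) /= !horner_mx_C !horner_mx_X hornerMXaddC.
by rewrite mulmxDr mulmxA IH -scalemxAl vA scalerA mul_mx_scalar scalerDl.
Qed.

Lemma exists_notin (s : seq C) : exists c, c \notin s.
Proof.
exists (1 + \sum_(x <- s) `|x|); set c := 1 + _.
have c0 : 0 < c by rewrite ltr_pwDl // sumr_ge0.
apply/negP => cs; have : `|c| <= \sum_(x <- s) `|x|.
  by rewrite (perm_big _ (perm_to_rem cs)) big_cons lerDl sumr_ge0.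
by rewrite gtr0_norm // /c gerDr ler10.
Qed.

(** A generic combination of commuting diagonalizable matrices has the common centralizer: [c]
    avoids the finitely many values at which distinct pairs of eigenvalues collide. *)
Lemma toral_pair A B : diagonalizable A -> diagonalizable B -> A *m B = B *m A ->
  exists c, diagonalizable (A + c *: B) /\
    forall Y, lie (A + c *: B) Y = 0 -> lie A Y = 0 /\ lie B Y = 0.
Proof.
move=> dA dB AB.
have [|P Pu] := (codiagonalizableP [:: A; B]).1.
  split; last by move=> f; rewrite !inE => /orP[] /eqP->.
  by move=> f g; rewrite !inE => /orP[] /eqP-> /orP[] /eqP->; rewrite /comm_mx.
rewrite /= andbT => /andP[/similar_diagPex[D /(similarP Pu) PA] /similar_diagPex[E /(similarP Pu) PB]].
have [c cP] := exists_notin [seq - (D 0 ij.1 - D 0 ij.2) / (E 0 ij.1 - E 0 ij.2) | ij <- enum {: 'I_n.+1 * 'I_n.+1}].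
have PX (X : 'M_n.+1) G : P *m X = diag_mx G *m P -> X = invmx P *m diag_mx G *m P.
  by move=> PX; rewrite -mulmxA -PX mulKmx.
have lieP (X : 'M_n.+1) G Y : P *m X = diag_mx G *m P ->
    (lie X Y = 0 <-> forall i j, (G 0 i - G 0 j) * (P *m Y *m invmx P) i j = 0).
  move=> PXG; pose Z := P *m Y *m invmx P.
  have lieD i j : lie (diag_mx G) Z i j = (G 0 i - G 0 j) * Z i j.
    by rewrite /lie mul_diag_mx mul_mx_diag !mxE; ring.
  have cE : P *m lie X Y *m invmx P = lie (diag_mx G) Z.
    rewrite /lie mulmxBr mulmxBl (PX _ _ PXG) /Z.
    by rewrite !mulmxA mulmxV // mul1mx !mulmxK // mulmxKV.
  split=> [XY i j|H]; first by rewrite -lieD -cE XY mulmx0 mul0mx mxE.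
  have : lie (diag_mx G) Z = 0 by apply/matrixP => i j; rewrite lieD H mxE.
  rewrite -cE => /(congr1 (fun Z => invmx P *m Z *m P)).
  by rewrite !mulmxA mulVmx // mul1mx mulmxKV // mulmx0 mul0mx.
have PAB : P *m (A + c *: B) = diag_mx (D + c *: E) *m P.
  by rewrite mulmxDr -scalemxAr PA PB linearD linearZ /= mulmxDl -scalemxAl.
exists c; split.
  by exists P => //; apply/similar_diagPex; exists (D + c *: E); apply/(similarP Pu).
move=> Y /(lieP _ _ _ PAB) H.
have K i j : (P *m Y *m invmx P) i j = 0 \/ D 0 i = D 0 j /\ E 0 i = E 0 j.
  have /eqP := H i j; rewrite mulf_eq0 => /orP[|/eqP]; last by left.
  rewrite !mxE => H0; have {}H0 : (D 0 i - D 0 j) + c * (E 0 i - E 0 j) = 0.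
    by move/eqP: H0 => <-; ring.
  have [eE|nE] := eqVneq (E 0 i - E 0 j) 0.
    by right; move: H0; rewrite eE mulr0 addr0 => /eqP; rewrite subr_eq0 => /eqP; split=> //; apply/eqP; rewrite -subr_eq0 eE.
  case/negP: cP; apply/mapP; exists (i, j); rewrite ?mem_enum //=.
  by apply: (canRL (mulfK nE)); move/eqP: H0; rewrite addrC addr_eq0 => /eqP.
split; [apply/(lieP _ _ _ PA)|apply/(lieP _ _ _ PB)] => i j.
  by case: (K i j) => [->|[-> _]]; rewrite ?mulr0 // subrr mul0r.
by case: (K i j) => [->|[_ ->]]; rewrite ?mulr0 // subrr mul0r.
Qed.

Lemma cartan_toral k (U h : {vspace 'M[C]_n.+1}) :
    U =i so_block k -> cartan_subalgebra U h ->
  exists t, [/\ t \in h, diagonalizable t &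
    forall X, (X \in h) = (X \in U) && (lie t X == 0)].
Proof.
move=> UE [/subvP hU hh hnil hN].
pose toral t := [/\ t \in h, diagonalizable t & forall Y, Y \in h -> lie t Y = 0].
have jordan X : X \in h ->
    exists S, toral S /\ exists m, (X - S) ^+ m = 0.
  move=> Xh; have [q [m [qN qD qm]]] := jordan_odd X.
  pose S := horner_mx X q; exists S; split; last by exists m.
  (* [lie S] is nilpotent at [Y], being [lie X] minus the operator of the commuting nilpotent X - S;
     diagonalizability of [S] then gives zero. *)
  have SY Y : Y \in h -> lie S Y = 0.
    move=> Yh; have [p pP] := nilpotent_ad hh hnil.
    apply: (lie_diag_eq0 (k := (p + (m + m))) qD).
    rewrite -[horner_mx X q](subKr X).
    apply: iter_lieB => //; last exact: pP.
    by rewrite mulmxBr mulmxBl horner_mx_comm.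
  split=> //; apply: hN => [|Y Yh]; last by rewrite SY // mem0v.
  have := hU _ Xh; rewrite !UE => /so_blockP[XT X0].
  apply/so_blockP; split.
    rewrite trmx_horner XT -[- X]/(- X) -{1}[X](horner_mx_X) -rmorphN /=.
    by rewrite horner_mx_comp qN rmorphN.
  (* An odd [q] has no constant term, so [S] inherits the zero rows of [X]. *)
  move=> i j ki; have q0 : q.[0] = 0.
    move: qN => /(congr1 (horner^~ 0)); rewrite horner_comp !hornerN hornerX oppr0.
    by move/eqP; rewrite -subr_eq0 opprK -mulr2n mulrn_eq0 /= => /eqP.
  have : delta_mx 0 i *m X = 0 *: (delta_mx 0 i : 'rV_n.+1).
    by rewrite -rowE scale0r; apply/rowP => b; rewrite !mxE X0.
  move/(horner_mx_eigen q); rewrite q0 scale0r -rowE => /rowP/(_ j).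
  by rewrite !mxE.
pose cent (t : 'M[C]_n.+1) := (U :&: lker (linfun (lie t)))%VS.
have centP t X : (X \in cent t) = (X \in U) && (lie t X == 0).
  by rewrite memv_cap memv_ker lfunE.
have : exists d, `[< exists2 t, toral t & \dim (cent t) = d >].
  exists (\dim (cent 0)); apply/asboolP; exists 0 => //; split; first exact: mem0v.
    exact: diagonalizable0.
  by move=> Y _; rewrite lie0l.
case/ex_minnP => d /asboolP[t [th td tc] td0] dmin.
have ht X : X \in h -> X \in cent t.
  by move=> Xh; rewrite centP hU //= tc.
(* Otherwise a generic [t + c *: S] would be toral with a strictly smaller centralizer than [t]. *)
have centS X S w : X \in h -> toral S -> w \in cent t -> lie S w = 0.
  move=> Xh [Sh Sd Sc] wt.
  have [|c [tcd tcP]] := toral_pair td Sd.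
    by apply/eqP; rewrite -subr_eq0 -/(lie t S) tc.
  have sub : (cent (t + c *: S)%R <= cent t)%VS.
    apply/subvP => Y; rewrite !centP => /andP[-> /eqP/tcP[-> _]] /=.
    exact: eqxx.
  have : cent (t + c *: S) = cent t.
    apply/eqP; rewrite eqEdim sub td0 dmin //; apply/asboolP.
    exists (t + c *: S) => //; split=> //; first by rewrite rpredD ?rpredZ.
    by move=> Y Yh; rewrite lieDl lieZl tc // Sc // scaler0 addr0.
  move=> E; move: wt; rewrite -E centP => /andP[_ /eqP/tcP[_ ->]].
  by [].
exists t; split=> // X; rewrite -centP; apply/idP/idP; first exact: ht.
move=> Xt; apply/negPn/negP => Xh.
have [] := nilpotent_normalizer (W := fun w => w \in cent t) hh hnil; last 1 first.
- move=> w [wt /negP nw wh]; apply: nw; apply: hN.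
    by move: wt; rewrite centP => /andP[].
  by move=> Y Yh; rewrite lieC rpredN wh.
- move=> Y w Yh; rewrite !centP => /andP[wU /eqP tw]; rewrite jacobi tw.
  by rewrite tc // lie0l lie0r addr0 eqxx andbT UE so_block_lie // -UE // hU.
(* On [cent t] the semisimple part [S] acts by zero, so [Y] acts there as the nilpotent Y - S. *)
- move=> Y w Yh wt; have [S [St [m Sm]]] := jordan _ Yh.
  exists (m + m)%N; rewrite -(ad_nilpotent w Sm).
  elim: (m + m)%N => //= p <-.
  have : iter p (lie Y) w \in cent t.
    elim: p => //= p; rewrite !centP => /andP[wU /eqP tw]; rewrite jacobi tw.
    by rewrite tc // lie0l lie0r addr0 eqxx andbT UE so_block_lie // -UE // hU.
  by move=> /(centS _ _ _ Yh St); rewrite lieBl => ->; rewrite subr0.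
by exists X.
Qed.

End Toral.

(** * Hyperbolic bases *)

Section Dot.
Variables (F : fieldType) (n : nat).
Implicit Types (x y z u w : 'rV[F]_n) (X : 'M[F]_n).

Definition dotp x y : F := (x *m y^T) 0 0.

Lemma dotpE x y : dotp x y = \sum_j x 0 j * y 0 j.
Proof. by rewrite /dotp mxE; apply: eq_bigr => j _; rewrite mxE. Qed.
Lemma dotpC x y : dotp x y = dotp y x.
Proof. by rewrite !dotpE; apply: eq_bigr => j _; rewrite mulrC. Qed.
Lemma dotpDl x y z : dotp (x + y) z = dotp x z + dotp y z.
Proof. by rewrite /dotp mulmxDl mxE. Qed.
Lemma dotpNl x y : dotp (- x) y = - dotp x y.
Proof. by rewrite /dotp mulNmx mxE. Qed.
Lemma dotpZl c x y : dotp (c *: x) y = c * dotp x y.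
Proof. by rewrite /dotp -scalemxAl mxE. Qed.
Lemma dotpBl x y z : dotp (x - y) z = dotp x z - dotp y z.
Proof. by rewrite dotpDl dotpNl. Qed.
Lemma dotpDr x y z : dotp z (x + y) = dotp z x + dotp z y.
Proof. by rewrite dotpC dotpDl -!(dotpC z). Qed.
Lemma dotpNr x y : dotp y (- x) = - dotp y x.
Proof. by rewrite dotpC dotpNl -(dotpC y). Qed.
Lemma dotpZr c x y : dotp y (c *: x) = c * dotp y x.
Proof. by rewrite dotpC dotpZl -(dotpC y). Qed.
Lemma dotpBr x y z : dotp z (x - y) = dotp z x - dotp z y.
Proof. by rewrite dotpDr dotpNr. Qed.
Lemma dotp0l x : dotp 0 x = 0. Proof. by rewrite /dotp mul0mx mxE. Qed.
Lemma dotp0r x : dotp x 0 = 0. Proof. by rewrite dotpC dotp0l. Qed.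
Lemma dotp_suml (I : Type) (r : seq I) P (f : I -> 'rV[F]_n) y :
  dotp (\sum_(i <- r | P i) f i) y = \sum_(i <- r | P i) dotp (f i) y.
Proof.
by apply: (big_rec2 (fun A B => dotp A y = B)) => [|i A B _ <-]; rewrite ?dotpDl ?dotp0l.
Qed.
Lemma dotp_sumr (I : Type) (r : seq I) P (f : I -> 'rV[F]_n) y :
  dotp y (\sum_(i <- r | P i) f i) = \sum_(i <- r | P i) dotp y (f i).
Proof. by rewrite dotpC dotp_suml; apply: eq_bigr => i _; rewrite dotpC. Qed.

Lemma dotp_delta x j : dotp x (delta_mx 0 j) = x 0 j.
Proof.
rewrite dotpE (bigD1 j) //= mxE !eqxx mulr1 big1 ?addr0 // => i ij.
by rewrite mxE (negPf ij) andbF mulr0.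
Qed.

Lemma dotp_antisym X x y : X^T = - X -> dotp (x *m X) y = - dotp x (y *m X).
Proof. by move=> XT; rewrite /dotp trmx_mul XT mulNmx mulmxN mulmxA; set A := _ *m _; rewrite [in RHS]mxE opprK. Qed.

Lemma dotp_is_linear y : linear (fun x => dotp x y : F^o).
Proof. by move=> c x z; rewrite dotpDl dotpZl. Qed.

Lemma dim_orthogonal (U : {vspace 'rV[F]_n}) y x :
  x \in U -> dotp x y != 0 -> exists U' : {vspace 'rV[F]_n},
   (\dim U').+1 = \dim U /\ forall z, (z \in U') = (z \in U) && (dotp z y == 0).
Proof.
move=> xU xy.
pose f : {linear 'rV[F]_n -> F^o} := HB.pack (fun x => dotp x y : F^o)
  (GRing.isLinear.Build F _ _ _ (fun x => dotp x y : F^o) (dotp_is_linear y)).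
exists (U :&: lker (linfun f))%VS; split; last first.
  by move=> z; rewrite memv_cap memv_ker lfunE.
rewrite -(limg_ker_dim (linfun f) U) -addn1; congr addn.
apply/eqP; rewrite eq_sym eqn_leq; apply/andP; split.
  apply: leq_trans (dimvS (subvf _)) _; rewrite dimvf.
  by [].
rewrite lt0n dimv_eq0; apply: contra xy => /eqP fU0.
have : linfun f x \in (linfun f @: U)%VS by apply: memv_img.
by rewrite fU0 memv0 lfunE.
Qed.

End Dot.

Section Frame.
Variables (C : numClosedFieldType) (n : nat).
Local Notation rV := 'rV[C]_n.+1.
Implicit Types (U : {vspace rV}) (x y u w : rV) (t : 'M[C]_n.+1).

Lemma diagonalizable_prod t : diagonalizable t ->
  exists2 rs : seq C, uniq rs & \prod_(a <- rs) (t - a%:M) = 0.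
Proof.
move/diagonalizableP=> [rs urs /dvdpP[p pE]]; exists rs => //.
have : horner_mx t (\prod_(a <- rs) ('X - a%:P)) = 0.
  by rewrite pE rmorphM /= mx_root_minpoly mulr0.
rewrite rmorph_prod /= => <-; apply: eq_bigr => a _.
by rewrite rmorphB /= horner_mx_X horner_mx_C.
Qed.

(** Decompose [x *m (t - b%:M)] along the eigenvalues other than [b] and divide the components by a
    - b; what remains of [x] is an eigenvector for [b]. *)
Lemma eigen_decomposition U t (rs : seq C) x :
    (forall x, x \in U -> x *m t \in U) -> uniq rs -> x \in U ->
    x *m \prod_(a <- rs) (t - a%:M) = 0 ->
  exists2 f : C -> rV, x = \sum_(a <- rs) f a &
    forall a, a \in rs -> f a \in U /\ f a *m t = a *: f a.
Proof.
move=> Ut; elim: rs x => [|b rs IH] x /=.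
  by move=> _ _; rewrite big_nil mulmx1 => ->; exists (fun=> 0); rewrite ?big_nil.
case/andP=> brs urs xU; rewrite big_cons mulmxA => x0.
have [|f yE fP] := IH (x *m (t - b%:M)) urs _ x0.
  by rewrite mulmxBr mul_mx_scalar rpredB ?rpredZ ?Ut.
pose z := x - \sum_(a <- rs) (a - b)^-1 *: f a.
exists (fun a => if a == b then z else (a - b)^-1 *: f a).
  rewrite big_cons eqxx (eq_big_seq (fun a => (a - b)^-1 *: f a)) ?subrK // => a ars.
  by case: eqVneq ars brs => // -> ->.
have fa a : a \in rs -> (a - b)^-1 *: f a *m (t - b%:M) = f a.
  move=> ars; have [_ E] := fP _ ars.
  rewrite mulmxBr mul_mx_scalar -scalemxAl E !scalerA -scalerBl.
  rewrite [b * _]mulrC -mulrBr mulVf ?scale1r // subr_eq0.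
  by apply: contraNneq brs => <-.
move=> a; rewrite inE; case: eqVneq => [-> _|ab /= ars]; last first.
  have [fU E] := fP _ ars; rewrite rpredZ //; split=> //.
  by rewrite -scalemxAl E !scalerA mulrC.
split.
  rewrite rpredB // big_seq rpred_sum // => c cr.
  by rewrite rpredZ //; case: (fP _ cr).
apply/eqP; rewrite -subr_eq0 -mul_mx_scalar -mulmxBr /z mulmxBl yE mulmx_suml.
by rewrite -sumrB big_seq big1 // => c cr; rewrite fa ?subrr.
Qed.

(** If [t] is nonzero on [U], an eigenvector for a nonzero eigenvalue is isotropic for free. If [t]
    vanishes there, an isotropic vector is made by hand, from two dimensions and a square root. *)
Lemma hyperbolic_pair U t :
    t^T = - t -> diagonalizable t -> (1 < \dim U)%N ->
    (forall x, x \in U -> x *m t \in U) ->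
    (forall x, x \in U -> (forall y, y \in U -> dotp x y = 0) -> x = 0) ->
  exists u w a, [/\ u \in U, w \in U & u *m t = a *: u] /\ [/\ w *m t = (- a) *: w,
    dotp u u = 0, dotp w w = 0 & dotp u w = 1].
Proof.
move=> tT td dU Ut nd; have [rs urs rst] := diagonalizable_prod td.
have nd' u : u \in U -> u != 0 -> exists2 y, y \in U & dotp u y != 0.
  move=> uU u0; apply: contrapT => H; move/eqP: u0; apply; apply: nd => // y yU.
  by apply: contrapT => /eqP uy; apply: H; exists y.
have [H|H] := pselect (exists2 x, x \in U & x *m t != 0).
- case: H => x xU xt0.
  have [|f xE fP] := eigen_decomposition Ut urs xU; first by rewrite rst mulmx0.
  have [a ars fat] : exists2 a, a \in rs & f a *m t != 0.
    apply: contrapT => H; move/eqP: xt0; apply; rewrite xE mulmx_suml big_seq big1 // => a ars.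
    by apply: contrapT => /eqP fa; apply: H; exists a.
  have [uU ut] := fP _ ars; set u := f a in uU ut fat.
  have a0 : a != 0 by apply: contraNneq fat => a0; rewrite ut a0 scale0r.
  have u0 : u != 0 by apply: contraNneq fat => ->; rewrite mul0mx.
  have [y yU uy] := nd' _ uU u0.
  have [|g yE gP] := eigen_decomposition Ut urs yU; first by rewrite rst mulmx0.
  have [b brs gb] : exists2 b, b \in rs & dotp u (g b) != 0.
    apply: contrapT => H; move/eqP: uy; apply; rewrite yE dotp_sumr big_seq big1 // => b brs.
    by apply: contrapT => /eqP fa; apply: H; exists b.
  have [wU wt] := gP _ brs.
  have bE : b = - a.
    have := dotp_antisym u (g b) tT; rewrite ut wt dotpZl dotpZr => /eqP.
    by rewrite -addr_eq0 -mulrDl mulf_eq0 (negPf gb) orbF addrC addr_eq0 => /eqP.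
  have iso v c : c != 0 -> v *m t = c *: v -> dotp v v = 0.
    move=> c0 vt; have := dotp_antisym v v tT; rewrite vt dotpZl dotpZr => /eqP.
    by rewrite -addr_eq0 -mulr2n mulrn_eq0 mulf_eq0 (negPf c0) /= => /eqP.
  exists u, ((dotp u (g b))^-1 *: g b), a; split; first by rewrite rpredZ.
  split.
  - by rewrite -scalemxAl wt bE !scalerA mulrC.
  - exact: iso ut.
  - by rewrite dotpZl dotpZr (iso _ b) ?mulr0 // bE oppr_eq0.
  - by rewrite dotpZr mulVf.
have t0 x : x \in U -> x *m t = 0.
  by move=> xU; apply: contrapT => /eqP xt; apply: H; exists x.
have [u [uU u0 uu]] : exists u, [/\ u \in U, u != 0 & dotp u u = 0].
  have x0 : vpick U != 0 by rewrite vpick0 -dimv_eq0; case: (\dim U) dU.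
  have xU := memv_pick U; move: (vpick U) x0 xU => x x0 xU.
  have [xx|xx] := eqVneq (dotp x x) 0; first by exists x.
  have [z zU zx] : exists2 z, z \in U & z \notin <[x]>%VS.
    apply: contrapT => Hz; move: dU; rewrite ltnNge => /negP; apply.
    have /dimvS : (U <= <[x]>)%VS.
      by apply/subvP => z zU; apply: contrapT => /negP zx; apply: Hz; exists z.
    by rewrite dim_vline x0.
  pose y := z - (dotp z x / dotp x x) *: x.
  have yU : y \in U by rewrite rpredB ?rpredZ.
  have yx : dotp y x = 0 by rewrite dotpBl dotpZl mulfVK ?subrr.
  have y0 : y != 0.
    by apply: contraNneq zx => /eqP; rewrite subr_eq0 => /eqP->; rewrite rpredZ ?memv_line.
  clearbody y; have [yy|yy] := eqVneq (dotp y y) 0; first by exists y.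
  (* As [x] and [y] are orthogonal, isotropy of [x + c *: y] means (x, x) + c^2 (y, y) = 0. *)
  pose c := sqrtC (- (dotp x x / dotp y y)).
  exists (x + c *: y); split; first by rewrite rpredD ?rpredZ.
    apply: contraNneq xx => /(congr1 (dotp x)).
    by rewrite dotpDr dotpZr dotp0r [dotp x y]dotpC yx mulr0 addr0 => ->.
  rewrite !(dotpDl, dotpDr, dotpZl, dotpZr) [dotp x y]dotpC yx !mulr0 addr0 add0r.
  by rewrite mulrA -expr2 sqrtCK mulNr divfK ?subrr.
have [z zU uz] := nd' _ uU u0.
pose z' := (dotp u z)^-1 *: z.
have uz' : dotp u z' = 1 by rewrite dotpZr mulVf.
have z'U : z' \in U by rewrite rpredZ.
clearbody z'.
(* This correction along the isotropic [u] kills the norm of [z'] and keeps its pairing with [u]. *)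
exists u, (z' - (dotp z' z' / 2) *: u), 0; split.
  by rewrite rpredB ?rpredZ // t0 // scale0r.
split=> //.
- by rewrite mulmxBl -scalemxAl !t0 // oppr0 scale0r scaler0 subr0.
- rewrite !(dotpBl, dotpBr, dotpZl, dotpZr) uu uz' dotpC uz' !mulr1 !mulr0 subr0.
  by field.
- by rewrite dotpBr dotpZr uz' uu mulr0 subr0.
Qed.

(** Split off a hyperbolic pair and pass to its orthogonal in [U], again [t]-stable and
    nondegenerate. The line left at the end is anisotropic, and antisymmetry makes [t] vanish on it.
    That a vector orthogonal to the whole family is zero stands in for a spanning statement. *)
Lemma hyperbolic_frame_in m U t :
    t^T = - t -> diagonalizable t -> \dim U = (2 * m + 1)%N ->
    (forall x, x \in U -> x *m t \in U) ->
    (forall x, x \in U -> (forall y, y \in U -> dotp x y = 0) -> x = 0) ->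
  exists (b : nat -> bool -> rV) (p : rV) (a : nat -> C),
  [/\ p \in U, p *m t = 0, dotp p p = 1 &
      forall x, x \in U -> dotp x p = 0 ->
        (forall i s, (i < m)%N -> dotp x (b i s) = 0) -> x = 0] /\
  [/\ forall i s, (i < m)%N -> b i s \in U /\ dotp (b i s) p = 0,
      forall i s, (i < m)%N -> b i s *m t = ((-1) ^+ s * a i) *: b i s &
      forall i j s s', (i < m)%N -> (j < m)%N ->
        dotp (b i s) (b j s') = ((i == j) && (s != s'))%:R].
Proof.
move=> tT td; elim: m U => [|m IH] U dU Ut nd.
  have v0 : vpick U != 0 by rewrite vpick0 -dimv_eq0 dU.
  have vU := memv_pick U; move: (vpick U) v0 vU => v v0 vU.
  have UE x : x \in U -> exists c, x = c *: v.
    suff -> : U = <[v]>%VS by move/vlineP.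
    by apply/esym/eqP; rewrite eqEdim dim_vline v0 dU andbT -memvE.
  have vv : dotp v v != 0.
    apply/eqP => vv; move/eqP: v0; apply; apply: nd => // y /UE[c ->].
    by rewrite dotpZr vv mulr0.
  pose c := sqrtC (dotp v v).
  have c0 : c != 0 by rewrite sqrtC_eq0.
  exists (fun _ _ => 0), (c^-1 *: v), (fun=> 0); split; last by split=> [i []|i []|i j []].
  split.
  - by rewrite rpredZ.
  - have [d dE] := UE _ (Ut _ vU).
    have := dotp_antisym v v tT; rewrite dE dotpZl dotpZr => /eqP.
    rewrite -addr_eq0 -mulr2n mulrn_eq0 mulf_eq0 (negPf vv) orbF /= => /eqP d0.
    by rewrite -scalemxAl dE d0 scale0r scaler0.
  - by rewrite dotpZl dotpZr mulrA -expr2 exprVn sqrtCK mulVf.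
  - move=> x /UE[d ->]; rewrite dotpZl dotpZr => /eqP.
    by rewrite !mulf_eq0 invr_eq0 (negPf c0) (negPf vv) !orbF => /eqP-> _; rewrite scale0r.
have [|u [w [a [[uU wU ut] [wt uu ww uw]]]]] := hyperbolic_pair tT td _ Ut nd.
  by rewrite dU; lia.
have [U1 [dU1 U1P]] : exists U' : {vspace rV},
   (\dim U').+1 = \dim U /\ forall z, (z \in U') = (z \in U) && (dotp z u == 0).
  by apply: (@dim_orthogonal _ _ U u w wU); rewrite dotpC uw oner_eq0.
have [U2 [dU2 U2P]] : exists U' : {vspace rV},
   (\dim U').+1 = \dim U1 /\ forall z, (z \in U') = (z \in U1) && (dotp z w == 0).
  by apply: (@dim_orthogonal _ _ U1 w u); rewrite ?uw ?oner_eq0 // U1P uU uu eqxx.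
have {U1 dU1 U1P dU2 U2P} [dU2 UP] : \dim U2 = (2 * m + 1)%N /\
    forall z, (z \in U2) = [&& z \in U, dotp z u == 0 & dotp z w == 0].
  by split=> [|z]; [move: dU; rewrite -dU1 -dU2; lia | rewrite U2P U1P andbA].
have [||b [p [l [[pU pt pp ptot] [bU bt bb]]]]] := IH U2 dU2.
- move=> x; rewrite !UP => /and3P[xU /eqP xu /eqP xw].
  by rewrite Ut // !(dotp_antisym _ _ tT) ut wt !dotpZr xu xw !mulr0 oppr0 eqxx.
- move=> x; rewrite UP => /and3P[xU /eqP xu /eqP xw] H; apply: nd => // y yU.
  (* Removing the components along the pair turns a test vector of [U] into one of [U2] with the
     same pairing against [x]. *)
  have := H (y - dotp y w *: u - dotp y u *: w).
  rewrite !dotpBr !dotpZr xu xw !mulr0 !subr0; apply.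
  rewrite UP !rpredB ?rpredZ //= !dotpBl !dotpZl uu ww uw dotpC [dotp w u]dotpC uw.
  by rewrite !mulr1 !mulr0 !subr0 [dotp u y]dotpC !subrr eqxx.
have U2u x : x \in U2 -> [/\ x \in U, dotp x u = 0 & dotp x w = 0].
  by rewrite UP => /and3P[-> /eqP-> /eqP->].
pose b' i s := if i == m then if s then w else u else b i s.
exists b', p, (fun i => if i == m then a else l i).
have [pU' pu pw] := U2u _ pU.
split.
  split=> // x xU xp xb; apply: ptot => //.
    have := xb m true (ltnSn m); have := xb m false (ltnSn m).
    by rewrite /b' eqxx UP xU => -> ->; rewrite eqxx.
  move=> i s im; have := xb i s (ltnW im).
  by rewrite /b' ltn_eqF.
have lt i : (i < m.+1)%N -> i != m -> (i < m)%N by rewrite ltnS leq_eqVlt => /orP[->|].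
split.
- move=> i s im; rewrite /b'; case: eqVneq => [_|/(lt _ im) {}im].
    by rewrite dotpC; case: s; rewrite ?pu ?pw.
  by have [/U2u[-> _ _] ->] := bU i s im.
- move=> i s im; rewrite /b'; case: eqVneq => [_|/(lt _ im) {}im]; last exact: bt.
  by case: s; rewrite ?mulN1r ?mul1r.
- move=> i j s s' im jm; rewrite /b'.
  case: (eqVneq i m) => [->|/(lt _ im) {}im]; case: (eqVneq j m) => [jE|nj].
  + by subst j; case: s; case: s'; rewrite ?ww ?uu ?uw //= dotpC.
  + have jm' := lt _ jm nj; rewrite dotpC.
    by have [/U2u[_ ? ?] _] := bU j s' jm'; case: s.
  + rewrite jE ltn_eqF //=.
    by have [/U2u[_ ? ?] _] := bU i s im; case: s'.
  + by apply: bb => //; exact: lt.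
Qed.

End Frame.

(** * Bivectors as antisymmetric matrices, and frames *)

Section Wedge.
Variables (F : fieldType) (n : nat).
Implicit Types (x y z : 'rV[F]_n) (X : 'M[F]_n).

Definition wedge x y : 'M[F]_n := x^T *m y - y^T *m x.

Lemma tr_wedge x y : (wedge x y)^T = - wedge x y.
Proof. by rewrite /wedge linearB /= !trmx_mul !trmxK opprB. Qed.

Lemma mul_wedge z x y : z *m wedge x y = dotp z x *: y - dotp z y *: x.
Proof.
by rewrite /wedge /dotp mulmxBr !mulmxA -!mul_scalar_mx -!mx11_scalar.
Qed.

Lemma wedgeC x y : wedge x y = - wedge y x.
Proof. by rewrite /wedge opprB. Qed.
Lemma wedgeZl c x y : wedge (c *: x) y = c *: wedge x y.
Proof. by rewrite /wedge linearZ /= -scalemxAl -scalemxAr scalerBr. Qed.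
Lemma wedgeNl x y : wedge (- x) y = - wedge x y.
Proof. by rewrite -scaleN1r wedgeZl scaleN1r. Qed.
Lemma wedgeZr c x y : wedge x (c *: y) = c *: wedge x y.
Proof. by rewrite wedgeC wedgeZl -scalerN -wedgeC. Qed.
Lemma wedgeDl x y z : wedge (x + y) z = wedge x z + wedge y z.
Proof. by rewrite /wedge linearD /= mulmxDl mulmxDr opprD addrACA. Qed.
Lemma wedge0l x : wedge 0 x = 0.
Proof. by rewrite -(scale0r 0) wedgeZl scale0r. Qed.
Lemma wedge0r x : wedge x 0 = 0.
Proof. by rewrite wedgeC wedge0l oppr0. Qed.
Lemma wedge_is_linear y : linear (wedge^~ y).
Proof. by move=> c x z; rewrite wedgeDl wedgeZl. Qed.

Lemma lie_wedge X x y : X^T = - X ->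
  lie X (wedge x y) = - (wedge (x *m X) y + wedge x (y *m X)).
Proof.
move=> XT; have Xz z : X *m z^T = - (z *m X)^T.
  by rewrite trmx_mul XT mulNmx opprK.
rewrite /lie /wedge mulmxBr mulmxBl !mulmxA !Xz !mulNmx.
by apply/matrixP => i j; rewrite !mxE; ring.
Qed.

Lemma lie_wedge_eigen X x y a c : X^T = - X -> x *m X = a *: x -> y *m X = c *: y ->
  lie X (wedge x y) = (- (a + c)) *: wedge x y.
Proof.
by move=> XT xX yX; rewrite lie_wedge // xX yX wedgeZl wedgeZr -scalerDl scaleNr.
Qed.

Lemma wedge_so_block k x y :
  (forall j : 'I_n, (k <= j)%N -> x 0 j = 0) ->
  (forall j : 'I_n, (k <= j)%N -> y 0 j = 0) -> wedge x y \in so_block k.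
Proof.
move=> x0 y0; apply/so_blockP; split=> [|i j ki]; first exact: tr_wedge.
by rewrite /wedge !mxE !big1 ?subrr // => a _; rewrite !mxE !ord1 ?(x0 i) ?(y0 i) ?mul0r.
Qed.

(* Comparison of the coefficient of X at (x, z) in [y, X] = c X. *)
Lemma weight_entry X Y x z a c d : X^T = - X -> Y^T = - Y -> lie Y X = d *: X ->
  x *m Y = a *: x -> z *m Y = c *: z -> dotp (x *m X) z != 0 -> d = a + c.
Proof.
move=> XT YT YX xY zY nz; apply: (mulIf nz); rewrite -dotpZl scalemxAr -YX /lie.
rewrite mulmxBr !mulmxA xY dotpBl -scalemxAl dotpZl [X in _ - X]dotp_antisym // zY dotpZr.
by rewrite opprK -mulrDl.
Qed.

Lemma so_block_supp k X x (j : 'I_n) : X \in so_block k -> (k <= j)%N -> (x *m X) 0 j = 0.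
Proof.
move=> /so_blockP[XT X0] kj; rewrite -dotp_delta dotp_antisym // -rowE.
by rewrite dotpE big1 ?oppr0 // => i _; rewrite !mxE X0 ?mulr0.
Qed.

End Wedge.

Section Frames.
Variables (F : fieldType) (n m k : nat).

(** [Some (i, false)], [Some (i, true)] and [None] stand for b_i, b_(-i) and b_0; the sign is
    [(-1) ^+ s]. *)
Definition frame_index := option ('I_m * bool).
Definition opp_index (i : frame_index) : frame_index := omap (fun p => (p.1, ~~ p.2)) i.

Lemma opp_indexK : involutive opp_index.
Proof. by case=> // -[i s]; rewrite /opp_index /= negbK. Qed.
Lemma eq_opp_index i j : (i == opp_index j) = (j == opp_index i).
Proof. by rewrite -(inj_eq (inv_inj opp_indexK)) opp_indexK eq_sym. Qed.

(* Then b is a basis of the span of the first k coordinate vectors, with dual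
   basis b \o opp_index. *)
Definition hyperbolic_frame (b : frame_index -> 'rV[F]_n) :=
  [/\ forall i (j : 'I_n), (k <= j)%N -> b i 0 j = 0,
      forall i j, dotp (b i) (b j) = (j == opp_index i)%:R &
      forall x : 'rV[F]_n, (forall j : 'I_n, (k <= j)%N -> x 0 j = 0) ->
        (forall i, dotp x (b i) = 0) -> x = 0].

Variables (b : frame_index -> 'rV[F]_n) (bP : hyperbolic_frame b).

Let b_supp i (j : 'I_n) : (k <= j)%N -> b i 0 j = 0. Proof. by case: bP => H _ _; exact: H. Qed.
Let b_dot i j : dotp (b i) (b j) = (j == opp_index i)%:R. Proof. by case: bP. Qed.

Lemma frame_neq0 i : b i != 0.
Proof.
have : dotp (b i) (b (opp_index i)) != 0 by rewrite b_dot eqxx oner_eq0.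
by apply: contraNneq => ->; rewrite dotp0l.
Qed.

Lemma wedge_frame_so i j : wedge (b i) (b j) \in so_block k.
Proof. by apply: wedge_so_block => a; exact: b_supp. Qed.

Lemma mul_wedge_frame i j l : b l *m wedge (b i) (b j) =
  (i == opp_index l)%:R *: b j - (j == opp_index l)%:R *: b i.
Proof. by rewrite mul_wedge !b_dot. Qed.

Lemma wedge_frame_neq0 i j : i != j -> wedge (b i) (b j) != 0.
Proof.
move=> ij; apply: contraNneq (frame_neq0 j) => W0.
have := mul_wedge_frame i j (opp_index i).
by rewrite W0 mulmx0 opp_indexK eqxx eq_sym (negPf ij) scale0r scale1r subr0 => <-.
Qed.

Lemma so_block_frame_eq0 X : X \in so_block k ->
  (forall i j, dotp (b i *m X) (b j) = 0) -> X = 0.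
Proof.
move=> Xso H; have [XT X0] := so_blockP _ _ Xso.
have [_ _ nd] := bP.
have bX i : b i *m X = 0 by apply: nd => // j kj; exact: so_block_supp Xso kj.
apply/row_matrixP => i; rewrite row0 rowE; apply: nd => [j kj|j].
  exact: so_block_supp Xso kj.
by rewrite dotp_antisym // bX dotp0r oppr0.
Qed.

(** This order of the factors gives eigenvalue 1 on b_i and -1 on b_(-i). *)
Definition frame_coroot (i : 'I_m) := wedge (b (Some (i, true))) (b (Some (i, false))).

(** As b_(-i) is dual to b_i, this is the diagonal coefficient of [X] at b_i: linear in every [X],
    and the eigenvalue when b_i is an eigenvector. *)
Definition coroot_coord (i : 'I_m) (X : 'M[F]_n) :=
  dotp (b (Some (i, false)) *m X) (b (Some (i, true))).

Definition index_weight (a : frame_index) (X : 'M[F]_n) : F :=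
  if a is Some (i, s) then (-1) ^+ s * coroot_coord i X else 0.

Lemma mul_frame_coroot a i :
  b a *m frame_coroot i = (if a is Some (j, s) then (-1) ^+ s * (j == i)%:R else 0) *: b a.
Proof.
rewrite mul_wedge_frame; case: a => [[j s]|]; last by rewrite !scale0r subr0.
rewrite /= !(inj_eq Some_inj) !xpair_eqE [i == j]eq_sym.
case: eqVneq => [->|_]; last by rewrite mulr0 !scale0r subr0.
by case: s; rewrite /= ?mulr1 ?scale1r ?scale0r ?subr0 ?sub0r ?scaleN1r.
Qed.

Lemma coroot_coord_is_linear i : linear (coroot_coord i : 'M[F]_n -> F^o).
Proof. by move=> c X Y; rewrite /coroot_coord mulmxDr dotpDl -scalemxAr dotpZl. Qed.

Lemma coroot_coord_coroot i j : coroot_coord i (frame_coroot j) = (i == j)%:R.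
Proof. by rewrite /coroot_coord mul_frame_coroot dotpZl b_dot eqxx mul1r mulr1. Qed.

Lemma frame_coroot_so i : frame_coroot i \in so_block k.
Proof. exact: wedge_frame_so. Qed.

(** The hypothesis says that [X] is diagonal in the frame. Antisymmetry makes the coefficients at
    b_i and b_(-i) opposite and the one at b_0 zero, so only the coroots are left. *)
Lemma frame_coroot_expansion (U : {vspace 'M[F]_n}) X : U =i so_block k -> X \in U ->
  (forall i j, i != j -> j != opp_index i -> dotp (b i *m X) (b j) = 0) ->
  2 != 0 :> F -> X = \sum_i coroot_coord i X *: frame_coroot i.
Proof.
move=> UE XU H n2; apply/eqP; rewrite -subr_eq0; apply/eqP.
apply: so_block_frame_eq0 => [|i j].
  rewrite -UE rpredB // rpred_sum // => l _; rewrite rpredZ // UE; exact: wedge_frame_so.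
have XT : X^T = - X by move: XU; rewrite UE => /so_blockP[].
have anti x : dotp (x *m X) x = 0.
  have := dotp_antisym x x XT; rewrite [dotp x _]dotpC => /eqP.
  by rewrite -addr_eq0 -mulr2n -mulr_natl mulf_eq0 (negPf n2) => /eqP.
rewrite mulmxBr mulmx_sumr dotpBl dotp_suml.
under eq_bigr => l _ do rewrite -scalemxAr mul_frame_coroot !dotpZl b_dot.
have [->|nij] := eqVneq j (opp_index i); last first.
  rewrite big1 ?subr0 => [|l _]; last by rewrite !mulr0.
  by have [->|ij] := eqVneq i j; [exact: anti | exact: H].
case: i => [[i s]|] /=; last first.
  by rewrite anti big1 ?subr0 // => l _; rewrite mul0r mulr0.
rewrite (bigD1 i) //= big1 => [|l li]; last by rewrite eq_sym (negPf li) !(mulr0, mul0r).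
rewrite eqxx !mulr1 addr0 /coroot_coord; case: s => /=; last by rewrite mulr1 subrr.
by rewrite mulrN1 opprK (dotp_antisym _ _ XT) [X in - X]dotpC subrr.
Qed.

End Frames.

Arguments index_weight {F n m} b a X.
Arguments coroot_coord {F n m} b i X.
Arguments frame_coroot {F n m} b i.

Section CoordinateBlock.
Variables (F : fieldType) (n k : nat).
Hypothesis kn : (k <= n)%N.

Lemma coordinate_block : exists U : {vspace 'rV[F]_n}, \dim U = k /\
  forall x, x \in U <-> (forall j : 'I_n, (k <= j)%N -> x 0 j = 0).
Proof.
pose f : 'Hom('rV[F]_k, 'rV[F]_n) := linfun (mulmxr (pid_mx k)).
have fE (v : 'rV_k) : f v = v *m pid_mx k by rewrite lfunE.
have pK : (pid_mx k : 'M[F]_(k, n)) *m (pid_mx k : 'M_(n, k)) = 1%:M.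
  by rewrite mul_pid_mx minnn (minn_idPr kn) pid_mx_1.
exists (limg f); split.
  rewrite limg_dim_eq ?dimvf /dim /= ?mul1n //.
  apply/eqP; rewrite -subv0; apply/subvP => v.
  rewrite memv_cap memv_ker fE => /andP[_ /eqP/(congr1 (mulmx^~ (pid_mx k : 'M_(n, k))))].
  by rewrite -mulmxA pK mulmx1 mul0mx => ->; rewrite mem0v.
move=> x; split=> [/memv_imgP[v _ ->] j kj|x0].
  by rewrite fE mxE big1 // => a _; rewrite mxE ltn_eqF ?mulr0 //; exact: leq_trans (ltn_ord a) kj.
have -> : x = f (x *m (pid_mx k : 'M_(n, k))).
  rewrite fE -mulmxA mul_pid_mx minnn minnn; apply/rowP => j; rewrite mxE.
  have [jk|kj] := ltnP j k; last by rewrite x0 // big1 // => a _; rewrite mxE; case: eqP => [->|_]; rewrite ?mulr0 // ltnNge kj mulr0.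
  rewrite (bigD1 j) //= mxE eqxx jk mulr1 big1 ?addr0 // => a aj.
  by rewrite mxE (_ : (a == j :> nat) = false) ?mulr0 //; exact: negPf.
by rewrite memv_img // memvf.
Qed.

End CoordinateBlock.

Section AdaptedFrameDef.
Variables (F : fieldType) (n m k : nat) (U : {vspace 'M[F]_n}).

Definition adapted_frame (h : {vspace 'M[F]_n}) (b : frame_index m -> 'rV[F]_n) :=
  [/\ hyperbolic_frame k b, (h <= U)%VS, forall i, frame_coroot b i \in h &
    forall X, X \in h -> X = \sum_i coroot_coord b i X *: frame_coroot b i].

End AdaptedFrameDef.

(** * Frames adapted to a Cartan subalgebra *)

Section FrameExistence.
Variables (C : numClosedFieldType) (n m k : nat).
Hypotheses (kE : k = (2 * m + 1)%N) (kn : (k <= n.+1)%N).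
Local Notation idx := (frame_index m).

Lemma hyperbolic_frame_exists t : t \in so_block k -> diagonalizable t ->
  exists (b : idx -> 'rV[C]_n.+1) (a : idx -> C), [/\ hyperbolic_frame k b,
    forall i, b i *m t = a i *: b i & forall i, a (opp_index i) = - a i].
Proof.
move=> tso td; have [tT t0] := so_blockP _ _ tso.
have [U [dU UE]] := coordinate_block C kn.
have Ut x : x \in U -> x *m t \in U.
  by move=> _; apply/UE => j kj; exact: so_block_supp tso kj.
have nd x : x \in U -> (forall y, y \in U -> dotp x y = 0) -> x = 0.
  move=> /UE x0 H; apply/rowP => j; rewrite [RHS]mxE.
  have [jk|/x0//] := ltnP j k; rewrite -dotp_delta H //; apply/UE => i ki.
  by rewrite mxE eqxx /= (_ : (i == j) = false) //; apply/eqP => ij; rewrite ij leqNgt jk in ki.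
rewrite kE in dU.
have [b [p [a [[pU pt pp ptot] [bU bt bb]]]]] := hyperbolic_frame_in tT td dU Ut nd.
pose b' (i : idx) := if i is Some (i, s) then b i s else p.
exists b', (fun i : idx => if i is Some (i, s) then (-1) ^+ s * a i else 0).
split.
- split.
  + by case=> [[i s]|] j kj /=; [have [/UE H _] := bU i s (ltn_ord i) | have /UE H := pU]; exact: H.
  + case=> [[i s]|] [[j s']|] /=; last by rewrite pp.
    * rewrite bb // (inj_eq Some_inj) xpair_eqE eq_sym -(inj_eq val_inj); congr (_ && _)%:R.
      by case: s s' => -[].
    * by have [_ ->] := bU i s (ltn_ord i).
    * by rewrite dotpC; have [_ ->] := bU j s' (ltn_ord j).
  + move=> x /UE xU H; apply: ptot => //; first exact: (H None).
    by move=> i s im; exact: (H (Some (Ordinal im, s))).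
- by case=> [[i s]|] /=; [exact: bt | rewrite pt scale0r].
- by case=> [[i s]|] /=; rewrite ?oppr0 //; case: s; rewrite /= ?mul1r ?mulN1r ?opprK.
Qed.

Variables (U : {vspace 'M[C]_n.+1}).
Hypothesis UE : U =i so_block k.

Let n2 : 2 != 0 :> C. Proof. by rewrite pnatr_eq0. Qed.

Lemma cartan_frame_succ h : cartan_subalgebra U h -> exists b : idx -> _, adapted_frame k U h b.
Proof.
move=> hC; have [t [th td hE]] := cartan_toral UE hC.
have [hU hh hnil _] := hC.
have tso : t \in so_block k by rewrite -UE (subvP hU).
have [tT _] := so_blockP _ _ tso.
have [b [a [bP bt aN]]] := hyperbolic_frame_exists tso td.
have [_ bb _] := bP; exists b.
(* A bivector of weight zero for [t] centralizes [t], hence lies in [h]. *)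
have Wh i j : a i + a j = 0 -> wedge (b i) (b j) \in h.
  move=> aij; rewrite hE UE (wedge_frame_so bP) (lie_wedge_eigen tT (bt i) (bt j)).
  by rewrite aij oppr0 scale0r eqxx.
(* If a_i + a_j = 0 off the Cartan pairs, b_i ^ b_opp(i) and b_i ^ b_j generate
   a non-nilpotent subalgebra of h. *)
have a_some i j : i != j -> j != opp_index i -> i != None -> a i + a j != 0.
  move=> ij jNi iN; apply/eqP => aij.
  have iNi : opp_index i != i by case: i iN {ij jNi aij} => // -[i s] _; rewrite /= (inj_eq Some_inj) xpair_eqE eqxx; case: s.
  pose H := wedge (b (opp_index i)) (b i); pose E := wedge (b i) (b j).
  have Hh : H \in h by rewrite Wh // aN addNr.
  have Eh : E \in h by exact: Wh.
  have HE : lie H E = - E.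
    rewrite /E (@lie_wedge_eigen _ _ _ _ _ 1 0) ?addr0 ?scaleN1r //.
    - exact: tr_wedge.
    - by rewrite /H (mul_wedge_frame bP) eqxx eq_sym (negPf iNi) scale0r subr0 scale1r.
    - rewrite /H (mul_wedge_frame bP) (inj_eq (inv_inj (@opp_indexK m))) (negPf ij).
      by rewrite eq_opp_index (negPf jNi) !scale0r subr0.
  have [p pP] := nilpotent_ad hh hnil.
  have HpE q : iter q (lie H) E = (-1) ^+ q *: E.
    elim: q => [|q IH] /=; rewrite ?scale1r // IH lieZr HE exprSr mulrN1.
    by rewrite scaleNr scalerN.
  have := pP _ _ Hh Eh; rewrite HpE => /eqP; rewrite scaler_eq0 signr_eq0 /=.
  by rewrite (negPf (wedge_frame_neq0 bP ij)).
(* At most one of the distinct [i] and [j] is [None], so symmetry reduces to [a_some]. *)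
have a_neq0 i j : i != j -> j != opp_index i -> a i + a j != 0.
  move=> ij jNi; have [iN|] := eqVneq i None; last exact: a_some.
  rewrite addrC; apply: a_some; first by rewrite eq_sym.
    by rewrite eq_opp_index.
  by rewrite -iN eq_sym.
split=> // [i|X Xh]; first by apply: Wh; rewrite -[Some (i, true)]/(opp_index (Some (i, false))) aN addNr.
have XU := subvP hU _ Xh; apply: (frame_coroot_expansion bP UE XU _ n2) => i j ij jNi.
have [XT _] : X^T = - X /\ True by move: XU; rewrite UE => /so_blockP[].
move: Xh; rewrite hE => /andP[_ /eqP tX].
have tX0 : lie t X = 0 *: X by rewrite scale0r.
apply/eqP/negPn/negP => nz; have := a_neq0 _ _ ij jNi.
by rewrite -(weight_entry XT tT tX0 (bt i) (bt j) nz) eqxx.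
Qed.

Lemma frame_coroot_comm (b : idx -> 'rV[C]_n.+1) i j : hyperbolic_frame k b ->
  lie (frame_coroot b i) (frame_coroot b j) = 0.
Proof.
move=> bP; rewrite [frame_coroot b j]/frame_coroot.
rewrite (lie_wedge_eigen _ (mul_frame_coroot bP _ i) (mul_frame_coroot bP _ i)).
  by rewrite mulN1r mul1r addNr oppr0 scale0r.
exact: tr_wedge.
Qed.

(** The diagonal torus of any frame works, and the zero matrix supplies a frame. The torus is
    abelian, so an [X] normalizing it satisfies [H, [H, X]] = 0; a nonzero off-diagonal entry of [X]
    would then force the square of its weight, hence the weight itself, to vanish on every
    coroot. *)
Lemma cartan_exists_succ : exists h, cartan_subalgebra U h.
Proof.
have so0 : (0 : 'M[C]_n.+1) \in so_block k by rewrite -UE mem0v.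
have [b [_ [bP _ _]]] := hyperbolic_frame_exists so0 (diagonalizable0 _).
pose h := <<[seq frame_coroot b i | i <- enum 'I_m]>>%VS.
have Hh i : frame_coroot b i \in h.
  by apply: memv_span; apply: map_f; rewrite mem_enum.
have hU : (h <= U)%VS.
  by apply/span_subvP => _ /mapP[i _ ->]; rewrite UE; exact: (frame_coroot_so bP).
have h_ind (P : 'M_n.+1 -> Prop) : P 0 -> (forall X Y c, P X -> P Y -> P (c *: X + Y)) ->
    (forall i, P (frame_coroot b i)) -> forall X, X \in h -> P X.
  move=> P0 PD HP X; rewrite /h => /coord_span->.
  apply: (big_ind P) => // [Y Z PY PZ|i _]; first by rewrite -[Y]scale1r; exact: PD.
  rewrite -[_ *: _]addr0; apply: PD => //.
  have /mapP[j _ ->] : [seq frame_coroot b i | i <- enum 'I_m]`_i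
      \in [seq frame_coroot b i | i <- enum 'I_m].
    by rewrite mem_nth // size_map -cardE.
  exact: HP.
have hab X Y : X \in h -> Y \in h -> lie X Y = 0.
  move=> Xh Yh; elim/h_ind: X / Xh => [|X X' c XY X'Y|i]; first exact: lie0l.
    by rewrite lieDl lieZl XY X'Y scaler0 addr0.
  elim/h_ind: Y / Yh => [|Y Y' c XY X'Y|j]; first exact: lie0r.
    by rewrite lieDr lieZr XY X'Y scaler0 addr0.
  exact: frame_coroot_comm.
exists h; split=> //.
- by move=> X Y Xh Yh; rewrite hab ?mem0v.
- exists 1%N; apply/eqP; rewrite -subv0; apply/span_subvP => _ /allpairsP[[X Y] [/= Xh Yh ->]].
  by rewrite hab ?mem0v ?vbasis_mem.
move=> X XU Xn; rewrite (frame_coroot_expansion bP UE XU _ n2).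
  by rewrite rpred_sum // => i _; rewrite rpredZ.
move=> i j ij jNi; have [XT _] : X^T = - X /\ True by move: XU; rewrite UE => /so_blockP[].
apply/eqP/negPn/negP => nz.
have key l : (if i is Some (p, s) then (-1) ^+ s * (p == l)%:R else 0) +
    (if j is Some (p, s) then (-1) ^+ s * (p == l)%:R else 0) = 0 :> C.
  set a := (X in X + _); set c := (X in _ + X).
  have lT : (frame_coroot b l)^T = - frame_coroot b l by exact: tr_wedge.
  have bi := mul_frame_coroot bP i l; have bj := mul_frame_coroot bP j l.
  have dotlie Y : Y^T = - Y ->
      dotp (b i *m lie (frame_coroot b l) Y) (b j) = (a + c) * dotp (b i *m Y) (b j).
    move=> YT; rewrite /lie mulmxBr !mulmxA bi dotpBl -scalemxAl dotpZl.
    by rewrite (dotp_antisym (b i *m Y) _ lT) bj dotpZr opprK -mulrDl.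
  have : lie (frame_coroot b l) (lie (frame_coroot b l) X) = 0.
    by rewrite hab // lieC rpredN Xn.
  move/(congr1 (fun Y => dotp (b i *m Y) (b j))); rewrite mulmx0 dotp0l !dotlie //.
    by move/eqP; rewrite !mulf_eq0 (negPf nz) orbF orbb => /eqP.
  by rewrite trmx_lie XT lT lieNl lieNr opprK.
move: i j ij jNi key {nz} => [[i s]|] [[j s']|] // ij jNi key.
- have := key i; rewrite eqxx mulr1; have [ji|_] := eqVneq j i.
    move: ij jNi; rewrite ji /= !(inj_eq Some_inj) !xpair_eqE eqxx /=.
    by case: s {key}; case: s'.
  by rewrite mulr0 addr0 => /eqP; rewrite signr_eq0.
- by have := key i; rewrite eqxx mulr1 addr0 => /eqP; rewrite signr_eq0.
- by have := key j; rewrite eqxx mulr1 add0r => /eqP; rewrite signr_eq0.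
Qed.

End FrameExistence.

Section CartanSubalgebras.
Variables (C : numClosedFieldType) (n m k : nat) (U : {vspace 'M[C]_n}).
Hypotheses (kE : k = (2 * m + 1)%N) (kn : (k <= n)%N) (UE : U =i so_block k).

Lemma cartan_frame h : cartan_subalgebra U h ->
  exists b : frame_index m -> 'rV_n, adapted_frame k U h b.
Proof.
case: n U kn UE h => [|n'] U' kn' UE'; first by move: kn'; rewrite kE addn1.
exact: cartan_frame_succ.
Qed.

Lemma cartan_exists : exists h, cartan_subalgebra U h.
Proof.
case: n U kn UE => [|n'] U' kn' UE'; first by move: kn'; rewrite kE addn1.
exact: (@cartan_exists_succ C n' m k kE kn' U' UE').
Qed.

End CartanSubalgebras.

(** * The Killing form *)

Section Killing.
Variables (F : fieldType) (n : nat).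
Hypothesis n2 : 2 != 0 :> F.
Implicit Types (A B X Y : 'M[F]_n).

Lemma mul_delta_entry A B (a b i j : 'I_n) :
  (A *m delta_mx a b *m B) i j = A i a * B b j.
Proof.
rewrite mxE (bigD1 b) //= big1 => [|c cb].
  rewrite addr0 mxE (bigD1 a) //= big1 => [|d da]; rewrite mxE ?eqxx ?mulr1 ?addr0 //.
  by rewrite (negPf da) mulr0.
rewrite mxE big1 ?mul0r // => d _; by rewrite mxE (negPf cb) andbF mulr0.
Qed.

(** The trace of Z -> A Z B over all matrices. *)
Lemma sum_delta_diag A B :
  \sum_(ab : 'I_n * 'I_n) (A *m delta_mx ab.1 ab.2 *m B) ab.1 ab.2 = \tr A * \tr B.
Proof.
under eq_bigr do rewrite mul_delta_entry.
by rewrite -(pair_bigA _ (fun a b => A a a * B b b)) /= big_distrlr.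
Qed.

(** The trace of Z -> A Z^T B over all matrices. *)
Lemma sum_delta_swap A B :
  \sum_(ab : 'I_n * 'I_n) (A *m delta_mx ab.2 ab.1 *m B) ab.1 ab.2 = \tr (A *m B^T).
Proof.
under eq_bigr do rewrite mul_delta_entry.
rewrite -(pair_bigA _ (fun a b => A a b * B a b)) /=.
by apply: eq_bigr => a _; rewrite mxE; apply: eq_bigr => b _; rewrite mxE.
Qed.

Lemma trace_antisym X : X^T = - X -> \tr X = 0.
Proof.
move=> XT; apply/eqP; have /eqP := mxtrace_tr X.
by rewrite XT linearN /= eq_sym -addr_eq0 -mulr2n -mulr_natl mulf_eq0 (negPf n2).
Qed.

(** The trace over so_n is the trace over all matrices after composition with the projection (Z -
    Z^T) / 2, that is, half the difference of the sums of [d] and [s] below; this gives (2n - 4) / 2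
    times the trace of XY. *)
Lemma killing_so (g : {vspace 'M[F]_n}) X Y : (forall X, X \in g = (X^T == - X)) ->
  X \in g -> Y \in g -> killing g X Y = (n%:R - 2) * \tr (X *m Y).
Proof.
move=> gE Xg Yg.
have XT : X^T = - X by apply/eqP; rewrite -gE.
have YT : Y^T = - Y by apply/eqP; rewrite -gE.
pose phi Z := lie X (lie Y Z).
have phiZ c A : phi (c *: A) = c *: phi A by rewrite /phi !lieZr.
have phi_sum (I : Type) (r : seq I) (E : I -> 'M_n) :
    phi (\sum_(i <- r) E i) = \sum_(i <- r) phi (E i).
  by rewrite /phi !lie_sumr.
have glie A B : A \in g -> B \in g -> lie A B \in g.
  by rewrite !gE => /eqP AT /eqP BT; rewrite trmx_lie AT BT lieNl lieNr opprK.
(* Projected matrix units: an overcomplete family in [g] in which an antisymmetric [Z] has its own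
   entries as coefficients. *)
pose f (ab : 'I_n * 'I_n) : 'M[F]_n := 2^-1 *: (delta_mx ab.1 ab.2 - delta_mx ab.2 ab.1).
have fg ab : f ab \in g.
  by rewrite rpredZ // gE linearB /= !trmx_delta opprB.
have expand Z : Z \in g -> Z = \sum_ab Z ab.1 ab.2 *: f ab.
  rewrite gE => /eqP ZT; have Z2 : Z = 2^-1 *: (Z - Z^T).
    by rewrite ZT opprK -mulr2n -scaler_nat scalerA mulVf ?scale1r.
  have ZE : Z = \sum_(ab : 'I_n * 'I_n) Z ab.1 ab.2 *: delta_mx ab.1 ab.2.
    rewrite -(pair_bigA _ (fun a b => Z a b *: delta_mx a b)) /=.
    exact: matrix_sum_delta.
  rewrite [LHS]Z2 {1 2}ZE linear_sum /= -sumrB scaler_sumr.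
  apply: eq_bigr => ab _; rewrite linearZ /= trmx_delta -scalerBr.
  by rewrite /f !scalerA mulrC.
transitivity (\sum_ab (phi (f ab)) ab.1 ab.2).
  pose v := vbasis g.
  rewrite /killing; transitivity (\sum_(i < \dim g) \sum_ab (v`_i) ab.1 ab.2 * coord v i (phi (f ab))).
    apply: eq_bigr => i _; rewrite -/(phi _) -/v {1}[v`_i]expand ?vbasis_mem ?mem_nth ?size_tuple //.
    rewrite phi_sum linear_sum /=; apply: eq_bigr => ab _.
    by rewrite phiZ linearZ.
  rewrite exchange_big /=; apply: eq_bigr => ab _.
  have pg : phi (f ab) \in g by rewrite /phi !glie.
  rewrite [in RHS](coord_vbasis pg) summxE; apply: eq_bigr => i _.
  by rewrite mxE mulrC.
have phiE Z : phi Z = (X *m Y) *m Z *m 1%:M - X *m Z *m Y - Y *m Z *m X + 1%:M *m Z *m (Y *m X).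
  rewrite /phi /lie mulmx1 mul1mx !(mulmxBr, mulmxBl) !mulmxA.
  by apply/matrixP => i j; rewrite !mxE; ring.
have trYX : \tr (Y *m X) = \tr (X *m Y) by rewrite mxtrace_mulC.
pose d := fun ab : 'I_n * 'I_n => phi (delta_mx ab.1 ab.2) ab.1 ab.2.
pose s := fun ab : 'I_n * 'I_n => phi (delta_mx ab.2 ab.1) ab.1 ab.2.
have dE : \sum_ab d ab = 2 * n%:R * \tr (X *m Y).
  rewrite (eq_bigr (fun ab : 'I_n * 'I_n => (X *m Y *m delta_mx ab.1 ab.2 *m 1%:M) ab.1 ab.2
     - (X *m delta_mx ab.1 ab.2 *m Y) ab.1 ab.2 - (Y *m delta_mx ab.1 ab.2 *m X) ab.1 ab.2
     + (1%:M *m delta_mx ab.1 ab.2 *m (Y *m X)) ab.1 ab.2)); last first.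
    by move=> ab _; rewrite /d phiE !mxE.
  rewrite big_split /= !sumrB !sum_delta_diag (trace_antisym XT) mul0r mulr0 mxtrace1 trYX.
  by ring.
have sE : \sum_ab s ab = 4 * \tr (X *m Y).
  rewrite (eq_bigr (fun ab : 'I_n * 'I_n => (X *m Y *m delta_mx ab.2 ab.1 *m 1%:M) ab.1 ab.2
     - (X *m delta_mx ab.2 ab.1 *m Y) ab.1 ab.2 - (Y *m delta_mx ab.2 ab.1 *m X) ab.1 ab.2
     + (1%:M *m delta_mx ab.2 ab.1 *m (Y *m X)) ab.1 ab.2)); last first.
    by move=> ab _; rewrite /s phiE !mxE.
  rewrite big_split /= !sumrB !sum_delta_swap trmx1 mulmx1 mul1mx mxtrace_tr trYX.
  by rewrite XT YT !mulmxN !linearN /= trYX; ring.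
transitivity (2^-1 * (\sum_ab d ab - \sum_ab s ab)).
  rewrite -sumrB mulr_sumr; apply: eq_bigr => ab _.
  rewrite /f phiZ /d /s; have -> A B : phi (A - B) = phi A - phi B by rewrite /phi !lieBr.
  by rewrite !mxE.
by rewrite dE sE; field.
Qed.

End Killing.

Local Open Scope classical_set_scope.
Local Open Scope ring_scope.

(** * Roots *)

Lemma regularZ (F : fieldType) (a x : F) : a *: (x : F^o) = a * x.
Proof. by []. Qed.

Section AdaptedFrame.
Variables (C : numClosedFieldType) (n m k : nat).
Variables (U h : {vspace 'M[C]_n}) (b : frame_index m -> 'rV[C]_n).
Hypotheses (UE : U =i so_block k) (hb : adapted_frame k U h b).
Implicit Types (i j : 'I_m) (y : subvs_of h) (p q : frame_index m).

Let bP : hyperbolic_frame k b. Proof. by case: hb. Qed.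
Let corootP i : frame_coroot b i \in h. Proof. by case: hb => _ _ H _; exact: H. Qed.
Let expansion X : X \in h -> X = \sum_i coroot_coord b i X *: frame_coroot b i.
Proof. by case: hb => _ _ _ H; exact: H. Qed.
Let subU X : X \in h -> X \in U. Proof. by case: hb => _ /subvP H _ _; exact: H. Qed.

Lemma cartan_antisym y : (vsval y)^T = - vsval y.
Proof. by have := subU (subvsP y); rewrite UE => /so_blockP[]. Qed.

Lemma mul_frame_cartan p X : X \in h -> b p *m X = index_weight b p X *: b p.
Proof.
move=> Xh; rewrite {1}(expansion Xh) mulmx_sumr.
under eq_bigr do rewrite -scalemxAr (mul_frame_coroot bP) scalerA.
rewrite -scaler_suml; congr (_ *: _); case: p => [[i s]|] /=; last first.
  by rewrite big1 // => i _; rewrite mulr0.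
rewrite (bigD1 i) //= big1 => [|j ji]; last by rewrite eq_sym (negPf ji) !mulr0.
by rewrite eqxx mulr1 addr0 mulrC.
Qed.

Definition coroot_functional i y : C^o := coroot_coord b i (vsval y).
Lemma coroot_functional_is_linear i : linear (coroot_functional i).
Proof. by move=> c x y; rewrite /coroot_functional linearP coroot_coord_is_linear. Qed.
HB.instance Definition _ i :=
  GRing.isLinear.Build C _ _ _ (coroot_functional i) (coroot_functional_is_linear i).

(** The eps_i of the standard model of B_m, that is the eigenvalue on b_i; not a fundamental weight
    in the usual sense. *)
Definition fund_weight i : dual h := linfun (coroot_functional i).
Definition frame_weight p : dual h :=
  if p is Some (i, s) then (-1) ^+ s *: fund_weight i else 0.

Lemma fund_weightE i y : fund_weight i y = coroot_coord b i (vsval y).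
Proof. by rewrite lfunE. Qed.

Lemma frame_weightE p y : frame_weight p y = index_weight b p (vsval y).
Proof.
by case: p => [[i s]|]; rewrite /frame_weight ?zero_lfunE // scale_lfunE fund_weightE.
Qed.

Definition coroot_subvs i : subvs_of h := Subvs (corootP i).

Lemma fund_weight_coroot i j : fund_weight i (coroot_subvs j) = (i == j)%:R.
Proof. by rewrite fund_weightE (coroot_coord_coroot bP). Qed.

Lemma cartan_expansion y : y = \sum_i coroot_coord b i (vsval y) *: coroot_subvs i.
Proof.
apply/val_inj; rewrite /= linear_sum {1}(expansion (subvsP y)).
by apply: eq_bigr => i _; rewrite linearZ.
Qed.

Lemma fund_weight_expansion (a : dual h) : a = \sum_i a (coroot_subvs i) *: fund_weight i.
Proof.
apply/lfunP => y; rewrite {1}(cartan_expansion y) linear_sum sum_lfunE.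
by apply: eq_bigr => i _; rewrite linearZ scale_lfunE fund_weightE; exact: mulrC.
Qed.

Lemma fund_weight_basis : basis_of fullv [tuple fund_weight i | i < m].
Proof.
have nthE i : [tuple fund_weight i | i < m]`_i = fund_weight i by rewrite -tnth_nth tnth_mktuple.
rewrite basisEfree; apply/and3P; split; last 2 first.
- exact: subvf.
- rewrite size_tuple; apply: leq_trans (_ : \dim <<[tuple fund_weight i | i < m]>> <= _)%N.
    apply: dimvS; apply/subvP => a _; rewrite (fund_weight_expansion a).
    by apply: memv_suml => i _; rewrite rpredZ // memv_span //; apply/tnthP; exists i; rewrite tnth_mktuple.
  by rewrite (leq_trans (dim_span _)) // size_tuple.
apply/freeP => c c0 i; have := congr1 (fun a : dual h => a (coroot_subvs i)) c0.
rewrite sum_lfunE (bigD1 i) //= big1 => [|j ji].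
  by rewrite nthE scale_lfunE fund_weight_coroot eqxx addr0 regularZ mulr1 => ->; rewrite zero_lfunE.
by rewrite nthE scale_lfunE fund_weight_coroot (negPf ji) /= scaler0.
Qed.

Lemma frame_weight_sum_neq0 p q : p != q -> q != opp_index p ->
  frame_weight p + frame_weight q != 0.
Proof.
have ev p' i : frame_weight p' (coroot_subvs i) =
    if p' is Some (j, s) then (-1) ^+ s * (j == i)%:R else 0.
  by case: p' => [[j s]|]; rewrite /frame_weight ?zero_lfunE // scale_lfunE fund_weight_coroot.
move=> pq qNp; apply/eqP => /(congr1 (fun a : dual h => fun i => a (coroot_subvs i))) H.
have {}H i : frame_weight p (coroot_subvs i) + frame_weight q (coroot_subvs i) = 0.
  by have := congr1 (fun f => f i) H; rewrite /= add_lfunE zero_lfunE.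
move: p q pq qNp H => [[i s]|] [[j s']|] // pq qNp H.
- have := H i; rewrite !ev eqxx mulr1; have [ji|_] := eqVneq j i.
    move: pq qNp; rewrite ji /= !(inj_eq Some_inj) !xpair_eqE eqxx /=.
    by case: s {H}; case: s'.
  by rewrite mulr0 addr0 => /eqP; rewrite signr_eq0.
- by have := H i; rewrite !ev eqxx mulr1 addr0 => /eqP; rewrite signr_eq0.
- by have := H j; rewrite !ev eqxx mulr1 add0r => /eqP; rewrite signr_eq0.
Qed.

(** With [x] a frame vector this reads off roots; with [x] a coordinate vector killed by [h], the
    weights of the vector representations. *)
Lemma weight_of_entry (a : dual h) X p (x : 'rV[C]_n) (c : dual h) :
  X^T = - X -> (forall y, lie (vsval y) X = a y *: X) ->
  (forall y, x *m vsval y = c y *: x) -> dotp (b p *m X) x != 0 ->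
  a = frame_weight p + c.
Proof.
move=> XT aX xc nz; apply/lfunP => y; rewrite add_lfunE frame_weightE.
apply: (weight_entry XT (cartan_antisym y) (aX y) _ (xc y) nz).
by rewrite mul_frame_cartan // subvsP.
Qed.

Lemma frame_eigen p y : b p *m vsval y = frame_weight p y *: b p.
Proof. by rewrite frame_weightE mul_frame_cartan // subvsP. Qed.

Lemma frame_weight_opp p : frame_weight (opp_index p) = - frame_weight p.
Proof.
case: p => [[i s]|]; rewrite /frame_weight /= ?oppr0 //.
by case: s; rewrite ?scaleN1r ?scale1r ?opprK.
Qed.

(** Opposite indices appear because [lie X] acts on a bivector by minus the sum of the eigenvalues
    of the row action. *)
Lemma frame_weight_wedge p q y :
  lie (vsval y) (wedge (b (opp_index p)) (b (opp_index q))) =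
  (frame_weight p + frame_weight q) y *: wedge (b (opp_index p)) (b (opp_index q)).
Proof.
rewrite (lie_wedge_eigen (cartan_antisym y) (frame_eigen _ y) (frame_eigen _ y)).
by rewrite !frame_weight_opp !opp_lfunE -opprD opprK add_lfunE.
Qed.

Lemma lie_rootsE : lie_roots U h =
  [set a | exists p q, [/\ p != q, q != opp_index p & a = frame_weight p + frame_weight q]].
Proof.
apply/seteqP; split=> a /=.
  case=> a0 [X [XU X0 aX]].
  have Xso : X \in so_block k by rewrite -UE.
  have [XT _] := so_blockP _ _ Xso.
  have [p [q nz]] : exists p q, dotp (b p *m X) (b q) != 0.
    apply: contrapT => H; move/eqP: X0; apply; apply: (so_block_frame_eq0 bP Xso) => p q.
    by apply: contrapT => /eqP nz; apply: H; exists p, q.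
  have aE := weight_of_entry XT aX (frame_eigen q) nz.
  exists p, q; split=> //.
    apply: contraNneq nz => <-; have := dotp_antisym (b p) (b p) XT.
    by rewrite [dotp (b p) _]dotpC => /eqP; rewrite -addr_eq0 -mulr2n mulrn_eq0.
  by apply: contraNneq a0 => qE; rewrite aE qE frame_weight_opp subrr.
case=> p [q [pq qNp ->]]; split; first exact: frame_weight_sum_neq0.
exists (wedge (b (opp_index p)) (b (opp_index q))); split; last exact: frame_weight_wedge.
  by rewrite UE (wedge_frame_so bP).
by rewrite (wedge_frame_neq0 bP) // (inj_eq (inv_inj (@opp_indexK m))).
Qed.

Lemma short_pairE (a : dual h) : (exists i (s : bool), a = (-1) ^+ s *: fund_weight i) <->
  (exists p, p != None /\ a = frame_weight p).
Proof.
split=> [[i [s ->]]|[[[i s]|] [] // _ ->]]; last by exists i, s.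
by exists (Some (i, s)).
Qed.

(** The index [None] has weight zero, so pairs with it give the +-eps_i, while p != q excludes +-2
    eps_i and q != [opp_index p] excludes zero. *)
Lemma lie_roots_split : lie_roots U h =
  [set a | exists i (s : bool), a = (-1) ^+ s *: fund_weight i] `|`
  [set a | exists i j (s t : bool),
     i != j /\ a = (-1) ^+ s *: fund_weight i + (-1) ^+ t *: fund_weight j].
Proof.
rewrite lie_rootsE; apply/seteqP; split=> a /=.
  case=> [[[i s]|] [[[j t]|] [//= pq qNp ->]]].
  - right; exists i, j, s, t; split=> //; apply: contraNneq pq => ij.
    move: qNp; rewrite ij !(inj_eq Some_inj) !xpair_eqE eqxx /=.
    by case: s; case: t.
  - by left; exists i, s; rewrite addr0.
  - by left; exists j, t; rewrite add0r.
case=> [[i [s ->]]|[i [j [s [t [ij ->]]]]]].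
  by exists (Some (i, s)), None; rewrite /= addr0.
exists (Some (i, s)), (Some (j, t)).
by split=> //; apply/eqP => -[] ji; rewrite ji eqxx in ij.
Qed.

Lemma root_system_B_roots : root_system_B m (lie_roots U h).
Proof.
exists [tuple fund_weight i | i < m]; first exact: fund_weight_basis.
have nthE i : [tuple fund_weight i | i < m]`_i = fund_weight i by rewrite -tnth_nth tnth_mktuple.
rewrite lie_roots_split; congr (_ `|` _); apply/seteqP; split=> a /=.
- by case=> i [s ->]; exists i, s; rewrite nthE.
- by case=> i [s ->]; exists i, s; rewrite nthE.
- by case=> i [j [s [t [ij ->]]]]; exists i, j, s, t; rewrite !nthE.
- by case=> i [j [s [t [ij ->]]]]; exists i, j, s, t; rewrite !nthE in ij *.
Qed.

End AdaptedFrame.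

(** * The Killing form on the torus and its dual *)

Section DualForm.
Variables (C : numClosedFieldType) (n m k : nat).
Variables (g U h : {vspace 'M[C]_n}) (b : frame_index m -> 'rV[C]_n).
Hypotheses (gE : forall X, (X \in g) = (X^T == - X)) (n3 : (2 < n)%N).
Hypotheses (UE : U =i so_block k) (hb : adapted_frame k U h b).
Implicit Types (i j : 'I_m) (x y : subvs_of h) (a : dual h).

Local Notation wt := (fund_weight h b).
Let bP : hyperbolic_frame k b. Proof. by case: hb. Qed.
Local Notation c := (n%:R - 2 : C).

Let c_gt0 : 0 < c.
Proof. by rewrite subr_gt0 ltr_nat. Qed.
Let c_neq0 : c != 0. Proof. by rewrite gt_eqF. Qed.
Let n2 : 2 != 0 :> C. Proof. by rewrite pnatr_eq0. Qed.

Let hg x : vsval x \in g. Proof. by rewrite gE; apply/eqP; exact: (cartan_antisym UE hb). Qed.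

Lemma killing_cartan x y : killing g (vsval x) (vsval y) = c * \tr (vsval x *m vsval y).
Proof. exact: killing_so. Qed.

Definition cartan_pairing x y : C^o := c * \tr (vsval x *m vsval y).
Lemma cartan_pairing_is_linear x : linear (cartan_pairing x).
Proof.
move=> d y z; rewrite /cartan_pairing linearP /= mxtraceD mxtraceZ.
by rewrite mulrDr regularZ mulrCA.
Qed.
HB.instance Definition _ x :=
  GRing.isLinear.Build C _ _ _ (cartan_pairing x) (cartan_pairing_is_linear x).

Definition cartan_flat x : dual h := linfun (cartan_pairing x).
Lemma cartan_flat_is_linear : linear cartan_flat.
Proof.
move=> d x y; apply/lfunP => z; rewrite add_lfunE scale_lfunE !lfunE /=.
rewrite /cartan_pairing linearP /= mulmxDl -scalemxAl mxtraceD mxtraceZ.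
by rewrite mulrDr regularZ mulrCA.
Qed.
HB.instance Definition _ :=
  GRing.isLinear.Build C _ _ _ cartan_flat cartan_flat_is_linear.

Lemma killing_dualE : killing_dual g h = (linfun cartan_flat)^-1%VF.
Proof.
rewrite /killing_dual; congr (linfun _)^-1%VF; apply/funext => x.
rewrite /cartan_flat; congr linfun; apply/funext => y; exact: killing_cartan.
Qed.

Lemma trace_coroot i (X : 'M[C]_n) : X^T = - X ->
  \tr (frame_coroot b i *m X) = 2 * coroot_coord b i X.
Proof.
move=> XT; have tr11 (u w : 'rV[C]_n) : \tr (u^T *m w *m X) = dotp (w *m X) u.
  by rewrite -mulmxA mxtrace_mulC /mxtrace big_ord1.
rewrite /frame_coroot /wedge mulmxBl linearB /= !tr11 /coroot_coord.
by rewrite [X in _ - X](dotp_antisym _ _ XT) opprK [X in _ + X]dotpC mulr_natl mulr2n.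
Qed.

Lemma cartan_flat_coroot i : cartan_flat (coroot_subvs hb i) = (2 * c) *: wt i.
Proof.
apply/lfunP => y; rewrite scale_lfunE fund_weightE lfunE /= /cartan_pairing /=.
by rewrite trace_coroot ?(cartan_antisym UE hb) // regularZ; ring.
Qed.

(** Nondegeneracy on [h], tested on the coroots; it makes the inverse in [killing_dual] a genuine
    left inverse. *)
Lemma cartan_flat_inj : lker (linfun cartan_flat) == 0%VS.
Proof.
rewrite -subv0; apply/subvP => x; rewrite memv_ker lfunE /= memv0 => /eqP x0.
rewrite (cartan_expansion hb x) big1 // => i _.
have := congr1 (fun a : dual h => a (coroot_subvs hb i)) x0.
rewrite zero_lfunE lfunE /= /cartan_pairing mxtrace_mulC trace_coroot ?(cartan_antisym UE hb) //.
by move/eqP; rewrite !mulf_eq0 (negPf c_neq0) (negPf n2) => /eqP->; rewrite scale0r.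
Qed.

Lemma killing_dual_fund i : killing_dual g h (wt i) = (2 * c)^-1 *: coroot_subvs hb i.
Proof.
have := lker0_lfunK cartan_flat_inj (coroot_subvs hb i).
rewrite -killing_dualE lfunE /= cartan_flat_coroot linearZ /= => <-.
by rewrite scalerA mulVf ?scale1r // mulf_neq0.
Qed.

Lemma dual_formDl a a' d : dual_form g h (a + a') d = dual_form g h a d + dual_form g h a' d.
Proof. by rewrite /dual_form !killing_cartan !linearD /= mulmxDl linearD mulrDr. Qed.
Lemma dual_formZl e a d : dual_form g h (e *: a) d = e * dual_form g h a d.
Proof. by rewrite /dual_form !killing_cartan !linearZ /= -scalemxAl linearZ mulrCA. Qed.
Lemma dual_formC a d : dual_form g h a d = dual_form g h d a.
Proof. by rewrite /dual_form !killing_cartan mxtrace_mulC. Qed.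

Lemma dual_formDr a a' d : dual_form g h d (a + a') = dual_form g h d a + dual_form g h d a'.
Proof. by rewrite dual_formC dual_formDl !(dual_formC d). Qed.

(** The coroots are orthogonal of square norm 2c for the Killing form, so the dual basis is
    orthogonal of square norm 1/(2c). *)
Lemma dual_form_fund i j : dual_form g h (wt i) (wt j) = (i == j)%:R / (2 * c).
Proof.
rewrite /dual_form killing_cartan !killing_dual_fund ![vsval (_ *: _)]linearZ /=.
rewrite -scalemxAl -scalemxAr !mxtraceZ trace_coroot ?tr_wedge // (coroot_coord_coroot bP).
have nn : 2 * c != 0 by rewrite mulf_neq0.
by move: c_neq0 n2 nn; set d := n%:R - 2 => d0 n0 _; field; rewrite d0.
Qed.

Lemma dual_form_short i (s : bool) :
  dual_form g h ((-1) ^+ s *: wt i) ((-1) ^+ s *: wt i) = (2 * c)^-1.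
Proof.
rewrite dual_formZl dual_formC dual_formZl dual_form_fund eqxx mul1r mulrA.
by rewrite -expr2 sqrr_sign mul1r.
Qed.

Lemma dual_form_long i j (s t : bool) : i != j ->
  dual_form g h ((-1) ^+ s *: wt i + (-1) ^+ t *: wt j) ((-1) ^+ s *: wt i + (-1) ^+ t *: wt j)
    = 2 * (2 * c)^-1.
Proof.
move=> ij; have E i' j' (s' t' : bool) : i' != j' ->
    dual_form g h ((-1) ^+ s' *: wt i') ((-1) ^+ t' *: wt j') = 0.
  by move=> nij; rewrite dual_formZl dual_formC dual_formZl dual_form_fund eq_sym (negPf nij) mul0r !mulr0.
rewrite dual_formDl !dual_formDr !dual_form_short !E // 1?eq_sym //.
by rewrite addr0 add0r [RHS]mulr_natl mulr2n.
Qed.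

Let norm_gt0 : 0 < (2 * c)^-1. Proof. by rewrite invr_gt0 mulr_gt0 ?ltr0n ?c_gt0. Qed.

Lemma dual_form_root_neq0 a : lie_roots U h a -> dual_form g h a a != 0.
Proof.
rewrite (lie_roots_split UE hb) => -[[i [s ->]]|[i [j [s [t [ij ->]]]]]].
  by rewrite dual_form_short gt_eqF.
by rewrite dual_form_long // mulf_neq0 // gt_eqF.
Qed.

Lemma short_rootsE : (0 < m)%N -> short_roots (dual_form g h) (lie_roots U h) =
  [set a | exists i (s : bool), a = (-1) ^+ s *: wt i].
Proof.
move=> m0; rewrite (lie_roots_split UE hb); apply/seteqP; split=> a /=; last first.
  case=> i [s ->]; split; first by left; exists i, s.
  move=> _ [[j [t ->]]|[j [l [t [t' [jl ->]]]]]]; rewrite dual_form_short ?dual_form_short //.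
  by rewrite dual_form_long // ler_peMl ?ler1n // ltW.
move=> [[sh _|[i [j [s [t [ij ->]]]]] H]]; first exact: sh.
have := H _ (or_introl (ex_intro _ (Ordinal m0) (ex_intro _ false erefl))).
by rewrite dual_form_long // dual_form_short ger_pMl // lern1.
Qed.

(** The bound supplies a root of larger norm to compare with; for [m = 1] all roots have the same
    length. *)
Lemma long_rootsE : (1 < m)%N -> long_roots (dual_form g h) (lie_roots U h) =
  [set a | exists i j (s t : bool),
     i != j /\ a = (-1) ^+ s *: wt i + (-1) ^+ t *: wt j].
Proof.
move=> m1; rewrite (lie_roots_split UE hb); apply/seteqP; split=> a /=; last first.
  case=> i [j [s [t [ij ->]]]]; split; first by right; exists i, j, s, t.
  move=> _ [[j' [t' ->]]|[j' [l [t' [t'' [jl ->]]]]]]; rewrite !dual_form_long //.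
  by rewrite dual_form_short ler_peMl ?ler1n // ltW.
move=> [[[i [s ->]] H|lg _]]; last exact: lg.
have m0 : (0 < m)%N by exact: ltnW.
have ij : Ordinal m0 != Ordinal m1 by [].
have := H _ (or_intror (ex_intro _ (Ordinal m0) (ex_intro _ (Ordinal m1)
  (ex_intro _ false (ex_intro _ false (conj ij erefl)))))).
by rewrite dual_form_long // dual_form_short ger_pMl // lern1.
Qed.

End DualForm.

(** * Simplicity and the vector representation *)

Section BlockSimple.
Variables (F : fieldType) (n k : nat).
Hypotheses (n2 : 2 != 0 :> F) (k3 : (2 < k)%N) (kn : (k <= n)%N).
Implicit Types (a b c d : 'I_n) (X Y : 'M[F]_n).

(** The generator F_ab = E_ab - E_ba, written as a bivector so that the calculus of [wedge]
    applies. *)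
Definition so_unit a b : 'M[F]_n := wedge (delta_mx 0 a) (delta_mx 0 b).

Lemma so_unitC a b : so_unit a b = - so_unit b a.
Proof. exact: wedgeC. Qed.

Lemma dotp_deltas a b : dotp (delta_mx 0 a : 'rV[F]_n) (delta_mx 0 b) = (a == b)%:R.
Proof. by rewrite dotp_delta mxE eqxx eq_sym. Qed.

Lemma delta_supp a (j : 'I_n) : (a < k)%N -> (k <= j)%N -> (delta_mx 0 a : 'rV[F]_n) 0 j = 0.
Proof. by move=> ak kj; rewrite mxE; case: (j =P a) => [ja|]; rewrite ?andbF //; rewrite ja leqNgt ak in kj. Qed.

Lemma so_unit_block a b : (a < k)%N -> (b < k)%N -> so_unit a b \in so_block k.
Proof. by move=> ak bk; apply: wedge_so_block => j; exact: delta_supp. Qed.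

Lemma so_unit_entry a b c d :
  so_unit a b c d = ((c == a) && (d == b))%:R - ((c == b) && (d == a))%:R.
Proof.
by rewrite /so_unit /wedge !mxE !big_ord1 !mxE !eqxx /= -!natrM !mulnb.
Qed.

Lemma so_unit_neq0 a b : a != b -> so_unit a b != 0.
Proof.
move=> ab; apply/eqP => /matrixP/(_ a b); rewrite so_unit_entry mxE !eqxx (negPf ab) subr0.
by apply/eqP; rewrite oner_eq0.
Qed.

Lemma lie_so_unit a c d : a != c -> c != d -> a != d ->
  lie (so_unit a c) (so_unit c d) = so_unit a d.
Proof.
move=> ac cd ad; rewrite /so_unit lie_wedge ?tr_wedge // !mul_wedge !dotp_deltas.
rewrite eqxx [c == a]eq_sym [d == a]eq_sym [d == c]eq_sym (negPf ac) (negPf ad) (negPf cd).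
by rewrite !scale0r scale1r !sub0r oppr0 wedge0r addr0 wedgeNl opprK.
Qed.

Lemma lie_so_unit_entry a b Y c d : lie (so_unit a b) Y c d =
  (c == a)%:R * Y b d - (c == b)%:R * Y a d + (d == a)%:R * Y c b - (d == b)%:R * Y c a.
Proof.
have E : so_unit a b = delta_mx a b - delta_mx b a.
  by apply/matrixP => i j; rewrite so_unit_entry !mxE.
have L i j : (delta_mx i j *m Y) c d = (c == i)%:R * Y j d.
  by have := mul_delta_entry (1%:M) Y i j c d; rewrite mul1mx => ->; rewrite mxE.
have R i j : (Y *m delta_mx i j) c d = (d == j)%:R * Y c i.
  by have := mul_delta_entry Y 1%:M i j c d; rewrite mulmx1 => ->; rewrite mulrC mxE eq_sym.
have subE (A B : 'M[F]_n) : (A - B) c d = A c d - B c d by rewrite !mxE.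
by rewrite /lie E mulmxBl mulmxBr !subE !(L, R); ring.
Qed.

(* (ad F_ab)^2 is diagonal in the basis of the F_cd. *)
Lemma ad_so_unit2_entry a b X c d : a != b -> X^T = - X ->
  lie (so_unit a b) (lie (so_unit a b) X) c d =
  - ((c \in [:: a; b]) (+) (d \in [:: a; b]))%:R * X c d.
Proof.
move=> ab XT; have Xt i j : X j i = - X i j.
  by have := congr1 (fun M : 'M_n => M i j) XT; rewrite !mxE.
have X0 i : X i i = 0.
  have /eqP := Xt i i; by rewrite -addr_eq0 -mulr2n -mulr_natl mulf_eq0 (negPf n2) => /eqP.
rewrite !lie_so_unit_entry !inE.
have ba : (b == a) = false by rewrite eq_sym (negPf ab).
(case: (eqVneq c a) => [->|ca]; last case: (eqVneq c b) => [->|cb]);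
(case: (eqVneq d a) => [->|da]; last case: (eqVneq d b) => [->|db]);
by rewrite ?eqxx ?(negPf ab) ?ba /= ?X0 ?(Xt a b); ring.
Qed.

Lemma exists_other (s : seq 'I_n) : (size s < k)%N -> exists2 c : 'I_n, (c < k)%N & c \notin s.
Proof.
move=> sk; apply: contrapT => H.
have sub : {subset [seq widen_ord kn i | i <- enum 'I_k] <= s}.
  move=> _ /mapP[i _ ->]; apply: contrapT => /negP ns.
  by apply: H; exists (widen_ord kn i) => //=.
have /uniq_leq_size : uniq [seq widen_ord kn i | i <- enum 'I_k].
  rewrite map_inj_uniq ?enum_uniq // => i j e; apply: val_inj.
  exact: (congr1 val e).
by move/(_ _ sub); rewrite size_map size_enum_ord leqNgt sk.
Qed.

(* The operators (ad F_ab)^2 separate the lines spanned by the F_cd; this fails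
   for k = 4, where so_4 is not simple. *)
Lemma separate_pairs c d c' d' : k != 4%N ->
    [/\ (c < k)%N, (d < k)%N, (c' < k)%N & (d' < k)%N] -> c != d -> c' != d' ->
    ~~ ((c == c') && (d == d') || (c == d') && (d == c')) ->
  exists a b, [/\ (a < k)%N, (b < k)%N, a != b &
    (c \in [:: a; b]) (+) (d \in [:: a; b]) != (c' \in [:: a; b]) (+) (d' \in [:: a; b])].
Proof.
move=> k4 [ck dk c'k d'k] cd c'd' ne.
(* If the pairs share exactly one index, F_cd itself separates them. *)
have [H|H] := boolP ((c' \in [:: c; d]) (+) (d' \in [:: c; d])).
  by exists c, d; split=> //; rewrite H !inE !eqxx orbT.
have [H1|H1] := boolP (c' \in [:: c; d]); last first.
  have H2 : d' \notin [:: c; d] by move: H; rewrite (negPf H1).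
  move: H1 H2; rewrite !inE !negb_or => /andP[c'c c'd] /andP[d'c d'd].
  (* Disjoint pairs need a fifth index: four distinct ones force [k] to be at least 4, and [k != 4]
     leaves room for another. *)
  have [|e ek] := @exists_other [:: c; d; c'; d'].
    rewrite /= ltn_neqAle eq_sym k4 /=.
    have /uniq_leq_size : uniq [:: c; d; c'; d'].
      by rewrite /= !inE !negb_or cd c'd' [c == c']eq_sym c'c [c == d']eq_sym d'c [d == c']eq_sym c'd [d == d']eq_sym d'd.
    move=> /(_ [seq widen_ord kn i | i <- enum 'I_k]); rewrite size_map size_enum_ord; apply.
    have im (x : 'I_n) : (x < k)%N -> x \in [seq widen_ord kn i | i <- enum 'I_k].
      by move=> xk; apply/mapP; exists (Ordinal xk); rewrite ?mem_enum //=; exact: val_inj.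
    by move=> x; rewrite !inE => /or4P[] /eqP->; exact: im.
  rewrite !inE !negb_or => /and4P[ec ed ec' ed'].
  exists c, e; split; rewrite // 1?eq_sym // !inE eqxx.
  by rewrite (negPf c'c) (negPf d'c) [d == c]eq_sym (negPf cd) ![_ == e]eq_sym (negPf ed) (negPf ec') (negPf ed').
move: H; rewrite H1 /= negbK => H2; case/negP: ne; move: H1 H2 c'd'.
rewrite !inE => /orP[] /eqP-> /orP[] /eqP->; rewrite ?eqxx // ?orbT //.
Qed.

Variable U : {vspace 'M[F]_n}.
Hypothesis UE : U =i so_block k.

Let anti X : X \in U -> X^T = - X. Proof. by rewrite UE => /so_blockP[]. Qed.
Let entryN X c d : X \in U -> X d c = - X c d.
Proof. by move=> /anti /(congr1 (fun M : 'M_n => M c d)); rewrite !mxE. Qed.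
Let entry_diag X c : X \in U -> X c c = 0.
Proof.
by move=> /(entryN c c) /eqP; rewrite -addr_eq0 -mulr2n -mulr_natl mulf_eq0 (negPf n2) => /eqP.
Qed.
Let entry_supp X c d : X \in U -> X c d != 0 -> (c < k)%N /\ (d < k)%N.
Proof.
move=> XU X0; have [_ X0'] := so_blockP _ _ (etrans (esym (UE X)) XU : X \in so_block k).
split; rewrite ltnNge; apply/negP => le; move/eqP: X0; apply; first exact: X0'.
by rewrite (entryN d c XU) X0' // oppr0.
Qed.

Lemma so_unit_expansion X : X \in U -> X = 2^-1 *: \sum_a \sum_b X a b *: so_unit a b.
Proof.
move=> XU; have E : \sum_a \sum_b X a b *: so_unit a b = X *+ 2.
  transitivity (X - X^T); last by rewrite (anti XU) opprK mulr2n.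
  transitivity (\sum_a \sum_b X a b *: delta_mx a b - (\sum_a \sum_b X a b *: delta_mx a b)^T);
    last by rewrite -matrix_sum_delta.
  rewrite linear_sum /= -sumrB; apply: eq_bigr => a _.
  rewrite linear_sum -sumrB; apply: eq_bigr => b _.
  rewrite linearZ /= trmx_delta -scalerBr; congr (_ *: _).
  by apply/matrixP => i j; rewrite so_unit_entry !mxE.
by rewrite E -scaler_nat scalerA mulVf ?scale1r.
Qed.

(** Descent on the support of an element of [I]: if it involves two different pairs, a separating
    (ad F_ab)^2 kills one, keeps the other and creates no new entry. *)
Lemma ideal_so_unit (I : {vspace 'M[F]_n}) : k != 4%N -> lie_ideal U I -> I != 0%VS ->
  exists c d, [/\ (c < k)%N, (d < k)%N, c != d & so_unit c d \in I].
Proof.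
move=> k4 [/subvP IU Ist] I0.
have XI := memv_pick I; have X0 : vpick I != 0 by rewrite vpick0.
move: (vpick I) XI X0 => X.
pose supp X := [pred cd : 'I_n * 'I_n | X cd.1 cd.2 != 0].
have [s] := ubnP #|supp X|; elim: s X => // s IH X; rewrite ltnS => Xs XI X0.
have XU := IU _ XI.
have [c [d Xcd]] : exists c d, X c d != 0.
  apply: contrapT => H; move/eqP: X0; apply; apply/matrixP => c d; rewrite [RHS]mxE.
  by apply: contrapT => /eqP nz; apply: H; exists c, d.
have [ck dk] := entry_supp XU Xcd.
have cd : c != d by apply: contraNneq Xcd => ->; rewrite entry_diag.
have [[c' [d' [Xc'd' ne]]]|H] := pselect (exists c' d', X c' d' != 0 /\
    ~~ ((c == c') && (d == d') || (c == d') && (d == c'))).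
  have [c'k d'k] := entry_supp XU Xc'd'.
  have c'd'_neq : c' != d' by apply: contraNneq Xc'd' => ->; rewrite entry_diag.
  have [a [b [ak bk ab sep]]] := separate_pairs k4 (And4 ck dk c'k d'k) cd c'd'_neq ne.
  pose Y := lie (so_unit a b) (lie (so_unit a b) X).
  have FU : so_unit a b \in U by rewrite UE so_unit_block.
  have YI : Y \in I by rewrite /Y !Ist.
  have YE i j : Y i j = - ((i \in [:: a; b]) (+) (j \in [:: a; b]))%:R * X i j.
    exact: ad_so_unit2_entry ab (anti XU).
  have [i [j [i' [j' [Yij Yi'j' Xi'j']]]]] : exists i j i' j',
      [/\ Y i j != 0, Y i' j' = 0 & X i' j' != 0].
    move: sep; have := YE c d; have := YE c' d'.
    case: (_ (+) _); case: (_ (+) _) => // Y1 Y2 _.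
      exists c', d', c, d; split=> //; first by rewrite Y1 mulN1r oppr_eq0.
      by rewrite Y2 oppr0 mul0r.
    exists c, d, c', d'; split=> //; first by rewrite Y2 mulN1r oppr_eq0.
    by rewrite Y1 oppr0 mul0r.
  apply: (IH Y) => //; last by apply: contraNneq Yij => ->; rewrite mxE.
  apply: leq_trans Xs; apply: proper_card; apply/properP; split.
    by apply/fintype.subsetP => -[p q]; rewrite !inE /= YE; apply: contraNneq => ->; rewrite mulr0.
  by exists (i', j'); rewrite !inE /= ?Yi'j' ?eqxx.
exists c, d; split=> //; suff -> : so_unit c d = (X c d)^-1 *: X by rewrite rpredZ.
apply/esym.
suff E : X = X c d *: so_unit c d by rewrite [X in _ *: X]E scalerA mulVf ?scale1r.
apply/matrixP => i j; rewrite mxE so_unit_entry.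
have [/andP[/eqP-> /eqP->]|ne1] := boolP ((i == c) && (j == d)).
  by rewrite (negPf cd) subr0 mulr1.
have [/andP[/eqP-> /eqP->]|ne2] := boolP ((i == d) && (j == c)).
  by rewrite sub0r mulrN1 (entryN c d XU).
rewrite subrr mulr0; apply: contrapT => /eqP nz; apply: H; exists i, j; split=> //.
by rewrite negb_or ![c == _]eq_sym ![d == _]eq_sym ne1 [(j == c) && _]andbC ne2.
Qed.

Lemma so_block_simple : k != 4%N -> lie_simple U.
Proof.
move=> k4; split.
- by move=> X Y; rewrite !UE; exact: so_block_lie.
- have [a ak _] := @exists_other [::] (ltn_trans (isT : 0 < 2)%N k3).
  have [c ck ca] := @exists_other [:: a] (ltn_trans (isT : 1 < 2)%N k3).
  have [d dk dn] := @exists_other [:: a; c] k3.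
  move: ca dn; rewrite !inE negb_or => ca /andP[da dc].
  exists (so_unit a c), (so_unit c d); rewrite !UE !so_unit_block //; split=> //.
  by rewrite lie_so_unit ?so_unit_neq0 // eq_sym.
move=> I Iid; have [->|I0] := eqVneq I 0%VS; [by left | right].
have [c [d [ck dk cd cdI]]] := ideal_so_unit k4 Iid I0.
have [IU Ist] := Iid.
(* Indices are replaced one at a time through [F_ap, F_pq] = F_aq. *)
have step (p q a : 'I_n) : (p < k)%N -> (q < k)%N -> (a < k)%N -> p != q -> a != q ->
    so_unit p q \in I -> so_unit a q \in I.
  move=> pk qk ak pq aq pqI; have [->//|ap] := eqVneq a p.
  by rewrite -(lie_so_unit ap pq aq) Ist // UE so_unit_block.
apply/eqP; rewrite eqEsubv IU; apply/subvP => X XU.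
rewrite (so_unit_expansion XU) rpredZ // rpred_sum // => a _; rewrite rpred_sum // => b _.
have [->|X0] := eqVneq (X a b) 0; first by rewrite scale0r mem0v.
have [ak bk] := entry_supp XU X0.
have ab : a != b by apply: contraNneq X0 => ->; rewrite entry_diag.
rewrite rpredZ //.
have [ad|ad] := eqVneq a d.
  rewrite so_unitC rpredN ad; apply: (step c) => //.
  by rewrite -ad eq_sym.
have adI : so_unit a d \in I by apply: (step c).
rewrite so_unitC rpredN; apply: (step d) => //; rewrite 1?eq_sym //.
by rewrite so_unitC rpredN.
Qed.

Section VectorRepresentation.
Variables (q : 'I_n) (W : {vspace 'M[F]_n}).
Hypothesis kq : (k <= q)%N.
Hypothesis WE : forall X, X \in W <-> exists v : 'rV[F]_n,
  (forall j : 'I_n, (k <= j)%N -> v 0 j = 0) /\ X = wedge v (delta_mx 0 q).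

Lemma lie_wedge_fixed X v : X \in U ->
  lie X (wedge v (delta_mx 0 q)) = - wedge (v *m X) (delta_mx 0 q).
Proof.
move=> XU; rewrite lie_wedge ?anti //.
have [_ X0] := so_blockP _ _ (etrans (esym (UE X)) XU : X \in so_block k).
have -> : (delta_mx 0 q : 'rV[F]_n) *m X = 0 by rewrite -rowE; apply/rowP => j; rewrite !mxE X0.
by rewrite wedge0r addr0.
Qed.

(** Starting from v ^ e with v_i nonzero, two generators through an auxiliary index isolate the i-th
    coordinate and produce e_j ^ e for every other j; one more generator returns e_i ^ e. The
    auxiliary index is where [2 < k] enters. *)
Lemma vector_rep_irreducible : lie_irreducible U W.
Proof.
pose e := delta_mx 0 q : 'rV[F]_n.
have delta_so (a b : 'I_n) : delta_mx 0 a *m so_unit a b = delta_mx 0 b - (a == b)%:R *: delta_mx 0 a :> 'rV[F]_n.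
  by rewrite mul_wedge !dotp_deltas eqxx scale1r.
have qk (a : 'I_n) : (a < k)%N -> a != q by move=> ak; apply: contraTneq ak => ->; rewrite -leqNgt.
split.
- move=> X Y XU /WE[v [v0 ->]]; rewrite lie_wedge_fixed // rpredN; apply/WE.
  exists (v *m X); split=> // j kj; apply: so_block_supp kj; by rewrite -UE.
- have [a ak _] := @exists_other [::] (ltn_trans (isT : 0 < 2)%N k3).
  apply/eqP => W0; have : wedge (delta_mx 0 a) e \in W.
    by apply/WE; exists (delta_mx 0 a); split=> // j; exact: delta_supp.
  by rewrite W0 memv0; apply/negP; apply: so_unit_neq0; exact: qk.
move=> W' /subvP W'W W'st; have [->|W'0] := eqVneq W' 0%VS; [by left | right].
have act v (a b : 'I_n) : (a < k)%N -> (b < k)%N -> wedge v e \in W' -> wedge (v *m so_unit a b) e \in W'.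
  move=> ak bk vW; rewrite -rpredN -lie_wedge_fixed ?W'st // UE so_unit_block //.
have [v [v0 vW'] [i vi]] : exists2 v : 'rV[F]_n,
    (forall j : 'I_n, (k <= j)%N -> v 0 j = 0) /\ wedge v e \in W' & exists i, v 0 i != 0.
  have XW := memv_pick W'; have X0 : vpick W' != 0 by rewrite vpick0.
  have /WE[v [v0 XE]] := W'W _ XW; exists v; first by rewrite -XE.
  apply: contrapT => H; move/eqP: X0; apply; rewrite XE (_ : v = 0) ?wedge0l //.
  by apply/rowP => i; rewrite mxE; apply: contrapT => /eqP nz; apply: H; exists i.
have ik : (i < k)%N by rewrite ltnNge; apply: contra vi => /v0->.
have other (j : 'I_n) : (j < k)%N -> j != i -> wedge (delta_mx 0 j) e \in W'.
  move=> jk ji; have [l lk ln] := @exists_other [:: i; j] k3.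
  move: ln; rewrite !inE negb_or => /andP[li lj].
  have := act _ _ _ lk jk (act _ _ _ ik lk vW').
  rewrite !mul_wedge !(dotpBl, dotpZl) !dotp_deltas !dotp_delta eqxx.
  rewrite (negPf lj) [i == l]eq_sym (negPf li) [i == j]eq_sym (negPf ji).
  rewrite !mulr0 !subr0 mulr1 scale0r subr0 wedgeZl => /(memvZ (v 0 i)^-1).
  by rewrite scalerA mulVf ?scale1r.
have all_j (j : 'I_n) : (j < k)%N -> wedge (delta_mx 0 j) e \in W'.
  move=> jk; have [->|] := eqVneq j i; last exact: other.
  have [l lk ln] := @exists_other [:: i] (ltn_trans (isT : 1 < 2)%N k3).
  rewrite inE in ln; have := act _ _ _ lk ik (other _ lk ln).
  by rewrite delta_so (negPf ln) scale0r subr0.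
apply/eqP; rewrite eqEsubv; apply/andP; split; first exact/subvP.
apply/subvP => X /WE[w [w0 ->]]; rewrite [w]row_sum_delta.
rewrite (big_morph (fun x => wedge x e) (fun x y => @wedgeDl F n x y e) (wedge0l e)).
apply: memv_suml => j _; rewrite wedgeZl.
have [jk|kj] := ltnP j k; first by rewrite rpredZ ?all_j.
by rewrite w0 // scale0r mem0v.
Qed.

Lemma vector_rep_dim : \dim W = k.
Proof.
have [B [dB BE]] := coordinate_block F kn.
pose f : {linear 'rV[F]_n -> 'M[F]_n} := HB.pack (fun x => wedge x (delta_mx 0 q))
  (GRing.isLinear.Build F _ _ _ (fun x => wedge x (delta_mx 0 q)) (wedge_is_linear (delta_mx 0 q))).
have fE v : linfun f v = wedge v (delta_mx 0 q) by rewrite lfunE.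
have -> : W = (linfun f @: B)%VS.
  apply/vspaceP => X; apply/idP/idP => [/WE[v [v0 ->]]|/memv_imgP[v /BE v0 ->]].
    by rewrite -fE memv_img //; apply/BE.
  by rewrite fE; apply/WE; exists v.
rewrite limg_dim_eq //; apply/eqP; rewrite -subv0; apply/subvP => v.
rewrite memv_cap memv_ker fE => /andP[/BE v0 /eqP W0]; rewrite memv0; apply/eqP.
have := mul_wedge (delta_mx 0 q) v (delta_mx 0 q).
rewrite W0 mulmx0 dotpC dotp_delta v0 // scale0r dotp_deltas eqxx scale1r sub0r => /eqP.
by rewrite eq_sym oppr_eq0 => /eqP.
Qed.

End VectorRepresentation.

End BlockSimple.

Lemma so_block_type_B (C : numClosedFieldType) (n m k : nat) (U : {vspace 'M[C]_n}) :
  k = (2 * m + 1)%N -> (0 < m)%N -> (k <= n)%N -> U =i so_block k -> simple_of_type_B m U.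
Proof.
move=> kE m0 kn UE; split.
- by apply: (so_block_simple _ _ kn UE); rewrite ?pnatr_eq0 ?kE //; lia.
- exact: cartan_exists kE kn UE.
move=> h /(cartan_frame kE kn UE)[b hb]; exact: root_system_B_roots UE hb.
Qed.

(** * The grading by two sign changes *)

Section SignAutomorphisms.
Variables (F : fieldType) (n : nat) (s : 'rV[F]_n).
Hypothesis ss : forall i, s 0 i * s 0 i = 1.
Hypothesis n2 : 2 != 0 :> F.

Lemma Ad_signE X i j : Ad (diag_mx s) X i j = s 0 i * s 0 j * X i j.
Proof.
have AA : diag_mx s *m diag_mx s = 1%:M.
  apply/matrixP => a b; rewrite mul_diag_mx !mxE mulrnAr ss.
  by [].
have Au : diag_mx s \in unitmx by case/mulmx1_unit: AA.
have AV : invmx (diag_mx s) = diag_mx s.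
  by rewrite -[RHS]mulmx1 -(mulmxV Au) mulmxA AA mul1mx.
have lin : linear (fun X : 'M[F]_n => diag_mx s *m X *m invmx (diag_mx s)).
  by move=> c Y Z; rewrite mulmxDr mulmxDl -scalemxAr -scalemxAl.
pose f : {linear 'M[F]_n -> 'M[F]_n} := HB.pack (fun X : 'M[F]_n => diag_mx s *m X *m invmx (diag_mx s))
  (GRing.isLinear.Build F _ _ _ (fun X : 'M[F]_n => diag_mx s *m X *m invmx (diag_mx s)) lin).
rewrite /Ad (lfunE f) /= AV mul_mx_diag mxE mul_diag_mx mxE.
by rewrite mulrAC.
Qed.

Local Notation sg := (Ad (diag_mx s)).

Lemma Ad_signK X : sg (sg X) = X.
Proof.
apply/matrixP => i j; rewrite !Ad_signE.
transitivity (s 0 i * s 0 i * (s 0 j * s 0 j * X i j)); first by ring.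
by rewrite !ss !mul1r.
Qed.

Lemma Ad_sign_lie X Y : sg (lie X Y) = lie (sg X) (sg Y).
Proof.
apply/matrixP => i j; rewrite Ad_signE /lie !mxE mulrBr !mulr_sumr.
by congr (_ - _); apply: eq_bigr => a _; rewrite !Ad_signE -[LHS]mul1r -(ss a); ring.
Qed.

Lemma Ad_sign_antisym X : (sg X)^T = - sg X <-> X^T = - X.
Proof.
have H Y : Y^T = - Y -> (sg Y)^T = - sg Y.
  move=> YT; apply/matrixP => i j; have := congr1 (fun M : 'M_n => M i j) YT.
  by rewrite !mxE !Ad_signE => ->; rewrite mulrN [s 0 j * _]mulrC.
by split=> [/H|/H//]; rewrite Ad_signK.
Qed.

Lemma lie_automorphism_sign : lie_automorphism (so F n) sg.
Proof.
split; last by move=> X Y _ _; exact: Ad_sign_lie.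
  apply/vspaceP => X; apply/memv_imgP/idP => [[Y Yg ->]|Xg].
    by move: Yg; rewrite !memv_so => /eqP/Ad_sign_antisym/eqP.
  exists (sg X); last by rewrite Ad_signK.
  by move: Xg; rewrite !memv_so => /eqP/Ad_sign_antisym/eqP.
by move=> X Y _ _ /(congr1 sg); rewrite !Ad_signK.
Qed.

(** The generator F_ab is negated, so the automorphism is not the identity. *)
Lemma order_on_sign a b : s 0 a * s 0 b = -1 -> order_on (so F n) sg 2.
Proof.
move=> sab; split=> [//|X _|k /andP[k0 k2] H]; first by rewrite /= Ad_signK.
have k1 : k = 1%N by lia.
have ab : a != b.
  apply: contraNneq n2 => ab; have := ss a; rewrite {2}ab sab => /eqP.
  by rewrite eq_sym -addr_eq0 => /eqP <-.
have := H (so_unit F a b); rewrite memv_so /so_unit tr_wedge eqxx => /(_ isT).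
move/(congr1 (fun M : 'M_n => M a b)); rewrite k1 /= Ad_signE sab mulN1r -/(so_unit F a b).
rewrite so_unit_entry !eqxx (negPf ab) subr0 => /eqP.
by rewrite eq_sym -addr_eq0 (negPf n2).
Qed.

End SignAutomorphisms.

Lemma Ad_sign_comm (F : fieldType) n (s t : 'rV[F]_n) X :
  (forall i, s 0 i * s 0 i = 1) -> (forall i, t 0 i * t 0 i = 1) ->
  Ad (diag_mx s) (Ad (diag_mx t) X) = Ad (diag_mx t) (Ad (diag_mx s) X).
Proof. by move=> ss tt; apply/matrixP => i j; rewrite !Ad_signE // mulrCA. Qed.

Section Signs.
Variables (F : fieldType) (l : nat).

Definition sign0 : 'rV[F]_(2 * l + 3) := \row_i (-1) ^+ (i == (2 * l + 2)%N :> nat).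
Definition sign1 : 'rV[F]_(2 * l + 3) := \row_i (-1) ^+ (i == (2 * l + 1)%N :> nat).

Lemma sign0_sqr i : sign0 0 i * sign0 0 i = 1.
Proof. by rewrite mxE -signr_addb addbb. Qed.
Lemma sign1_sqr i : sign1 0 i * sign1 0 i = 1.
Proof. by rewrite mxE -signr_addb addbb. Qed.

Lemma sum_munit_entry m a b : (0 < m)%N ->
  (\sum_(1 <= i < m) munit F l i i) a b = ((a == b) && (a.+1 < m)%N)%:R.
Proof.
move=> m0; rewrite summxE.
have [/= am|/= am] := boolP (a.+1 < m)%N; last first.
  rewrite andbF big1_seq // => i /andP[_]; rewrite mem_index_iota => /andP[_ im].
  by rewrite mxE; case: eqP => // ai; rewrite ai im in am.
rewrite andbT (bigD1_seq a.+1) ?iota_uniq ?mem_index_iota //= big1 => [|i ia].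
  by rewrite addr0 mxE eqxx /= eqSS eq_sym.
by rewrite mxE eq_sym (negPf ia).
Qed.

Lemma sigma0E : sigma0 F l = Ad (diag_mx sign0).
Proof.
rewrite /sigma0; congr Ad; apply/matrixP => a b.
rewrite mxE mxE sum_munit_entry ?addn_gt0 ?orbT // !mxE.
have [->|ab] := eqVneq a b; last first.
  rewrite (_ : _ && _ = false) ?oppr0 ?addr0 //; apply: contraNF ab => /andP[/eqP ea /eqP eb].
  by apply/eqP/val_inj/succn_inj; rewrite ea eb.
rewrite !andbb mulr1n /=; have bN := ltn_ord b.
have [eq|ne] := eqVneq (b : nat) (2 * l + 2)%N.
  rewrite (_ : b.+1 == 2 * l + 3 = true)%N; last lia.
  rewrite (_ : b.+1 < 2 * l + 3 = false)%N; last lia.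
  by rewrite addr0.
rewrite (_ : b.+1 == 2 * l + 3 = false)%N; last lia.
rewrite (_ : b.+1 < 2 * l + 3 = true)%N; last lia.
by rewrite oppr0 add0r.
Qed.

Lemma sigma1E : sigma1 F l = Ad (diag_mx sign1).
Proof.
rewrite /sigma1; congr Ad; apply/matrixP => a b.
rewrite mxE mxE mxE sum_munit_entry ?addn_gt0 ?orbT // !mxE.
have [->|ab] := eqVneq a b; last first.
  have nab m : ((a.+1 == m) && (b.+1 == m)) = false.
    apply: contraNF ab => /andP[/eqP ea /eqP eb].
    by apply/eqP/val_inj/succn_inj; rewrite ea eb.
  by rewrite !nab oppr0 !addr0.
rewrite !andbb mulr1n /=; have bN := ltn_ord b.
have [lt|gt|eq] := ltngtP b (2 * l + 1)%N.
- rewrite (_ : b.+1 == 2 * l + 2 = false)%N; last lia.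
  rewrite (_ : b.+1 == 2 * l + 3 = false)%N; last lia.
  rewrite (_ : b.+1 < 2 * l + 2 = true)%N; last lia.
  by rewrite oppr0 !add0r.
- rewrite (_ : b.+1 == 2 * l + 2 = false)%N; last lia.
  rewrite (_ : b.+1 == 2 * l + 3 = true)%N; last lia.
  rewrite (_ : b.+1 < 2 * l + 2 = false)%N; last lia.
  by rewrite oppr0 add0r addr0.
- rewrite (_ : b.+1 == 2 * l + 2 = true)%N; last lia.
  rewrite (_ : b.+1 == 2 * l + 3 = false)%N; last lia.
  rewrite (_ : b.+1 < 2 * l + 2 = false)%N; last lia.
  by rewrite !addr0.
Qed.

End Signs.

Section Grading.
Variables (R : realType) (l : nat).
Local Notation C := R[i].
Local Notation N := (2 * l + 3)%N.
Local Notation k := (2 * l + 1)%N.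
Local Notation gr := (graded (so C N) (sigma0 C l) (sigma1 C l) 2 2).
Implicit Type X : 'M[C]_N.

Lemma epsilonC2 : epsilonC R 2 = -1.
Proof.
rewrite /epsilonC mulrAC divff ?pnatr_eq0 // mul1r cospi sinpi.
by apply/eqP; rewrite eq_complex /= oppr0 !eqxx.
Qed.

Lemma expz_sign (F : fieldType) (p : int) : (-1 : F) ^ p = (-1) ^+ odd `|p|%N.
Proof.
case: p => p; first by rewrite absz_nat signr_odd.
rewrite NegzE abszN absz_nat signr_odd -exprnN.
by rewrite -[in LHS]signr_odd invr_sign signr_odd.
Qed.

(** Both automorphisms scale each entry by a sign, so a degree is a condition on the support alone;
    in terms of parities, the later inclusions become arithmetic on indices. *)
Lemma gradedP X (p q : int) : X \in gr p q <-> X^T = - X /\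
  forall i j, X i j != 0 ->
    (i == (2 * l + 2)%N :> nat) (+) (j == (2 * l + 2)%N :> nat) = odd `|p|%N /\
    (i == (2 * l + 1)%N :> nat) (+) (j == (2 * l + 1)%N :> nat) = odd `|q|%N.
Proof.
have n2 : 2 != 0 :> C by rewrite pnatr_eq0.
have signP (a b : bool) (x : C) : (-1) ^+ a * x = (-1) ^+ b * x <-> (x != 0 -> a = b).
  split=> [/eqP|H]; last by have [->|/H->] := eqVneq x 0; rewrite ?mulr0.
  move=> E x0; apply/eqP; move: E; rewrite (inj_eq (mulIf x0)).
  by case: a; case: b => //=; rewrite ?[_ == 1 :> C]eq_sym -addr_eq0 (negPf n2).
have eigP (s : 'rV[C]_N) (c : C) : (forall i, s 0 i * s 0 i = 1) ->
    (X \in passmx.leigenspace (Ad (diag_mx s)) c) <-> forall i j, s 0 i * s 0 j * X i j = c * X i j.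
  move=> ss; rewrite memv_ker add_lfunE opp_lfunE scale_lfunE id_lfunE subr_eq0; split.
    by move/eqP/matrixP => H i j; rewrite -Ad_signE // H mxE.
  by move=> H; apply/eqP/matrixP => i j; rewrite Ad_signE // H mxE.
have L0 := @sigma0E C l; have L1 := @sigma1E C l.
rewrite /graded L0 L1 epsilonC2 !expz_sign; split.
  case/memv_capP => /memv_capP[XT /(eigP _ _ (@sign0_sqr C l)) H0] /(eigP _ _ (@sign1_sqr C l)) H1.
  split=> [|i j Xij]; first by apply/eqP; rewrite -memv_so.
  have := H0 i j; have := H1 i j.
  by rewrite !mxE -!signr_addb => /signP/(_ Xij)-> /signP/(_ Xij)->.
case=> XT H; apply/memv_capP; split; first (apply/memv_capP; split).
- by rewrite memv_so XT eqxx.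
- apply/(eigP _ _ (@sign0_sqr C l)) => i j; rewrite !mxE -signr_addb.
  by apply/signP => /H[].
apply/(eigP _ _ (@sign1_sqr C l)) => i j; rewrite !mxE -signr_addb.
by apply/signP => /H[].
Qed.

Lemma graded_parity X p q p' q' : odd `|p|%N = odd `|p'|%N -> odd `|q|%N = odd `|q'|%N ->
  X \in gr p q -> X \in gr p' q'.
Proof. by move=> pp qq /gradedP[XT H]; apply/gradedP; rewrite -pp -qq. Qed.

Let n2 : 2 != 0 :> C. Proof. by rewrite pnatr_eq0. Qed.
Let diag0 X i : X^T = - X -> X i i = 0.
Proof.
move=> /(congr1 (fun M : 'M_N => M i i)); rewrite !mxE => /eqP.
by rewrite -addr_eq0 -mulr2n mulrn_eq0 => /eqP.
Qed.
Let entryN X i j : X^T = - X -> X j i = - X i j.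
Proof. by move=> /(congr1 (fun M : 'M_N => M i j)); rewrite !mxE. Qed.

Lemma graded00 : gr 0 0 =i so_block k.
Proof.
move=> X; apply/idP/so_blockP => [/gradedP[XT H]|[XT X0]].
  split=> // i j ki; apply: contrapT => /eqP Xij; have [] := H i j Xij => /= H0 H1.
  have iN := ltn_ord i; have jN := ltn_ord j.
  have ij : i = j by apply: val_inj => /=; lia.
  by move: Xij; rewrite ij diag0 ?eqxx.
apply/gradedP; split=> // i j Xij.
have ik : (i < k)%N by rewrite ltnNge; apply: contra Xij => /X0->.
have jk : (j < k)%N by rewrite ltnNge; apply: contra Xij => kj; rewrite (entryN j i XT) X0 ?oppr0.
by rewrite /=; lia.
Qed.

Lemma wedge_delta_entry (v : 'rV[C]_N) q i j :
  wedge v (delta_mx 0 q) i j = v 0 i * (j == q)%:R - (i == q)%:R * v 0 j.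
Proof. by rewrite /wedge !mxE !big_ord1 !mxE eqxx. Qed.

Lemma antisym_wedge X (q : 'I_N) : (k <= q)%N -> X^T = - X ->
  (forall i j, X i j != 0 -> (i < k)%N && (j == q) || (i == q) && (j < k)%N) ->
  exists v : 'rV[C]_N, (forall j : 'I_N, (k <= j)%N -> v 0 j = 0) /\ X = wedge v (delta_mx 0 q).
Proof.
move=> kq XT H; exists (\row_i X i q); split=> [j kj|].
  rewrite mxE; apply: contrapT => /eqP /H /orP[/andP[jk _]|/andP[_ qk]].
    by rewrite leqNgt jk in kj.
  by rewrite leqNgt qk in kq.
apply/matrixP => i j; rewrite wedge_delta_entry !mxE.
have [->|jq] := eqVneq j q; have [->|iq] := eqVneq i q.
- by rewrite diag0 // mulr0 mul0r subrr.
- by rewrite mulr1 mul0r subr0.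
- by rewrite mulr0 mul1r sub0r (entryN j q XT).
- rewrite mulr0 mul0r subrr; apply: contrapT => /eqP /H.
  by rewrite (negPf jq) (negPf iq) andbF.
Qed.

Lemma wedge_entry_neq0 (v : 'rV[C]_N) (q i j : 'I_N) : (k <= q)%N ->
  (forall j : 'I_N, (k <= j)%N -> v 0 j = 0) -> wedge v (delta_mx 0 q) i j != 0 ->
  (i < k)%N && (j == q) || (i == q) && (j < k)%N.
Proof.
move=> kq v0; rewrite wedge_delta_entry.
have [ik|ki] := ltnP i k; have [jk|kj] := ltnP j k.
- by case: (j == q); case: (i == q); rewrite ?mulr0n ?mulr0 ?mul0r ?subrr ?eqxx.
- by rewrite (v0 j) // mulr0 subr0; case: (j == q); rewrite ?mulr0n ?mulr0 ?eqxx.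
- by rewrite (v0 i) // mul0r sub0r; case: (i == q); rewrite ?mulr0n ?mul0r ?oppr0 ?eqxx ?orbT.
- by rewrite (v0 i) // (v0 j) // mulr0 mul0r subrr eqxx.
Qed.

(** One statement for both vector pieces: the parities of the degree say which of the last two
    coordinates [q] is. *)
Lemma graded_vector X (q : 'I_N) (p p' : int) : (k <= q)%N ->
  (odd `|p|%N = (val q == (2 * l + 2)%N)) -> (odd `|p'|%N = (val q == (2 * l + 1)%N)) ->
  X \in gr p p' <->
  exists v : 'rV[C]_N, (forall j : 'I_N, (k <= j)%N -> v 0 j = 0) /\ X = wedge v (delta_mx 0 q).
Proof.
move=> kq pE p'E; have qN := ltn_ord q; split=> [/gradedP[XT H]|[v [v0 XE]]].
  apply: antisym_wedge => // i j Xij; have [] := H i j Xij; rewrite pE p'E /= => H0 H1.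
  have iN := ltn_ord i; have jN := ltn_ord j.
  rewrite -[j == q]/(j == q :> nat) -[i == q]/(i == q :> nat).
  move: H0 H1 kq iN jN qN; clear.
  move: (nat_of_ord i) (nat_of_ord j) (nat_of_ord q) => a b c.
  by repeat (case: eqP => ?); rewrite /= ?andbF ?andbT ?orbF; lia.
apply/gradedP; split=> [|i j]; first by rewrite XE tr_wedge.
rewrite XE => /(wedge_entry_neq0 kq v0); rewrite pE p'E /=.
rewrite -[j == q]/(j == q :> nat) -[i == q]/(i == q :> nat).
move: kq qN; clear; move: (nat_of_ord i) (nat_of_ord j) (nat_of_ord q) => a b c kc cN.
by case/orP=> /andP[]; [move=> ak /eqP-> | move=> /eqP-> ak]; split;
  repeat (case: eqP => ?); rewrite //=; lia.
Qed.

Lemma graded01 (q : 'I_N) : val q = (2 * l + 1)%N ->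
  forall X, X \in gr 0 1 <-> exists v : 'rV[C]_N,
    (forall j : 'I_N, (k <= j)%N -> v 0 j = 0) /\ X = wedge v (delta_mx 0 q).
Proof. by move=> qE X; apply: graded_vector; rewrite ?qE //=; lia. Qed.

Lemma graded10 (q : 'I_N) : val q = (2 * l + 2)%N ->
  forall X, X \in gr 1 0 <-> exists v : 'rV[C]_N,
    (forall j : 'I_N, (k <= j)%N -> v 0 j = 0) /\ X = wedge v (delta_mx 0 q).
Proof. by move=> qE X; apply: graded_vector; rewrite ?qE //=; lia. Qed.

Variables q1 q2 : 'I_N.
Hypotheses (q1E : val q1 = (2 * l + 1)%N) (q2E : val q2 = (2 * l + 2)%N).

Lemma graded11 : gr 1 1 = <[so_unit C q1 q2]>%VS.
Proof.
have q12 : q1 != q2 by rewrite -(inj_eq val_inj) q1E q2E; lia.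
apply/vspaceP => X; apply/idP/vlineP => [/gradedP[XT H]|[c ->]].
  exists (X q1 q2); apply/matrixP => i j; rewrite mxE so_unit_entry.
  have [/andP[/eqP-> /eqP->]|n1] := boolP ((i == q1) && (j == q2)).
    by rewrite (negPf q12) subr0 mulr1.
  have [/andP[/eqP-> /eqP->]|n3] := boolP ((i == q2) && (j == q1)).
    by rewrite sub0r mulrN1 (entryN q1 q2 XT).
  rewrite subrr mulr0; apply: contrapT => /eqP /H [].
  have E (p : 'I_N) (q : 'I_N) : (p == q) = (val p == val q) by [].
  move: n1 n3; rewrite !E q1E q2E /=; clear; move: (nat_of_ord i) (nat_of_ord j) => a b.
  by repeat (case: eqP => ?) => //=; lia.
rewrite rpredZ //; apply/gradedP; split=> [|i j]; first exact: tr_wedge.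
rewrite so_unit_entry.
have E (p : 'I_N) (q : 'I_N) : (p == q) = (val p == val q) by [].
rewrite !E q1E q2E /=; clear; move: (nat_of_ord i) (nat_of_ord j) => a b.
case: (a =P k) => ?; case: (b =P k) => ?; case: (a =P (2 * l + 2)%N) => ?;
  case: (b =P (2 * l + 2)%N) => ?; rewrite /= ?subrr ?eqxx //; lia.
Qed.

Lemma dim_graded11 : \dim (gr 1 1) = 1%N.
Proof. by rewrite graded11 dim_vline so_unit_neq0 // -(inj_eq val_inj) q1E q2E; lia. Qed.

End Grading.

(** * Weight spaces of the toroidal algebra *)

Section LaurentCoefficients.
Variables (F : fieldType) (V : lmodType F).

Lemma laurentP (f g : laurent V) : f =1 g -> f = g.
Proof. by move=> fg; apply/val_inj/funext. Qed.

Lemma laurent0E (r : int * int) : (0 : laurent V) r = 0.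
Proof. by []. Qed.
Lemma laurentDE (f g : laurent V) r : (f + g) r = f r + g r.
Proof. by []. Qed.
Lemma laurentZE c (f : laurent V) r : (c *: f) r = c *: f r.
Proof. by []. Qed.

Lemma laurent_sumE (I : Type) (rs : seq I) (f : I -> laurent V) r :
  (\sum_(i <- rs) f i) r = \sum_(i <- rs) f i r.
Proof. exact: (big_morph (fun f : laurent V => f r)). Qed.

Lemma tmono0 r : tmono r (0 : V) = 0.
Proof. by apply: laurentP => s; rewrite /= if_same. Qed.

Lemma deriv0l (f : laurent V) : Defs.deriv 0 f = 0.
Proof. by apply: laurentP => s; rewrite /= !mul0r addr0 scale0r. Qed.

Lemma deriv_tmono0 a (v : V) : Defs.deriv a (tmono 0 v) = 0.
Proof.
apply: laurentP => s /=; case: eqP => [->|_]; last by rewrite scaler0.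
by rewrite !mulr0 addr0 scale0r.
Qed.

End LaurentCoefficients.

Section ToroidalWeights.
Variables (R : realType) (N : nat).
Local Notation C := R[i].
Variables (g : {vspace 'M[C]_N}) (s0 s1 : 'End('M[C]_N)) (n0 n1 : nat) (h : {vspace 'M[C]_N}).
Implicit Types (X Y : 'M[C]_N) (x : loop R N).

(** Both sums range over all exponents, so they are first cut down to finite sets outside which the
    terms vanish: the exponent 0 on the left, the support of [x] on the right. *)
Lemma loop_bracket_tmono0 Y x r : loop_bracket (tmono 0 Y) x r = lie Y (x r).
Proof.
rewrite /loop_bracket -(@fsbig_widen _ _ _ _ [set 0]) //; last first.
  move=> s [_ /= /eqP s0']; rewrite fsbig1 // => t _.
  by rewrite /= (negPf s0') lie0l tmono0.
have E0 : tmono (0 : int * int) Y 0 = Y by [].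
rewrite fsbig_set1 E0.
have /asboolP fin := lcoefP x.
rewrite -(@fsbig_widen _ _ _ _ [set s | x s != 0]) //; last first.
  by move=> s [_ /= /negP/negPn/eqP ->]; rewrite lie0r tmono0.
rewrite fsbig_finite // laurent_sumE /=.
have [xr|xr] := eqVneq (x r) 0.
  rewrite xr lie0r big_seq big1 // => s; rewrite in_fset_set // inE /= add0r => xs.
  by case: eqP => // rs; rewrite -rs xr eqxx in xs.
rewrite (bigD1_seq r) /=; last 2 first.
- by rewrite in_fset_set // inE.
- exact: finmap.fset_uniq.
rewrite add0r eqxx big1 ?addr0 // => s sr.
by rewrite add0r eq_sym (negPf sr).
Qed.

Lemma killing0l Y : killing g 0 Y = 0.
Proof. by rewrite /killing big1 // => i _; rewrite lie0l linear0. Qed.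

Lemma kclass0 : kclass (0 : omega1 C) = 0.
Proof. by apply: (addIr (kclass 0)); rewrite add0r -kclassD addr0. Qed.

(** Only the exponent 0 occurs on the left, and d(t^0) = 0. *)
Lemma loop_cocycle_tmono0 Y x : loop_cocycle g (tmono 0 Y) x = 0.
Proof.
rewrite /loop_cocycle fsbig1 // => r _; rewrite fsbig1 // => s _ /=.
case: eqP => [->|_]; last by rewrite killing0l scale0r.
by rewrite -[(_, _)]/(0 : C^o * C^o) tmono0 kclass0 scaler0.
Qed.

Lemma kderiv0l (z : kahler C) : kderiv 0 z = 0.
Proof. by rewrite /kderiv deriv0l kclass0. Qed.

(** [kderiv] acts through the representative chosen for the zero class, which is only known to be
    exact; the derivation commutes with d, so the result is exact too. *)
Lemma kderiv_tmono a : kderiv a (0 : kahler C) = 0.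
Proof.
have : kclass (repr (0 : kahler C)) == kclass 0 by rewrite kclassK kclass0.
rewrite kclass_eq subr0 /kderiv => /asboolP[f ->].
apply/eqP; rewrite -[X in _ == X]kclass0 kclass_eq subr0; apply/asboolP.
exists (Defs.deriv a f); apply: laurentP => r /=.
by congr (_, _); rewrite !scalerA mulrC.
Qed.

Definition loop_weight (beta : weights h) (m n : int) X :=
  [/\ X \in graded g s0 s1 n0 n1 m n, X != 0, beta.2 = (m%:~R, n%:~R) &
    forall y : subvs_of h, lie (vsval y) X = beta.1 y *: X].

Lemma weight_space_loop (beta : weights h) : beta.1 != 0 ->
  (exists2 u, weight_space g s0 s1 n0 n1 beta u & u != 0) <->
  (exists m n X, loop_weight beta m n X).
Proof.
move=> beta0; split; last first.
  case=> m [n [X [Xg X0 beta2 wX]]].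
  exists ((tmono (m, n) X : loop R N, 0), 0); last first.
    apply: contraNneq X0 => /(congr1 (fun u : ambient R N => u.1.1 (m, n))) /=.
    by rewrite eqxx => ->.
  split.
    split; last by exists [::]; rewrite big_nil.
    by move=> m' n' /=; case: eqP => [[-> ->]|_]; [exact: Xg | exact: mem0v].
  move=> y a c; rewrite /toroidal_bracket /cartan_elt.
  rewrite loop_cocycle_tmono0 kderiv_tmono kderiv0l deriv0l !subr0 addr0.
  congr (_, _, _); rewrite ?scaler0 //.
  apply: laurentP => r; rewrite laurentDE loop_bracket_tmono0 laurentZE /=.
  case: eqP => [->|_]; last by rewrite lie0r !scaler0 addr0.
  by rewrite wX -scalerDl /weight_eval beta2 /= addrA ![_%:~R * _]mulrC.
case=> -[[x z] d] [[/= xg zs] H] u0.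
have [y0 by0] : exists y, beta.1 y != 0.
  apply: contrapT => H0; move/eqP: beta0; apply; apply/lfunP => y; rewrite zero_lfunE.
  by apply: contrapT => /eqP nz; apply: H0; exists y.
have Hy y a : [/\ forall r, lie (vsval y) (x r) + (a.1 * r.1%:~R + a.2 * r.2%:~R) *: x r
      = weight_eval beta y a *: x r,
    kderiv a z - kderiv d (kclass (tmono 0 0)) = weight_eval beta y a *: z &
    0 = weight_eval beta y a *: d].
  have := H y a 0; rewrite /toroidal_bracket /cartan_elt loop_cocycle_tmono0 deriv_tmono0 subr0 add0r.
  move=> E; split.
  - move=> r; have := congr1 (fun u : ambient R N => u.1.1 r) E => /=.
    by rewrite -loop_bracket_tmono0.
  - exact: (congr1 (fun u : ambient R N => u.1.2) E).
  - exact: (congr1 (fun u : ambient R N => u.2) E).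
have ev0 y : weight_eval beta y 0 = beta.1 y by rewrite /weight_eval !mulr0 !addr0.
have d0 : d = 0.
  have [_ _ /esym/eqP] := Hy y0 0; rewrite ev0 scaler_eq0 (negPf by0) /=.
  by move/eqP.
have z0 : z = 0.
  have [_ + _] := Hy y0 0; rewrite d0 !kderiv0l subr0 ev0 => /esym/eqP.
  by rewrite scaler_eq0 (negPf by0) /= => /eqP.
have [[m n] xr] : exists r, x r != 0.
  apply: contrapT => H0; move/eqP: u0; apply; rewrite d0 z0.
  rewrite (_ : x = 0) //; apply: laurentP => r; rewrite laurent0E.
  by apply: contrapT => /eqP nz; apply: H0; exists r.
exists m, n, (x (m, n)); split=> //.
  have half a : a.1 * m%:~R + a.2 * n%:~R = beta.2.1 * a.1 + beta.2.2 * a.2.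
    have [E _ _] := Hy 0 a; have /eqP := E (m, n).
    rewrite linear0 lie0l add0r /weight_eval linear0 add0r -subr_eq0 -scalerBl.
    by rewrite scaler_eq0 (negPf xr) orbF subr_eq0 => /eqP.
  have := half (1, 0); have := half (0, 1); rewrite /= !mul0r !mulr0 !mul1r !mulr1 !add0r !addr0.
  by case: (beta.2) => b1 b2 /= -> ->.
move=> y; have [E _ _] := Hy y 0; have := E (m, n).
by rewrite ev0 /= !mul0r addr0 scale0r addr0.
Qed.

End ToroidalWeights.

Local Opaque graded.

(** * Weights on the graded pieces and the root sets *)

Section RootsOfGradedPieces.
Variables (R : realType) (l : nat).
Local Notation C := R[i].
Local Notation N := (2 * l + 3)%N.
Local Notation k := (2 * l + 1)%N.
Local Notation g := (so C N).
Local Notation gr := (graded g (sigma0 C l) (sigma1 C l) 2 2).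
Variables (h : {vspace 'M[C]_N}) (b : frame_index l -> 'rV[C]_N).
Hypothesis hb : adapted_frame k (gr 0 0) h b.
Implicit Types (a : dual h) (y : subvs_of h) (m n : int) (X : 'M[C]_N).

Let bP : hyperbolic_frame k b. Proof. by case: hb. Qed.
Let gE X : (X \in g) = (X^T == - X). Proof. exact: memv_so. Qed.
Let N3 : (2 < N)%N. Proof. lia. Qed.
Let UE := @graded00 R l.

Lemma cartan_kills (q : 'I_N) y : (k <= q)%N -> (delta_mx 0 q : 'rV[C]_N) *m vsval y = 0.
Proof.
move=> kq; rewrite -rowE; apply/rowP => j; rewrite !mxE.
have [_ /subvP hU _ _] := hb; have := hU _ (subvsP y).
by rewrite UE => /so_blockP[_ ->].
Qed.

Definition has_weight m n a := exists X,
  [/\ X \in gr m n, X != 0 & forall y, lie (vsval y) X = a y *: X].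

(** The entry of v ^ e at (b_p, e) is the pairing of [v] with b_p, and e has weight zero, so every
    weight is that of some b_p; [a != 0] discards b_0. *)
Lemma has_weight_vector (q : 'I_N) (W : {vspace 'M[C]_N}) a : (k <= q)%N -> a != 0 ->
  (forall X, X \in W <-> exists v : 'rV[C]_N,
    (forall j : 'I_N, (k <= j)%N -> v 0 j = 0) /\ X = wedge v (delta_mx 0 q)) ->
  (exists X, [/\ X \in W, X != 0 & forall y, lie (vsval y) X = a y *: X]) <->
  (exists i (s : bool), a = (-1) ^+ s *: fund_weight h b i).
Proof.
move=> kq a0 WE; have [bsupp bdot btot] := bP.
pose e := delta_mx 0 q : 'rV[C]_N.
have be p : dotp (b p) e = 0 by rewrite dotp_delta bsupp.
have ee : dotp e e = 1 by rewrite dotp_delta mxE !eqxx.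
have ey y : e *m vsval y = (0 : dual h) y *: e by rewrite zero_lfunE scale0r cartan_kills.
have entry v p : dotp (b p *m wedge v e) e = dotp (b p) v.
  by rewrite mul_wedge be scale0r subr0 dotpZl ee mulr1.
rewrite short_pairE; split.
  case=> X [/WE[v [v0 XE]] X0 aX].
  have [p nz] : exists p, dotp (b p) v != 0.
    apply: contrapT => H; move/eqP: X0; apply; rewrite XE (_ : v = 0) ?wedge0l //.
    apply: btot => // p; rewrite dotpC.
    by apply: contrapT => /eqP nz; apply: H; exists p.
  have := weight_of_entry UE hb (p := p) (x := e) (c := 0) _ aX ey.
  rewrite XE entry tr_wedge addr0 => /(_ erefl nz) aE; exists p; split=> //.
  by apply: contraNneq a0 => pN; rewrite aE pN.
case=> p [pN ->]; exists (wedge (b (opp_index p)) e); split.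
- by apply/WE; exists (b (opp_index p)); split=> [j|//]; exact: bsupp.
- apply/eqP => W0; have := entry (b (opp_index p)) p.
  by rewrite W0 mulmx0 dotp0l bdot eqxx => /esym/eqP; rewrite oner_eq0.
move=> y; rewrite (lie_wedge_eigen (cartan_antisym UE hb y) (frame_eigen hb _ y) (ey y)).
by rewrite zero_lfunE addr0 frame_weight_opp opp_lfunE opprK.
Qed.

Variables q1 q2 : 'I_N.
Hypotheses (q1E : val q1 = (2 * l + 1)%N) (q2E : val q2 = (2 * l + 2)%N).

Let kq1 : (k <= q1)%N. Proof. by have -> : nat_of_ord q1 = k by []. Qed.
Let kq2 : (k <= q2)%N. Proof. have -> : nat_of_ord q2 = (2 * l + 2)%N by []. lia. Qed.

Lemma has_weight_parity m n m' n' a : odd `|m|%N = odd `|m'|%N -> odd `|n|%N = odd `|n'|%N ->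
  has_weight m n a <-> has_weight m' n' a.
Proof.
move=> mm nn; split=> -[X [Xg X0 aX]]; exists X; (split; [|exact: X0|exact: aX]).
  exact: (graded_parity mm nn Xg).
exact: (graded_parity (esym mm) (esym nn) Xg).
Qed.

(** Only parities matter: the line in degree (1, 1) is killed by [h], the vector pieces have the
    nonzero weights +-eps_i, and degree (0, 0) carries the roots of the fixed algebra. *)
Lemma has_weightP m n a : a != 0 -> has_weight m n a <->
  if odd `|m|%N && odd `|n|%N then False
  else if odd `|m|%N || odd `|n|%N then exists i (s : bool), a = (-1) ^+ s *: fund_weight h b i
  else lie_roots (gr 0 0) h a.
Proof.
move=> a0; case mO: (odd `|m|%N); case nO: (odd `|n|%N) => /=.
- rewrite (@has_weight_parity m n 1 1) //; split=> // -[X [Xg X0 aX]].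
  move: Xg X0 aX; rewrite (@graded11 R l q1 q2 q1E q2E) => /vlineP[c ->] X0 aX.
  move/eqP: a0; apply; apply/lfunP => y; rewrite zero_lfunE.
  have := aX y; rewrite lieZr lie_wedge ?(cartan_antisym UE hb) // !cartan_kills //.
  rewrite wedge0l wedge0r addr0 oppr0 scaler0 => /esym/eqP.
  by rewrite scaler_eq0 (negPf X0) orbF => /eqP.
- by rewrite (@has_weight_parity m n 1 0) //; exact: (has_weight_vector kq2 a0 (graded10 q2E)).
- by rewrite (@has_weight_parity m n 0 1) //; exact: (has_weight_vector kq1 a0 (graded01 q1E)).
rewrite (@has_weight_parity m n 0 0) //; split=> [[X XP]|[_ [X XP]]]; last by exists X.
by split; [exact: a0 | exists X].
Qed.

(** The form ignores the delta part, and a nonzero weight on any piece is a root of the fixed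
    algebra, hence of nonzero norm; so a weight is non-isotropic exactly when [beta.1 != 0]. *)
Lemma nonisotropic_rootsP (beta : weights h) :
  nonisotropic_roots g (sigma0 C l) (sigma1 C l) 2 2 h beta <->
  lie_roots (gr 0 0) h beta.1 /\
  exists m n, beta.2 = (m%:~R, n%:~R) /\ has_weight m n beta.1.
Proof.
have form0 : dual_form g h 0 0 = 0.
  by have := dual_formZl gE UE hb 0 0 0; rewrite scale0r mul0r.
split=> [[/= f0 w]|[P [m [n [b2 wt]]]]].
  have a0 : beta.1 != 0 by apply: contraNneq f0 => E; rewrite /weight_form E form0.
  have [m [n [X [Xg X0 b2 aX]]]] := (weight_space_loop _ _ _ _ _ a0).1 w.
  have wt : has_weight m n beta.1 by exists X.
  split; last by exists m, n.
  move: ((has_weightP m n a0).1 wt); case: (_ && _) => [[]|].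
  case: (_ || _) => [S|P]; last exact: P.
  by rewrite (lie_roots_split UE hb); left; exact: S.
have a0 : beta.1 != 0 by case: P.
split; first exact: (dual_form_root_neq0 gE N3 UE hb P).
apply/(weight_space_loop _ _ _ _ _ a0); case: wt => X [Xg X0 aX].
by exists m, n, X.
Qed.

Lemma dvd2z m : (2 %| m)%Z = ~~ odd `|m|%N.
Proof. by rewrite dvdzE dvdn2. Qed.

Lemma evenz m : ~~ odd `|m|%N -> exists m', m = 2 * m'.
Proof. by rewrite -dvd2z => /dvdzP[m' ->]; exists m'; rewrite mulrC. Qed.

Lemma nonisotropic_roots_B22 : (1 < l)%N ->
  nonisotropic_roots g (sigma0 C l) (sigma1 C l) 2 2 h =
  ears_B22star (dual_form g h) (lie_roots (gr 0 0) h).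
Proof.
move=> l1; apply/seteqP; split=> beta.
  move/nonisotropic_rootsP => [P [m [n [b2 wt]]]].
  have a0 : beta.1 != 0 by case: P.
  have bE : beta = delta_shift beta.1 m n by rewrite /delta_shift -b2; case: (beta).
  (* Excluding degrees with both entries odd is the condition that [m * n] be even. *)
  have := (has_weightP m n a0).1 wt; rewrite -[_ && _]negbK -oddM -abszM -dvd2z.
  case: ifP => //= /negbFE mn.
  have short : (exists i (s : bool), beta.1 = (-1) ^+ s *: fund_weight h b i) ->
      ears_B22star (dual_form g h) (lie_roots (gr 0 0) h) beta.
    move=> S; left; exists beta.1, m, n; split=> //.
    by rewrite (short_rootsE gE N3 UE hb) ?(ltnW l1).
  case: ifP => [_ /short//|/negbT]; rewrite negb_or => /andP[/evenz[m' mE] /evenz[n' nE]].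
  rewrite {1}(lie_roots_split UE hb) => -[/short//|L]; right.
  exists beta.1, m', n'; split; last by rewrite -mE -nE.
  by rewrite (long_rootsE gE N3 UE hb).
case=> [[a [m [n [S mn bE]]]]|[a [m [n [L bE]]]]]; apply/nonisotropic_rootsP; rewrite bE /=.
  have [P _] := S; split=> //; exists m, n; split=> //.
  have a0 : a != 0 by case: P.
  apply/(has_weightP m n a0); rewrite -[_ && _]negbK -oddM -abszM -dvd2z mn /=.
  by case: ifP => // _; move: S; rewrite (short_rootsE gE N3 UE hb) ?(ltnW l1).
have [P _] := L; split=> //; exists (2 * m), (2 * n); split=> //.
have a0 : a != 0 by case: P.
by apply/(has_weightP _ _ a0); rewrite !abszM !oddM.
Qed.

Lemma nonisotropic_roots_A11 : l = 1%N ->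
  nonisotropic_roots g (sigma0 C l) (sigma1 C l) 2 2 h =
  ears_A11star (lie_roots (gr 0 0) h).
Proof.
(* A single index leaves no roots +-eps_i +- eps_j, so every root is some +-eps_i. *)
move=> l1; have short a : lie_roots (gr 0 0) h a -> exists i (s : bool), a = (-1) ^+ s *: fund_weight h b i.
  rewrite (lie_roots_split UE hb) => -[//|[i [j [s [t [ij _]]]]]].
  case/negP: ij; apply/eqP/val_inj => /=.
  have := ltn_ord i; have := ltn_ord j; move: (nat_of_ord i) (nat_of_ord j) => p q.
  by rewrite l1; case: p q => // -[].
apply/seteqP; split=> beta.
  move/nonisotropic_rootsP => [P [m [n [b2 wt]]]].
  have a0 : beta.1 != 0 by case: P.
  exists beta.1, m, n; split=> //; last by rewrite /delta_shift -b2; case: (beta).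
  have := (has_weightP m n a0).1 wt; rewrite -[_ && _]negbK -oddM -abszM -dvd2z.
  by case: ifP => //= /negbFE.
case=> a [m [n [P mn bE]]]; apply/nonisotropic_rootsP; rewrite bE /=; split=> //.
exists m, n; split=> //; have a0 : a != 0 by case: P.
apply/(has_weightP m n a0); rewrite -[_ && _]negbK -oddM -abszM -dvd2z mn /=.
by case: ifP => // _; exact: short.
Qed.

End RootsOfGradedPieces.

Theorem mainTheorem9 (R : realType) (l : nat) (hl : (1 <= l)%N) :
  let g := so R[i] (2 * l + 3) in
  let s0 := sigma0 R[i] l in
  let s1 := sigma1 R[i] l in
  let gr := graded g s0 s1 2 2 in
  [/\ simple_of_type_B l.+1 g,
      lie_automorphism g s0 /\ order_on g s0 2,
      lie_automorphism g s1 /\ order_on g s1 2 &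
      {in g, forall X, s0 (s1 X) = s1 (s0 X)}] /\
  [/\ simple_of_type_B l (gr 0 0),
      lie_irreducible (gr 0 0) (gr 0 1) /\ \dim (gr 0 1) = (2 * l + 1)%N,
      lie_irreducible (gr 0 0) (gr 1 0) /\ \dim (gr 1 0) = (2 * l + 1)%N &
      \dim (gr 1 1) = 1%N] /\
  (forall h : {vspace 'M[R[i]]_(2 * l + 3)}, cartan_subalgebra (gr 0 0) h ->
     ((2 <= l)%N ->
        nonisotropic_roots g s0 s1 2 2 h =
        ears_B22star (dual_form g h) (lie_roots (gr 0 0) h)) /\
     (l = 1%N ->
        nonisotropic_roots g s0 s1 2 2 h =
        ears_A11star (lie_roots (gr 0 0) h))).
Proof.
move=> g s0 s1 gr.
have q1P : (2 * l + 1 < 2 * l + 3)%N by lia.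
have q2P : (2 * l + 2 < 2 * l + 3)%N by lia.
pose q1 := Ordinal q1P; pose q2 := Ordinal q2P.
have n2 : 2 != 0 :> R[i] by rewrite pnatr_eq0.
have k3 : (2 < 2 * l + 1)%N by lia.
have kn : (2 * l + 1 <= 2 * l + 3)%N by lia.
have kq1 : (2 * l + 1 <= q1)%N by [].
have kq2 : (2 * l + 1 <= q2)%N by rewrite /=; lia.
have UE : gr 0 0 =i so_block (2 * l + 1) by exact: graded00.
have neq12 : (2 * l + 1 == 2 * l + 2)%N = false by lia.
split; [split|split; [split|]].
(* With [k] equal to the matrix size the condition on rows is void, so the whole algebra is the
   block of rank [l.+1]. *)
- apply: (@so_block_type_B _ _ _ (2 * l + 3)) => //; first lia.
  move=> X; rewrite memv_so; apply/eqP/so_blockP => [XT|[]//].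
  by split=> // i j; rewrite leqNgt ltn_ord.
- rewrite /s0 sigma0E; split; first by apply: lie_automorphism_sign; exact: sign0_sqr.
  apply: (@order_on_sign _ _ _ _ _ q1 q2) => //; first exact: sign0_sqr.
  by rewrite !mxE /= neq12 eqxx mul1r.
- rewrite /s1 sigma1E; split; first by apply: lie_automorphism_sign; exact: sign1_sqr.
  apply: (@order_on_sign _ _ _ _ _ q1 q2) => //; first exact: sign1_sqr.
  by rewrite !mxE /= eq_sym neq12 eqxx mulr1.
- move=> X _; rewrite /s0 /s1 sigma0E sigma1E Ad_sign_comm //.
    exact: sign0_sqr.
  exact: sign1_sqr.
- exact: so_block_type_B UE.
- have WE := graded01 (R := R) (erefl : val q1 = _).
  split; first exact: (vector_rep_irreducible k3 kn UE kq1 WE).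
  exact: (vector_rep_dim kn kq1 WE).
- have WE := graded10 (R := R) (erefl : val q2 = _).
  split; first exact: (vector_rep_irreducible k3 kn UE kq2 WE).
  exact: (vector_rep_dim kn kq2 WE).
- exact: (@dim_graded11 R l q1 q2).
move=> h /(cartan_frame erefl kn UE)[b hb]; split=> l1.
  exact: (nonisotropic_roots_B22 hb (q1 := q1) (q2 := q2)).
exact: (nonisotropic_roots_A11 hb (q1 := q1) (q2 := q2)).
Qed.
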